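(* Let $V$ be a finite-dimensional complex vector space with $\dim V\ge 3$, let $q$ be a non-degenerate quadratic form on $V$, and let $Q\subset\mathbb{P}(V)$ be the quadric defined by $q=0$. Then $S(Q)$ is isomorphic to the quotient of the homogeneous coordinate ring of the Grassmannian $\mathbb{G}(2,V)\subset \mathbb{P}(\bigwedge^2V)$ by the ideal generated by $\wedge^2q$.
   Context: For a smooth complex projective variety $X$ with tangent bundle $T_X$, $S(X):=\bigoplus_{p\ge0}H^0(X,\operatorname{Sym}^pT_X)$, a graded $\mathbb{C}$-algebra. $\mathbb{P}(V)$ is the space of lines in $V$; $\mathbb{G}(2,V)$ is the Grassmannian of $2$-dimensional subspaces of $V$ in its Plücker embedding. $\wedge^2 q$ is the quadratic form on $\bigwedge^2V$ induced by $q$, given on decomposable bivectors by $\wedge^2q(v\wedge w)=q(v,v)q(w,w)-q(v,w)^2$, where $q(\cdot,\cdot)$ is the associated symmetric bilinear form; it is viewed as an element of degree $2$ of the homogeneous coordinate ring. *)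

(* Defs.v *)
From HB Require Import structures.
From mathcomp Require Import all_boot all_order all_algebra.
From mathcomp Require Import complex.
From mathcomp Require Import boolp classical_sets functions reals.
(* mpoly and monalg declare clashing notations. *)
From mathcomp Require monalg.
Import -(notations) monalg.
From mathcomp Require Import mpoly.
From mathcomp Require Import ring.

Set Implicit Arguments.
Unset Strict Implicit.
Unset Printing Implicit Defensive.
Import GRing.Theory.
Local Open Scope classical_set_scope.
Local Open Scope ring_scope.
Local Open Scope quotient_scope.

(* A commutative K-algebra, given by its structure morphism, with a family of
   subsets in the role of homogeneous components.  ([comAlgType] is not usable
   here: it requires 1 <> 0, which fails e.g. for the ring of sections over the
   empty variety.) *)
Record gralg (K : fieldType) := GrAlg {
  gralg_ring :> comPzRingType;
  gralg_scal : {rmorphism K -> gralg_ring};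
  gralg_comp : nat -> set gralg_ring
}.
Arguments gralg_scal {K} A : rename.
Arguments gralg_comp {K} A p : rename.

Definition gralg_isomorphic (K : fieldType) (A B : gralg K) : Prop :=
  exists f : {rmorphism A -> B},
    [/\ bijective f,
        forall c, f (gralg_scal A c) = gralg_scal B c
      & forall p, f @` gralg_comp A p = gralg_comp B p].

(* Finite sums of multiples of elements of E. *)
Inductive ideal_gen (A : pzRingType) (E : set A) : A -> Prop :=
| Ideal_gen0 : ideal_gen E 0
| Ideal_genD a e x : E e -> ideal_gen E x -> ideal_gen E (a * e + x).

Section Quotient.
Variables (A : comPzRingType) (E : set A).
Local Notation I := (ideal_gen E).

Lemma ideal_gen_add x y : I x -> I y -> I (x + y).
Proof.
elim=> [|a e z Ee _ IH] Iy; first by rewrite add0r.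
by rewrite -addrA; apply: Ideal_genD => //; apply: IH.
Qed.

Lemma ideal_gen_mul b x : I x -> I (b * x).
Proof.
elim=> [|a e z Ee _ IH]; first by rewrite mulr0; exact: Ideal_gen0.
by rewrite mulrDr mulrA; apply: Ideal_genD.
Qed.

Lemma ideal_gen_opp x : I x -> I (- x).
Proof. by rewrite -mulN1r; exact: ideal_gen_mul. Qed.

Definition ideal_eq : rel A := fun x y => `[< I (x - y) >].

Lemma ideal_eq_equiv : equiv_class_of ideal_eq.
Proof.
split=> [x|x y|y x z].
- by apply/asboolP; rewrite subrr; exact: Ideal_gen0.
- by apply/asboolP/asboolP=> /ideal_gen_opp; rewrite opprB.
- move=> /asboolP xy /asboolP yz; apply/asboolP.
  by have := ideal_gen_add xy yz; rewrite addrA subrK.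
Qed.
Canonical ideal_eq_canonical := EquivRelPack ideal_eq_equiv.

(* The quotient of A by the ideal generated by E. *)
Definition quot_ring := {eq_quot ideal_eq}.
HB.instance Definition _ := Choice.on quot_ring.
HB.instance Definition _ : EqQuotient A ideal_eq quot_ring :=
  EqQuotient.on quot_ring.

Lemma quot_ringP (x y : A) : I (x - y) <-> \pi_quot_ring x = \pi_quot_ring y.
Proof.
split=> [Ixy|/eqmodP]; first by apply/eqmodP/asboolP.
by move=> /asboolP.
Qed.

(* The operations are locked: unification must not unfold them. *)
Fact quot_key : unit. Proof. by []. Qed.

Definition quot_map : A -> quot_ring :=
  locked_with quot_key (fun x => \pi_quot_ring x).
Definition quot_add : quot_ring -> quot_ring -> quot_ring :=
  locked_with quot_key (fun x y => quot_map (repr x + repr y)).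
Definition quot_opp : quot_ring -> quot_ring :=
  locked_with quot_key (fun x => quot_map (- repr x)).
Definition quot_mul : quot_ring -> quot_ring -> quot_ring :=
  locked_with quot_key (fun x y => quot_map (repr x * repr y)).

Lemma quot_mapE x : quot_map x = \pi_quot_ring x.
Proof. by rewrite /quot_map unlock. Qed.

Lemma quot_mapP (x y : A) : I (x - y) <-> quot_map x = quot_map y.
Proof. by rewrite !quot_mapE; exact: quot_ringP. Qed.

Let reprqK (x : quot_ring) : quot_map (repr x) = x.
Proof. by rewrite quot_mapE; exact: reprK. Qed.

Let reprq x : I (repr (quot_map x) - x).
Proof. by apply/quot_mapP; rewrite reprqK. Qed.

Let add_map x y : quot_add (quot_map x) (quot_map y) = quot_map (x + y).
Proof.
rewrite /quot_add unlock; apply/quot_mapP; rewrite opprD addrACA.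
by apply: ideal_gen_add; exact: reprq.
Qed.

Let opp_map x : quot_opp (quot_map x) = quot_map (- x).
Proof.
rewrite /quot_opp unlock; apply/quot_mapP; rewrite -opprD.
by apply: ideal_gen_opp.
Qed.

Let mul_map x y : quot_mul (quot_map x) (quot_map y) = quot_map (x * y).
Proof.
rewrite /quot_mul unlock; apply/quot_mapP; set x' := repr _; set y' := repr _.
have -> : x' * y' - x * y = x' * (y' - y) + y * (x' - x).
  by rewrite !mulrBr (mulrC y x') (mulrC y x) addrA subrK.
by apply: ideal_gen_add; apply: ideal_gen_mul; exact: reprq.
Qed.

Let addqA : associative quot_add.
Proof.
by move=> x y z; rewrite -(reprqK x) -(reprqK y) -(reprqK z) !add_map addrA.
Qed.
Let addqC : commutative quot_add.
Proof. by move=> x y; rewrite -(reprqK x) -(reprqK y) !add_map addrC. Qed.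
Let add0q : left_id (quot_map 0) quot_add.
Proof. by move=> x; rewrite -(reprqK x) add_map add0r. Qed.
Let addNq : left_inverse (quot_map 0) quot_opp quot_add.
Proof. by move=> x; rewrite -(reprqK x) opp_map add_map addNr. Qed.
HB.instance Definition _ :=
  GRing.isZmodule.Build quot_ring addqA addqC add0q addNq.

Let mulqA : associative quot_mul.
Proof.
by move=> x y z; rewrite -(reprqK x) -(reprqK y) -(reprqK z) !mul_map mulrA.
Qed.
Let mulqC : commutative quot_mul.
Proof. by move=> x y; rewrite -(reprqK x) -(reprqK y) !mul_map mulrC. Qed.
Let mul1q : left_id (quot_map 1) quot_mul.
Proof. by move=> x; rewrite -(reprqK x) mul_map mul1r. Qed.
Let mulqDl : left_distributive quot_mul quot_add.
Proof.
move=> x y z; rewrite -(reprqK x) -(reprqK y) -(reprqK z).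
by rewrite !(add_map, mul_map) mulrDl.
Qed.
HB.instance Definition _ :=
  GRing.Zmodule_isComPzRing.Build quot_ring mulqA mulqC mul1q mulqDl.

Lemma quot_map_zmod_morphism : zmod_morphism quot_map.
Proof. by move=> x y; rewrite -add_map -opp_map. Qed.
Lemma quot_map_monoid_morphism : monoid_morphism quot_map.
Proof. by split=> // x y; rewrite -mul_map. Qed.
HB.instance Definition _ :=
  GRing.isZmodMorphism.Build A quot_ring quot_map quot_map_zmod_morphism.
HB.instance Definition _ :=
  GRing.isMonoidMorphism.Build A quot_ring quot_map quot_map_monoid_morphism.

Lemma quot_map_eq0 (x : A) : quot_map x = 0 <-> I x.
Proof. by rewrite -[in I x](subr0 x) quot_mapP raddf0. Qed.

End Quotient.

Definition gralg_quot (K : fieldType) (A : gralg K) (E : set A) : gralg K :=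
  @GrAlg K (quot_ring E) (quot_map E \o gralg_scal A)
    (fun p => quot_map E @` gralg_comp A p).

Arguments gralg_quot {K} A E.

(* Sym W: the free commutative K-algebra on the set W, modulo the relations
   making W -> Sym W linear. *)
Section SymmetricAlgebra.
Variables (K : fieldType) (W : lmodType K).

Definition free_com_alg := malg (cmonom W) K.
HB.instance Definition _ := GRing.ComNzRing.on free_com_alg.
HB.instance Definition _ := GRing.Lmodule.on free_com_alg.

Definition sym_var (w : W) : free_com_alg :=
  @mkmalgU (cmonom W) K (ucm w) 1.

Definition sym_rel : set free_com_alg :=
  [set r | (exists u v, r = sym_var (u + v) - (sym_var u + sym_var v))
        \/ (exists a u, r = sym_var (a *: u) - a *: sym_var u)].

Definition sym_alg := quot_ring sym_rel.
HB.instance Definition _ := GRing.ComPzRing.on sym_alg.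

Definition sym_scal (c : K) : sym_alg :=
  quot_map sym_rel (malgC c : free_com_alg).

Lemma sym_scal_zmod_morphism : zmod_morphism sym_scal.
Proof. by move=> c d; rewrite /sym_scal !raddfB. Qed.
Lemma sym_scal_monoid_morphism : monoid_morphism sym_scal.
Proof.
split=> [|c d]; first exact: (rmorph1 (quot_map sym_rel)).
rewrite /sym_scal (monalg.mpolyCM (cmonom W) c d : malgC (c * d) = _).
exact: (rmorphM (quot_map sym_rel)).
Qed.
HB.instance Definition _ :=
  GRing.isZmodMorphism.Build K sym_alg sym_scal sym_scal_zmod_morphism.
HB.instance Definition _ :=
  GRing.isMonoidMorphism.Build K sym_alg sym_scal sym_scal_monoid_morphism.

Definition sym_in (w : W) : sym_alg := quot_map sym_rel (sym_var w).

End SymmetricAlgebra.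

(* Projective varieties over an algebraically closed field are treated as sets
   of closed points. *)
Section Projective.
Variables (K : fieldType) (W : vectType K).

(* P(W), the space of lines in W. *)
Definition proj := {L : {vspace W} | \dim L == 1%N}.

(* The homogeneous coordinates on W are those of the basis [vbasis {:W}]. *)
Definition poly_fun (f : {mpoly K[\dim {:W}]}) (w : W) : K :=
  f.@[fun i => coord (vbasis {:W}) i w].

(* Value at a chosen nonzero vector of the line L: for f and g homogeneous of
   the same degree, whether [hval f L] vanishes and the quotient
   [hval f L / hval g L] are independent of the choice. *)
Definition hval (f : {mpoly K[\dim {:W}]}) (L : proj) : K :=
  poly_fun f (vpick (val L)).

Definition vanishing_forms (Z : set proj) : set {mpoly K[\dim {:W}]} :=
  [set f | exists d, f \is d.-homog /\ forall L, Z L -> hval f L = 0].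

Definition poly_gralg : gralg K :=
  @GrAlg K {mpoly K[\dim {:W}]} (@mpolyC _ K)
    (fun d => [set f | f \is d.-homog]).

Definition coord_ring (Z : set proj) : gralg K :=
  @gralg_quot K poly_gralg (vanishing_forms Z).

Definition coord_class (Z : set proj) (f : {mpoly K[\dim {:W}]}) :
  coord_ring Z := quot_map (vanishing_forms Z) f.

(* The degree 2 form w |-> b w w. *)
Definition form_mpoly (b : W -> W -> K) : {mpoly K[\dim {:W}]} :=
  \sum_(i < \dim {:W}) \sum_(j < \dim {:W})
    b (vbasis {:W})`_i (vbasis {:W})`_j *: ('X_i * 'X_j).

End Projective.

Section DependentProduct.
Variables (I : Type) (A : I -> comPzRingType).

Definition dprod := forall i, A i.
HB.instance Definition _ := gen_eqMixin dprod.
HB.instance Definition _ := gen_choiceMixin dprod.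

Let zerod : dprod := fun=> 0.
Let oned : dprod := fun=> 1.
Let oppd (s : dprod) : dprod := fun i => - s i.
Let addd (s t : dprod) : dprod := fun i => s i + t i.
Let muld (s t : dprod) : dprod := fun i => s i * t i.

Let adddA : associative addd.
Proof. by move=> s t u; apply: functional_extensionality_dep => i; exact: addrA. Qed.
Let adddC : commutative addd.
Proof. by move=> s t; apply: functional_extensionality_dep => i; exact: addrC. Qed.
Let add0d : left_id zerod addd.
Proof. by move=> s; apply: functional_extensionality_dep => i; exact: add0r. Qed.
Let addNd : left_inverse zerod oppd addd.
Proof. by move=> s; apply: functional_extensionality_dep => i; exact: addNr. Qed.
HB.instance Definition _ := GRing.isZmodule.Build dprod adddA adddC add0d addNd.

Let muldA : associative muld.
Proof. by move=> s t u; apply: functional_extensionality_dep => i; exact: mulrA. Qed.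
Let muldC : commutative muld.
Proof. by move=> s t; apply: functional_extensionality_dep => i; exact: mulrC. Qed.
Let mul1d : left_id oned muld.
Proof. by move=> s; apply: functional_extensionality_dep => i; exact: mul1r. Qed.
Let muldDl : left_distributive muld addd.
Proof. by move=> s t u; apply: functional_extensionality_dep => i; exact: mulrDl. Qed.
HB.instance Definition _ :=
  GRing.Zmodule_isComPzRing.Build dprod muldA muldC mul1d muldDl.

End DependentProduct.

Lemma prod_split (S : comPzRingType) p q (F : 'I_p -> S) (G : 'I_q -> S)
    (H : 'I_(p + q) -> S) :
  (forall i, H (lshift q i) = F i) -> (forall i, H (rshift p i) = G i) ->
  \prod_i H i = (\prod_i F i) * (\prod_i G i).
Proof.
by move=> HF HG; rewrite big_split_ord; congr (_ * _); apply: eq_bigr => i _.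
Qed.

Lemma sum_prod4 (S : comPzRingType) (I J : finType) (a b : I -> S) (c d : J -> S) :
  (\sum_i a i * b i) * (\sum_j c j * d j) =
  \sum_(k : I * J) (a k.1 * c k.2) * (b k.1 * d k.2).
Proof.
rewrite big_distrlr pair_big; apply: eq_bigr => k _; exact: mulrACA.
Qed.

Section SymmetricTensors.
Variables (K : fieldType) (W : vectType K) (X : set (proj W)).

Local Notation point := (set_type X).
Local Notation form := {mpoly K[\dim {:W}]}.
Local Notation fn := (point -> K).

(* P holds at all points of a Zariski neighbourhood of x in X; the open subsets
   h <> 0, for h homogeneous, form a basis of the Zariski topology. *)
Definition zariski_near (x : point) (P : point -> Prop) : Prop :=
  exists (h : form) (d : nat),
    [/\ h \is d.-homog, hval h (val x) != 0
      & forall y : point, hval h (val y) != 0 -> P y].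

Definition regular_at (F : fn) (x : point) : Prop :=
  exists (f g : form) (d : nat),
    [/\ f \is d.-homog, g \is d.-homog
      & zariski_near x (fun y => hval g (val y) != 0 /\
                                F y = hval f (val y) / hval g (val y))].

(* The K-derivations from the local ring of X at x to K.  Elements of the local
   ring are represented by functions on X regular at x, two of them being
   identified when they agree near x; functions not regular at x are
   mapped to 0 so that a derivation has a single representative. *)
Definition is_tangent (x : point) (v : fn -> K^o) : Prop :=
  [/\ forall (a : K) F G, regular_at F x -> regular_at G x ->
        v (fun y => a * F y + G y) = a * v F + v G,
      forall F G, regular_at F x -> regular_at G x ->
        v (fun y => F y * G y) = F x * v G + G x * v F,
      forall F G, regular_at F x -> regular_at G x ->
        zariski_near x (fun y => F y = G y) -> v F = v G
    & forall F, ~ regular_at F x -> v F = 0].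

Definition tangent_pred (x : point) : {pred fn -> K^o} :=
  fun v => `[< is_tangent x v >].

Lemma tangent_submod_closed (x : point) : submod_closed (tangent_pred x).
Proof.
split; first by apply/asboolP; split=> *; rewrite /= ?mulr0 ?addr0.
move=> c u v /asboolP[u1 u2 u3 u4] /asboolP[v1 v2 v3 v4].
have E F : (c *: u + v) F = c * u F + v F by [].
apply/asboolP; split=> [a F G rF rG|F G rF rG|F G rF rG FG|F rF]; rewrite !E.
- rewrite u1 // v1 // !mulrDr addrACA; congr (_ + _).
  by rewrite mulrCA.
- by rewrite u2 // v2 // !mulrDr addrACA; congr (_ + _ + _);
    rewrite mulrCA.
- by rewrite (u3 _ _ rF rG FG) (v3 _ _ rF rG FG).
- by rewrite u4 // v4 // mulr0 addr0.
Qed.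
HB.instance Definition _ (x : point) :=
  GRing.isSubmodClosed.Build K (fn -> K^o) (tangent_pred x)
    (tangent_submod_closed x).

(* The tangent space of X at x. *)
Record tangent_space (x : point) := Tangent {
  tangent_val :> fn -> K^o;
  _ : tangent_val \in tangent_pred x
}.
HB.instance Definition _ (x : point) := [isSub for @tangent_val x].
HB.instance Definition _ (x : point) := [Choice of tangent_space x by <:].
HB.instance Definition _ (x : point) :=
  [SubChoice_isSubLmodule of tangent_space x by <:].

Definition tensor_field := dprod (fun x : point => sym_alg (tangent_space x)).
HB.instance Definition _ := GRing.ComPzRing.on tensor_field.

(* Not necessarily regular; regularity on an open set U means
   [regular_field_at] at all points of U, and then D is a derivation of the
   sheaf of regular functions on U. *)
Definition vector_field := forall x : point, tangent_space x.

Definition regular_field_at (D : vector_field) (x : point) : Prop :=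
  forall F, regular_at F x -> regular_at (fun y => D y F) x.

(* s is a section of Sym^p T_X over X, for X smooth: its value at x lies in
   Sym^p (T_x X) and, locally, it is a combination of p-fold products of regular
   vector fields with regular coefficients. *)
Definition is_sym_tensor (p : nat) (s : tensor_field) : Prop :=
  forall x, exists (m : nat) (a : 'I_m -> fn)
                   (D : 'I_m -> 'I_p -> vector_field),
    zariski_near x (fun y =>
      [/\ forall k, regular_at (a k) y,
          forall k i, regular_field_at (D k i) y
        & s y = \sum_k sym_scal _ (a k y) * \prod_i sym_in (D k i y)]).

(* The sum over p is direct, as each Sym (T_x X) is graded. *)
Inductive is_sym_tensor_sum : tensor_field -> Prop :=
| Sym_tensor_sum0 : is_sym_tensor_sum 0
| Sym_tensor_sumD p s t :
    is_sym_tensor p s -> is_sym_tensor_sum t -> is_sym_tensor_sum (s + t).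

Lemma zariski_near_and x P Q : zariski_near x P -> zariski_near x Q ->
  zariski_near x (fun y => P y /\ Q y).
Proof.
have hvalM f g L : hval (f * g) L = hval f L * hval g L.
  by rewrite /hval /poly_fun mevalM.
move=> [f [d [fh fx fP]]] [g [e [gh gx gQ]]]; exists (f * g), (d + e)%N.
split; [exact: dhomogM | by rewrite hvalM mulf_neq0 |].
move=> y; rewrite hvalM mulf_eq0 negb_or => /andP[fy gy].
by split; [exact: fP | exact: gQ].
Qed.

Lemma zariski_nearW x (P Q : point -> Prop) :
  (forall y, P y -> Q y) -> zariski_near x P -> zariski_near x Q.
Proof.
by move=> PQ [f [d [fh fx fP]]]; exists f, d; split=> // y /fP /PQ.
Qed.

Lemma zariski_nearT x (P : point -> Prop) : (forall y, P y) -> zariski_near x P.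
Proof.
move=> PT; exists 1, 0%N; split=> //; first exact: dhomog1.
by rewrite /hval /poly_fun meval1 oner_neq0.
Qed.

Lemma regular_at_cst (c : K) x : regular_at (fun=> c) x.
Proof.
exists c%:MP, 1, 0%N; split; [|exact: dhomog1|].
  by rewrite -[c%:MP]mulr1 mul_mpolyC rpredZ ?dhomog1.
apply: zariski_nearT => y.
by rewrite /hval /poly_fun mevalC meval1 oner_neq0 divr1.
Qed.

Lemma regular_atM F G x :
  regular_at F x -> regular_at G x -> regular_at (fun y => F y * G y) x.
Proof.
move=> [f [g [d [fh gh FE]]]] [f' [g' [d' [fh' gh' GE]]]].
exists (f * f'), (g * g'), (d + d')%N; split; [exact: dhomogM..|].
apply: zariski_nearW (zariski_near_and FE GE) => y [[gy ->] [gy' ->]].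
rewrite /hval /poly_fun !mevalM mulf_neq0 //; split=> //.
by rewrite invfM mulrACA.
Qed.

(* Local expressions with an arbitrary finite type of indices. *)
Lemma is_sym_tensor_fin p (s : tensor_field) :
  (forall x, exists (T : finType) (a : T -> fn) (D : T -> 'I_p -> vector_field),
    zariski_near x (fun y =>
      [/\ forall k, regular_at (a k) y,
          forall k i, regular_field_at (D k i) y
        & s y = \sum_k sym_scal _ (a k y) * \prod_i sym_in (D k i y)])) ->
  is_sym_tensor p s.
Proof.
move=> H x; have [T [a [D aD]]] := H x.
exists #|T|, (a \o enum_val), (D \o enum_val).
apply: zariski_nearW aD => y [ra rD ->]; split=> //=.
rewrite [RHS](reindex enum_rank) /=; last first.
  by apply: onW_bij; exact: enum_rank_bij.
by apply: eq_bigr => k _; rewrite enum_rankK.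
Qed.

Definition scal_field (c : K) : tensor_field :=
  fun x => sym_scal (tangent_space x) c.

Lemma is_sym_tensor_scal (c : K) : is_sym_tensor 0 (scal_field c).
Proof.
apply: is_sym_tensor_fin => x; exists unit, (fun=> fun=> c), (fun _ _ _ => 0).
apply: zariski_nearT => y; split=> [_|_ []//|]; first exact: regular_at_cst.
by rewrite (big_pred1 tt) ?big_ord0 ?mulr1 //; case.
Qed.

Lemma is_sym_tensorM p q s t :
  is_sym_tensor p s -> is_sym_tensor q t -> is_sym_tensor (p + q) (s * t).
Proof.
move=> Hs Ht; apply: is_sym_tensor_fin => x.
have [m [a [D aD]]] := Hs x; have [n [b [E bE]]] := Ht x.
exists ('I_m * 'I_n)%type, (fun k y => a k.1 y * b k.2 y),
  (fun k (i : 'I_(p + q)) => match fintype.split i with inl j => D k.1 j | inr j => E k.2 j end).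
apply: zariski_nearW (zariski_near_and aD bE) => y [[ra rD sE] [rb rE tE]].
split=> [k|k i|]; first exact: regular_atM.
  by case: (fintype.split i) => j.
transitivity (s y * t y); first by [].
rewrite sE tE sum_prod4; apply: eq_bigr => k _; congr (_ * _).
  exact: (esym (rmorphM (sym_scal (tangent_space y)) _ _)).
apply/esym/prod_split => i.
  by rewrite (unsplitK (inl i) : fintype.split (lshift q i) = inl i).
by rewrite (unsplitK (inr i) : fintype.split (rshift p i) = inr i).
Qed.

Lemma is_sym_tensor_sumD s t :
  is_sym_tensor_sum s -> is_sym_tensor_sum t -> is_sym_tensor_sum (s + t).
Proof.
elim=> [|p u v pu _ IH] St; first by rewrite add0r.
by rewrite -addrA; apply: Sym_tensor_sumD pu _; exact: IH.
Qed.

Lemma is_sym_tensor_sum1 p s : is_sym_tensor p s -> is_sym_tensor_sum s.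
Proof.
by move=> ps; rewrite -[s]addr0; apply: Sym_tensor_sumD ps _;
  exact: Sym_tensor_sum0.
Qed.

Lemma is_sym_tensor_sumM s t :
  is_sym_tensor_sum s -> is_sym_tensor_sum t -> is_sym_tensor_sum (s * t).
Proof.
move=> Ss; elim=> [|p u v pu _ IH]; first by rewrite mulr0; exact: Sym_tensor_sum0.
rewrite mulrDr; apply: is_sym_tensor_sumD IH.
elim: Ss => [|q u' v' qu' _ IH]; first by rewrite mul0r; exact: Sym_tensor_sum0.
by rewrite mulrDl; apply: Sym_tensor_sumD IH; exact: is_sym_tensorM qu' pu.
Qed.

Lemma is_sym_tensor_sum_scal c : is_sym_tensor_sum (scal_field c).
Proof. exact: is_sym_tensor_sum1 (is_sym_tensor_scal c). Qed.

Lemma scal_field1 : scal_field 1 = 1.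
Proof.
apply: functional_extensionality_dep => x.
exact: (rmorph1 (sym_scal (tangent_space x))).
Qed.

Lemma scal_fieldM c d : scal_field (c * d) = scal_field c * scal_field d.
Proof.
apply: functional_extensionality_dep => x.
exact: (rmorphM (sym_scal (tangent_space x))).
Qed.

Lemma scal_fieldB c d : scal_field (c - d) = scal_field c - scal_field d.
Proof.
apply: functional_extensionality_dep => x.
exact: (rmorphB (sym_scal (tangent_space x))).
Qed.

Definition sym_tensor_sum_pred : {pred tensor_field} :=
  fun s => `[< is_sym_tensor_sum s >].

Lemma sym_tensor_sum_subring_closed : subring_closed sym_tensor_sum_pred.
Proof.
have c1 : is_sym_tensor_sum 1 by rewrite -scal_field1; exact: is_sym_tensor_sum_scal.
have cN1 : is_sym_tensor_sum (-1).
  have -> : -1 = scal_field (0 - 1) :> tensor_field.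
    by rewrite scal_fieldB -[in scal_field 0](subrr 1) scal_fieldB subrr
      scal_field1 add0r.
  exact: is_sym_tensor_sum_scal.
split=> [|s t /asboolP Ss /asboolP St|s t /asboolP Ss /asboolP St];
  apply/asboolP => //; last exact: is_sym_tensor_sumM.
rewrite -[- t]mulN1r; apply: is_sym_tensor_sumD => //.
exact: is_sym_tensor_sumM.
Qed.
HB.instance Definition _ :=
  GRing.isSubringClosed.Build tensor_field sym_tensor_sum_pred
    sym_tensor_sum_subring_closed.

Record sym_tensor_ring := SymTensor {
  sym_tensor_val :> tensor_field;
  _ : sym_tensor_val \in sym_tensor_sum_pred
}.
HB.instance Definition _ := [isSub for sym_tensor_val].
HB.instance Definition _ := [Choice of sym_tensor_ring by <:].
HB.instance Definition _ :=
  GRing.SubChoice_isSubComPzRing.Build tensor_field sym_tensor_sum_pred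
    sym_tensor_ring sym_tensor_sum_subring_closed.

Definition sym_tensor_scal (c : K) : sym_tensor_ring :=
  SymTensor (asboolT (is_sym_tensor_sum_scal c)).

Lemma sym_tensor_scal_zmod_morphism : zmod_morphism sym_tensor_scal.
Proof. by move=> c d; apply/val_inj/scal_fieldB. Qed.
Lemma sym_tensor_scal_monoid_morphism : monoid_morphism sym_tensor_scal.
Proof.
by split=> [|c d]; apply: val_inj; [exact: scal_field1 | exact: scal_fieldM].
Qed.
HB.instance Definition _ :=
  GRing.isZmodMorphism.Build K sym_tensor_ring sym_tensor_scal
    sym_tensor_scal_zmod_morphism.
HB.instance Definition _ :=
  GRing.isMonoidMorphism.Build K sym_tensor_ring sym_tensor_scal
    sym_tensor_scal_monoid_morphism.

(* S(X), the direct sum of the H^0(X, Sym^p T_X). *)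
Definition sym_tensor_gralg : gralg K :=
  @GrAlg K sym_tensor_ring sym_tensor_scal
    (fun p => [set s | is_sym_tensor p (val s)]).

End SymmetricTensors.

Section Quadrics.
Variables (K : fieldType) (V : vectType K).
Implicit Types (q : V -> K) (v w : V).

(* The symmetric bilinear form with polar q v v = q v. *)
Definition polar q v w : K := (q (v + w) - q v - q w) / 2%:R.

Definition quadratic_form q : Prop :=
  (forall a v, q (a *: v) = a ^+ 2 * q v) /\
  (forall a u v w, polar q (a *: u + v) w = a * polar q u w + polar q v w).

Definition nondegenerate_quad q : Prop :=
  forall v, (forall w, polar q v w = 0) -> v = 0.

Definition quadric q : set (proj V) :=
  [set L : proj V | forall v, v \in val L -> q v = 0].

Local Notation n := (\dim {:V}).
Local Notation "e_[ i ]" := ((vbasis {:V})`_i).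

Definition pairs := {p : 'I_n * 'I_n | (p.1 < p.2)%N}.

(* The exterior square of V: coordinates in the basis of the e_i ^ e_j, i < j,
   where e = vbasis {:V}. *)
Definition ext2 := {ffun pairs -> K^o}.

Definition wedge v w : ext2 :=
  let x := coord (vbasis {:V}) in
  [ffun p : pairs => x (val p).1 v * x (val p).2 w - x (val p).2 v * x (val p).1 w].

(* G(2, V) in its Pluecker embedding. *)
Definition grassmannian2 : set (proj ext2) :=
  [set L : proj ext2 | exists v w, free [:: v; w] /\ val L = <[wedge v w]>%VS].

(* The bilinear extension of
   (v ^ w, v' ^ w') |-> q(v, v') q(w, w') - q(v, w') q(w, v'). *)
Definition ext2_form q (eta theta : ext2) : K :=
  \sum_(p : pairs) \sum_(r : pairs) eta p * theta r *
    (polar q e_[(val p).1] e_[(val r).1] * polar q e_[(val p).2] e_[(val r).2]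
   - polar q e_[(val p).1] e_[(val r).2] * polar q e_[(val p).2] e_[(val r).1]).

Definition ext2_quadric q : {mpoly K[\dim {:ext2}]} := form_mpoly (ext2_form q).

End Quadrics.
Arguments grassmannian2 {K} V.

Lemma poly_fun_form (K : fieldType) (W : vectType K) (b : W -> W -> K) w :
  (forall u, linear (b u : W -> K^o)) -> (forall u, linear (b^~ u : W -> K^o)) ->
  poly_fun (form_mpoly b) w = b w w.
Proof.
move=> br bl.
have sumr u (F : 'I_(\dim {:W}) -> K) (e : 'I_(\dim {:W}) -> W) :
    b u (\sum_i F i *: e i) = \sum_i F i * b u (e i).
  pose f := HB.pack_for {linear W -> K^o} (b u : W -> K^o)
    (GRing.isLinear.Build K W K^o _ (b u) (br u)).
  rewrite -[b u]/(f : W -> K^o) linear_sum; apply: eq_bigr => i _.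
  by rewrite linearZ.
have suml u (F : 'I_(\dim {:W}) -> K) (e : 'I_(\dim {:W}) -> W) :
    b (\sum_i F i *: e i) u = \sum_i F i * b (e i) u.
  pose f := HB.pack_for {linear W -> K^o} (b^~ u : W -> K^o)
    (GRing.isLinear.Build K W K^o _ (b^~ u) (bl u)).
  rewrite -[LHS]/(f _) linear_sum; apply: eq_bigr => i _.
  by rewrite linearZ.
rewrite {2}(coord_vbasis (memvf w)) {3}(coord_vbasis (memvf w)) suml.
rewrite /poly_fun /form_mpoly raddf_sum; apply: eq_bigr => i _.
rewrite raddf_sum sumr big_distrr; apply: eq_bigr => j _ /=.
by rewrite mevalZ mevalM !mevalXU mulrC mulrA.
Qed.

Lemma sum_pairs (S : comPzRingType) m (x y : 'I_m -> S) (G : 'I_m -> 'I_m -> S) :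
  (forall i, G i i = 0) -> (forall i j, G i j = - G j i) ->
  \sum_(p : {p : 'I_m * 'I_m | (p.1 < p.2)%N})
    (x (val p).1 * y (val p).2 - x (val p).2 * y (val p).1)
      * G (val p).1 (val p).2
  = \sum_i \sum_j x i * y j * G i j.
Proof.
move=> Gd Ga.
pose A := [pred p : 'I_m * 'I_m | (p.1 < p.2)%N].
rewrite -(@big_sub _ _ _ _ A (fun p => (x p.1 * y p.2 - x p.2 * y p.1) * G p.1 p.2)).
rewrite pair_big [RHS](bigID A) /=.
rewrite [X in _ = _ + X](bigID (fun p : 'I_m * 'I_m => p.1 == p.2)) /=.
rewrite [X in _ = _ + (X + _)]big1 ?add0r; last first.
  by move=> [i j] /= /andP[_ /eqP->]; rewrite Gd mulr0.
rewrite [X in _ = _ + X](reindex_inj (h := fun p : 'I_m * 'I_m => (p.2, p.1))); last first.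
  by move=> [i j] [k l] /= [-> ->].
rewrite [X in _ = _ + X](eq_bigl A) /=; last first.
  by move=> [i j]; rewrite inE /= -leqNgt andbC -(inj_eq val_inj) /= eq_sym ltn_neqAle.
rewrite -big_split; apply: eq_bigr => -[i j] _ /=.
by rewrite mulrBl (Ga j i) mulrN.
Qed.

Lemma sum_minor (S : comPzRingType) (I : finType) (a b f g : I -> S) :
  \sum_k \sum_l a k * b l * (f k * g l - f l * g k) =
  (\sum_k a k * f k) * (\sum_l b l * g l) - (\sum_l b l * f l) * (\sum_k a k * g k).
Proof.
rewrite [X in _ - X]mulrC !big_distrlr -sumrB; apply: eq_bigr => k _ /=.
rewrite -sumrB; apply: eq_bigr => l _ /=.
rewrite mulrBr; congr (_ - _); first exact: mulrACA.
by rewrite (mulrC (f l)) mulrACA.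
Qed.

Section Ext2Quadric.
Variables (K : fieldType) (V : vectType K) (q : V -> K).
Hypotheses (K2 : 2%:R != 0 :> K) (qq : quadratic_form q).

Let polarC v w : polar q v w = polar q w v.
Proof. by rewrite /polar (addrC v) addrAC. Qed.

Let polarD v w u : polar q (v + w) u = polar q v u + polar q w u.
Proof. by have := qq.2 1 v w u; rewrite scale1r mul1r. Qed.

Let polar0 u : polar q 0 u = 0.
Proof. by apply: (addIr (polar q 0 u)); rewrite -polarD addr0 add0r. Qed.

Let polarZ a v u : polar q (a *: v) u = a * polar q v u.
Proof. by have := qq.2 a v 0 u; rewrite !addr0 polar0 addr0. Qed.

Let polar_suml m (c : 'I_m -> K) (e : 'I_m -> V) u :
  polar q (\sum_i c i *: e i) u = \sum_i c i * polar q (e i) u.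
Proof.
elim/big_rec2: _ => [|i a v _ <-]; first exact: polar0.
by rewrite polarD polarZ.
Qed.

Lemma polar_id v : polar q v v = q v.
Proof.
rewrite /polar -mulr2n -scaler_nat qq.1 -[X in _ - X]mul1r -[X in _ - X - _]mul1r.
rewrite -!mulrBl expr2 -!addrA -opprD -[1 + 1]/(2%:R) -{3}[2%:R]mulr1 -mulrBr.
rewrite mulrAC (_ : 2%:R - 1 = 1 :> K) ?mulr1 ?divff ?mul1r //.
by rewrite -[2%:R]/(1 + 1) addrK.
Qed.

Lemma ext2_form_wedge v w v' w' :
  ext2_form q (wedge v w) (wedge v' w') =
  polar q v v' * polar q w w' - polar q v w' * polar q w v'.
Proof.
pose c := coord (vbasis {:V}); pose e (i : 'I_(\dim {:V})) := (vbasis {:V})`_i.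
pose B i j k l := polar q (e i) (e k) * polar q (e j) (e l)
                - polar q (e i) (e l) * polar q (e j) (e k).
have vE u : u = \sum_i c i u *: e i by rewrite -coord_vbasis ?memvf.
transitivity (\sum_i \sum_j c i v * c j w *
               (\sum_k \sum_l c k v' * c l w' * B i j k l)).
  rewrite -sum_pairs.
  - apply: eq_bigr => p _; rewrite -sum_pairs.
    + by rewrite big_distrr; apply: eq_bigr => r _ /=; rewrite !ffunE mulrA.
    + by move=> k; rewrite /B mulrC subrr.
    + by move=> k l; rewrite /B opprB.
  - move=> i; rewrite big1 // => k _; rewrite big1 // => l _.
    by rewrite /B [X in X - _]mulrC subrr mulr0.
  - move=> i j; rewrite -sumrN; apply: eq_bigr => k _; rewrite -sumrN.
    apply: eq_bigr => l _; rewrite -mulrN /B opprB; congr (_ * (_ - _)).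
      by rewrite mulrC.
    by rewrite mulrC.
have pE u x : polar q u x = \sum_k c k x * polar q u (e k).
  rewrite polarC {1}(vE x) polar_suml; apply: eq_bigr => k _.
  by rewrite polarC.
transitivity (\sum_i \sum_j c i v * c j w *
   (polar q (e i) v' * polar q (e j) w' - polar q (e i) w' * polar q (e j) v')).
  apply: eq_bigr => i _; apply: eq_bigr => j _; congr (_ * _).
  rewrite (sum_minor (c^~ v') (c^~ w') (fun k => polar q (e i) (e k))
                     (fun k => polar q (e j) (e k))).
  by rewrite -!pE.
pose f i := polar q (e i) v'; pose g i := polar q (e i) w'.
have -> : \sum_i \sum_j c i v * c j w * (f i * g j - g i * f j) =
          \sum_i \sum_j c i v * c j w * (f i * g j - f j * g i).
  by apply: eq_bigr => i _; apply: eq_bigr => j _; rewrite (mulrC (g i)).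
rewrite (sum_minor (c^~ v) (c^~ w)) /f /g.
have pE' u x : polar q x u = \sum_k c k x * polar q (e k) u.
  by rewrite {1}(vE x) polar_suml.
by rewrite -!pE' [X in _ - X]mulrC.
Qed.

Lemma ext2_quadric_wedge v w :
  poly_fun (ext2_quadric q) (wedge v w) = q v * q w - polar q v w ^+ 2.
Proof.
rewrite /ext2_quadric poly_fun_form.
- by rewrite ext2_form_wedge !polar_id (polarC w v) expr2.
- move=> u a x y; rewrite [RHS](_ : _ = a * ext2_form q u x + ext2_form q u y) //.
  rewrite /ext2_form big_distrr -big_split.
  apply: eq_bigr => p _ /=; rewrite big_distrr -big_split.
  apply: eq_bigr => r _ /=.
  have -> : (a *: x + y) r = a * x r + y r by rewrite !ffunE.
  by ring.
- move=> u a x y; rewrite [RHS](_ : _ = a * ext2_form q x u + ext2_form q y u) //.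
  rewrite /ext2_form big_distrr -big_split.
  apply: eq_bigr => p _ /=; rewrite big_distrr -big_split.
  apply: eq_bigr => r _ /=.
  have -> : (a *: x + y) p = a * x p + y p by rewrite !ffunE.
  by ring.
Qed.
End Ext2Quadric.

(* Main.v *)
(* A symmetric tensor s of degree p on Q has a symbol F(x, w), the contraction of s(x) with
   w, defined for w orthogonal to the isotropic vector x; it is of degree p in w and unchanged
   when a multiple of x is added to w.  After rescaling, F is a function of bidegree (p, p) on
   the cone q(x) = B(x, w) = 0, locally a quotient of polynomials.  Computing in two charts, in
   a basis where q = x_0 x_1 + sum_i u_i^2, and using that x_0 is not a zero divisor modulo
   J = (q(x), B(x, w)), one finds that F is the restriction of a polynomial; by the
   representation theory of sl_2 this polynomial may be chosen to be killed by
   E = sum_i x_i d/dw_i, and then, by Capelli's identity, it is a form G of degree p in the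
   Pluecker coordinates of x ^ w.  Conversely, linear forms on the exterior square are
   skew-adjoint endomorphisms of V, that is, vector fields on Q, so that all G occur.
   The symbol of G is zero if and only if its pull-back G(x ^ w) lies in J; a polynomial of
   bidegree (p, p) in J killed by E is, again by sl_2, the product of q(x) q(w) - B(x, w)^2
   and of a polynomial killed by E, so that G is a multiple of the quadric modulo the ideal
   of the Grassmannian. *)
From HB Require Import structures.
Require Import Defs.
From mathcomp Require Import all_boot all_order all_algebra.
From mathcomp Require Import complex reals classical_sets.
From mathcomp Require Import boolp functions.
From mathcomp Require finmap monalg.
Import -(notations) finmap.
Import -(notations) monalg.
From mathcomp Require Import mpoly ring lra zify.
Set Implicit Arguments.
Unset Strict Implicit.
Unset Printing Implicit Defensive.
Import Order.TTheory GRing.Theory Num.Theory.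
Local Open Scope classical_set_scope.
Local Open Scope ring_scope.

(** * Derivations of polynomial rings *)

(** No cohomology is used, only points and polynomials in pairs (x, w). The difficulty lies in
    gluing the two charts. If x_0^N F and x_1^M F are polynomials h_0 and h_1, then x_1^M h_0 -
    x_0^N h_1 lies in J, and h_0 has to be divided by x_0^N modulo J. For this x_1 must be regular
    modulo J + (x_0). The condition dim V >= 3 provides at least one u_i. On a conic there is
    exactly one, and regularity fails: x_1 u w_0 lies in J + (x_0) but u w_0, of bidegree (1, 1),
    does not. It survives in bidegrees (k, l) with k >= 2 or l = 0, and as F has bidegree (p, p)
    only these are met. Complete reducibility for sl_2 is replaced by solving equations for EF + c
    by induction on the degree, in bidegrees where all eigenvalues are positive. The polynomial [LL]
    is 2 B(x, w), which is the origin of the factors 2 and 4. *)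

Lemma mnm_subUU n (i : 'I_n) : (U_(i) - U_(i) = 0 :> 'X_{1..n})%MM.
Proof. by apply/mnmP => j; rewrite mnmBE mnm0E subnn. Qed.

Section Derivations.
Variables (K : comNzRingType) (N : nat).
Local Notation P := {mpoly K[N]}.
Implicit Types (f g h : P) (phi psi : 'I_N -> P).

Definition derivation phi h : P := \sum_i phi i * h^`M(i).

Fact derivation_is_linear phi : linear (derivation phi).
Proof.
move=> c f g; rewrite /derivation scaler_sumr -big_split /=.
by apply: eq_bigr => i _; rewrite mderivD mderivZ mulrDr scalerAr.
Qed.
HB.instance Definition _ phi :=
  GRing.isLinear.Build K P P _ (derivation phi) (derivation_is_linear phi).

Lemma derivationM phi f g :
  derivation phi (f * g) = derivation phi f * g + f * derivation phi g.
Proof.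
rewrite /derivation big_distrl big_distrr -big_split /=.
by apply: eq_bigr => i _; rewrite mderivM; ring.
Qed.

Lemma derivationX phi i : derivation phi 'X_i = phi i.
Proof.
rewrite /derivation (bigD1 i) //= big1 => [|j ji]; rewrite mderivX mnm1E.
  by rewrite eqxx mnm_subUU mpolyX0 scale1r mulr1 addr0.
by rewrite eq_sym (negPf ji) scale0r mulr0.
Qed.

Lemma derivationC phi c : derivation phi c%:MP = 0.
Proof. by rewrite /derivation big1 // => i _; rewrite mderivC mulr0. Qed.

Lemma derivationB phi psi h :
  derivation (fun i => phi i - psi i) h = derivation phi h - derivation psi h.
Proof. by rewrite /derivation -sumrB; apply: eq_bigr => i _; rewrite mulrBl. Qed.

Lemma eq_derivation phi psi h : phi =1 psi -> derivation phi h = derivation psi h.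
Proof. by move=> e; apply: eq_bigr => i _; rewrite e. Qed.

(** The second-order terms of the two compositions agree because partial derivatives commute, so the
    bracket is again a derivation. The commutation rules of the sl_2 action are then read off on the
    variables. *)
Lemma derivation_bracket phi psi h :
  derivation phi (derivation psi h) - derivation psi (derivation phi h) =
  derivation (fun i => derivation phi (psi i) - derivation psi (phi i)) h.
Proof.
have dd a b : derivation a (derivation b h) =
    \sum_i derivation a (b i) * h^`M(i) + \sum_i \sum_j a i * b j * h^`M(j)^`M(i).
  rewrite exchange_big [X in derivation a X]/derivation linear_sum -big_split.
  apply: eq_bigr => j _ /=; rewrite derivationM; congr (_ + _).
  rewrite [X in _ * X]/derivation big_distrr; apply: eq_bigr => i _ /=; ring.
rewrite !dd [X in _ - (_ + X)]exchange_big /=.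
rewrite [X in _ + X - _](eq_bigr (fun i => \sum_j psi j * phi i * h^`M(i)^`M(j))).
  rewrite opprD addrACA subrr addr0 -sumrB; apply: eq_bigr => i _.
  by rewrite -mulrBl.
by move=> i _; apply: eq_bigr => j _; rewrite mderiv_comm (mulrC (phi i)).
Qed.

End Derivations.

(** * Polynomials along curves, and polynomials vanishing at all points *)

Section ChainRule.
Variables (K : comNzRingType) (N : nat).

(** Restriction to a polynomial curve reduces derivatives in a direction to one variable, so that an
    identity valid for almost all parameters can be differentiated. *)
Definition along (c : 'I_N -> {poly K}) (h : {mpoly K[N]}) : {poly K} :=
  mmap (@polyC K) c h.
HB.instance Definition _ c := GRing.RMorphism.copy (along c) (along c).

Lemma alongX c i : along c 'X_i = c i.
Proof. by rewrite [LHS]mmapX mmap1U. Qed.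
Lemma alongC c a : along c a%:MP = a%:P.
Proof. exact: mmapC. Qed.

Lemma horner_along c h t : (along c h).[t] = h.@[fun i => (c i).[t]].
Proof.
rewrite /along /mmap horner_sum mevalE; apply: eq_bigr => m _.
rewrite hornerM hornerC; congr (_ * _); rewrite /mmap1 horner_prod.
by apply: eq_bigr => i _; rewrite horner_exp.
Qed.

Lemma mpoly_ind (R : nzRingType) (n : nat) (S : {mpoly R[n]} -> Prop) :
  (forall c, S c%:MP) -> (forall i, S 'X_i) ->
  (forall f g, S f -> S g -> S (f + g)) -> (forall f g, S f -> S g -> S (f * g)) ->
  forall f, S f.
Proof.
move=> SC SX SD SM f; elim/mpolyind: f => [|c m p _ _ Sp]; first by rewrite -mpolyC0.
apply: (SD) => //; rewrite -mul_mpolyC; apply: (SM) => //.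
rewrite mpolyXE_id; elim/big_rec: _ => [|i x _ Sx]; first by rewrite -mpolyC1.
apply: (SM) => //; elim: (m i) => [|k Sk]; first by rewrite expr0 -mpolyC1.
by rewrite exprS; apply: (SM).
Qed.

Lemma deriv_along c h :
  (along c h)^`() = \sum_i along c h^`M(i) * (c i)^`().
Proof.
elim/mpoly_ind: h => [a|i|f g IHf IHg|f g IHf IHg].
- rewrite alongC derivC big1 // => i _; rewrite mderivC raddf0 mul0r //.
- rewrite alongX (bigD1 i) //= big1 ?addr0 => [|j ji]; rewrite mderivX mnm1E.
    by rewrite eqxx mnm_subUU mpolyX0 scale1r rmorph1 mul1r.
  by rewrite eq_sym (negPf ji) scale0r raddf0 mul0r.
- rewrite rmorphD derivD IHf IHg -big_split; apply: eq_bigr => i _ /=.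
  by rewrite mderivD rmorphD mulrDl.
- rewrite rmorphM derivM IHf IHg big_distrl big_distrr -big_split.
  apply: eq_bigr => i _ /=.
  by rewrite mderivM rmorphD !rmorphM; ring.
Qed.

Lemma deriv_along_at c h t : ((along c h)^`()).[t] =
  \sum_i h^`M(i).@[fun j => (c j).[t]] * (c i)^`().[t].
Proof.
rewrite deriv_along horner_sum; apply: eq_bigr => i _.
by rewrite hornerM horner_along.
Qed.
End ChainRule.

(** The exception b serves the scaling arguments, where the parameter must be nonzero.
    Multiplication by 'X - b removes it, and characteristic 0 provides more roots than the degree
    allows. *)
Lemma poly_eq0_inf (K : numDomainType) (p : {poly K}) (b : K) :
  (forall t, t != b -> p.[t] = 0) -> p = 0.
Proof.
move=> p0; have /eqP : p * ('X - b%:P) = 0.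
  apply/eqP/negPn/negP => q0.
  pose s := [seq i%:R : K | i <- iota 0 (size (p * ('X - b%:P)))].
  have /(max_poly_roots q0) : all (root (p * ('X - b%:P))) s.
    apply/allP => t _; rewrite rootM !rootE.
    by case: (eqVneq t b) => [->|/p0->]; rewrite ?eqxx // !hornerE subrr eqxx orbT.
  rewrite size_map size_iota ltnn => H; apply: notF; apply: H.
  by rewrite map_inj_uniq ?iota_uniq //; apply: mulrIn; exact: oner_neq0.
by rewrite mulf_eq0 polyXsubC_eq0 orbF => /eqP.
Qed.

(** Uniqueness of the digits in base D, by induction from the least significant one. *)
Lemma expand_inj (D n : nat) (a b : 'I_n -> nat) :
  (forall i, (a i < D)%N) -> (forall i, (b i < D)%N) ->
  (\sum_i a i * D ^ i = \sum_i b i * D ^ i)%N -> a =1 b.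
Proof.
elim: n a b => [|n IH] a b aD bD; first by move=> _ [].
rewrite !big_ord_recl !expn0 !muln1.
have E (c : 'I_n.+1 -> nat) : (\sum_(i < n) c (lift ord0 i) * D ^ lift ord0 i =
    (\sum_(i < n) c (lift ord0 i) * D ^ i) * D)%N.
  rewrite big_distrl; apply: eq_bigr => i _ /=.
  by rewrite /bump /= add1n expnS mulnA mulnAC.
rewrite !E => ab.
have ab0 : a ord0 = b ord0.
  by move/(congr1 (modn^~ D)): ab; rewrite addnC modnMDl modn_small // addnC modnMDl modn_small.
have D0 : (0 < D)%N by exact: leq_ltn_trans (aD ord0).
move: ab; rewrite ab0 => /addnI /eqP; rewrite eqn_pmul2r // => /eqP ab i.
case: (unliftP ord0 i) => [j|] ->; last by [].
by apply: (IH (fun k => a (lift ord0 k)) (fun k => b (lift ord0 k))) => [k|k|].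
Qed.

(** Kronecker substitution: ['X_i] goes to the power D^i of a single variable, where D exceeds all
    exponents, so distinct monomials become distinct powers. *)
Lemma mpoly_eq0 (K : numDomainType) n (f : {mpoly K[n]}) :
  (forall x, f.@[x] = 0) -> f = 0.
Proof.
move=> f0; pose D := msize f; pose e (m : 'X_{1..n}) := (\sum_i m i * D ^ i)%N.
pose c (i : 'I_n) : {poly K} := 'X^(D ^ i).
have /polyP c0 : along c f = 0.
  by apply: (@poly_eq0_inf _ _ 0) => t _; rewrite horner_along f0.
apply/mpolyP => m; rewrite mcoeff0; case: (boolP (m \in msupp f)) => [mf|]; last first.
  by move/memN_msupp_eq0.
have lt (m' : 'X_{1..n}) : m' \in msupp f -> forall i, (m' i < D)%N.
  move=> m'f i; apply: leq_ltn_trans (msize_mdeg_lt m'f).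
  by rewrite mdegE (bigD1 i) //= leq_addr.
have := c0 (e m); rewrite coef0 /along /mmap coef_sum (bigD1_seq m) ?msupp_uniq //=.
rewrite big_seq_cond big1 ?addr0 => [|m' /andP[m'f mm']].
  rewrite coefCM /mmap1 (eq_bigr (fun i => 'X^(m i * D ^ i))) => [|i _]; last first.
    by rewrite -exprM mulnC.
  by rewrite -expr_sum coefXn eqxx mulr1.
rewrite coefCM /mmap1 (eq_bigr (fun i => 'X^(m' i * D ^ i))) => [|i _]; last first.
  by rewrite -exprM mulnC.
rewrite -expr_sum coefXn [_ == _](_ : _ = false) ?mulr0 //.
apply: contraNF mm' => /eqP ee; apply/eqP/mnmP => i.
exact: (expand_inj (lt _ m'f) (lt _ mf) (esym ee)).
Qed.

(** * Bigraded polynomials and the action of sl_2 *)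

Section Bigraded.
Variables (K : numFieldType) (n : nat).
Local Notation P := {mpoly K[n + n]}.
Implicit Types (f g h : P) (k l : int).

Definition xv (i : 'I_n) : P := 'X_(lshift n i).
Definition yv (i : 'I_n) : P := 'X_(rshift n i).
Definition dx (i : 'I_n) h : P := h^`M(lshift n i).
Definition dy (i : 'I_n) h : P := h^`M(rshift n i).

Definition vf (T : Type) (a b : 'I_n -> T) (k : 'I_(n + n)) : T :=
  match fintype.split k with inl i => a i | inr i => b i end.

(** Together with [opF] this is the polarization action of sl_2, mixing x and y as a basis of the
    standard representation; the weight operator is [degx] minus [degy]. *)
Definition opE := derivation (vf (fun=> 0) xv).
Definition opF := derivation (vf yv (fun=> 0)).
Definition degx := derivation (vf xv (fun=> 0)).
Definition degy := derivation (vf (fun=> 0) yv).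
HB.instance Definition _ := GRing.Linear.copy opE opE.
HB.instance Definition _ := GRing.Linear.copy opF opF.
HB.instance Definition _ := GRing.Linear.copy degx degx.
HB.instance Definition _ := GRing.Linear.copy degy degy.

Lemma vf_l (T : Type) (a b : 'I_n -> T) i : vf a b (lshift n i) = a i.
Proof. by rewrite /vf (unsplitK (inl i) : fintype.split (lshift n i) = inl i). Qed.
Lemma vf_r (T : Type) (a b : 'I_n -> T) i : vf a b (rshift n i) = b i.
Proof. by rewrite /vf (unsplitK (inr i) : fintype.split (rshift n i) = inr i). Qed.

Lemma opEx i : opE (xv i) = 0. Proof. by rewrite /opE derivationX vf_l. Qed.
Lemma opEy i : opE (yv i) = xv i. Proof. by rewrite /opE derivationX vf_r. Qed.
Lemma opFx i : opF (xv i) = yv i. Proof. by rewrite /opF derivationX vf_l. Qed.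
Lemma opFy i : opF (yv i) = 0. Proof. by rewrite /opF derivationX vf_r. Qed.
Lemma degxx i : degx (xv i) = xv i. Proof. by rewrite /degx derivationX vf_l. Qed.
Lemma degxy i : degx (yv i) = 0. Proof. by rewrite /degx derivationX vf_r. Qed.
Lemma degyx i : degy (xv i) = 0. Proof. by rewrite /degy derivationX vf_l. Qed.
Lemma degyy i : degy (yv i) = yv i. Proof. by rewrite /degy derivationX vf_r. Qed.
Definition opX := (opEx, opEy, opFx, opFy, (degxx, degxy, degyx, degyy)).

Lemma derivation_vf a b h :
  derivation (vf a b) h = \sum_i a i * dx i h + \sum_i b i * dy i h.
Proof.
rewrite /derivation big_split_ord /=; congr (_ + _);
  by apply: eq_bigr => i _; rewrite ?vf_l ?vf_r.
Qed.

Lemma bracket_vf a b c d th h :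
  (forall i, derivation (vf a b) (c i) - derivation (vf c d) (a i) = th (lshift n i)) ->
  (forall i, derivation (vf a b) (d i) - derivation (vf c d) (b i) = th (rshift n i)) ->
  derivation (vf a b) (derivation (vf c d) h) =
    derivation (vf c d) (derivation (vf a b) h) + derivation th h.
Proof.
move=> el er; apply/eqP; rewrite addrC -subr_eq derivation_bracket; apply/eqP.
apply: eq_derivation => k; case: (splitP k) => i ki.
  have -> : k = lshift n i by apply: val_inj.
  by rewrite !vf_l.
have -> : k = rshift n i by apply: val_inj.
by rewrite !vf_r.
Qed.

Lemma opEF h : opE (opF h) = opF (opE h) + (degx h - degy h).
Proof.
rewrite -derivationB.
by apply: bracket_vf => i; rewrite ?vf_l ?vf_r -/opE -/opF ?opX ?linear0 ?opX ?subr0 ?sub0r ?add0r ?addr0.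
Qed.
Lemma degxE h : degx (opE h) = opE (degx h) + opE h.
Proof.
by apply: bracket_vf => i; rewrite ?vf_l ?vf_r -/opE -/degx ?opX ?linear0 ?opX ?subr0 ?sub0r ?add0r ?addr0.
Qed.
Lemma degyE h : degy (opE h) = opE (degy h) - opE h.
Proof.
apply/eqP; rewrite eq_sym subr_eq; apply/eqP.
by apply: bracket_vf => i; rewrite ?vf_l ?vf_r -/opE -/degy ?opX ?linear0 ?opX ?subr0 ?sub0r ?add0r ?addr0.
Qed.
Lemma degxF h : degx (opF h) = opF (degx h) - opF h.
Proof.
apply/eqP; rewrite eq_sym subr_eq; apply/eqP.
by apply: bracket_vf => i; rewrite ?vf_l ?vf_r -/opF -/degx ?opX ?linear0 ?opX ?subr0 ?sub0r ?add0r ?addr0.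
Qed.
Lemma degyF h : degy (opF h) = opF (degy h) + opF h.
Proof.
by apply: bracket_vf => i; rewrite ?vf_l ?vf_r -/opF -/degy ?opX ?linear0 ?opX ?subr0 ?sub0r ?add0r ?addr0.
Qed.

(** Bidegrees are integers defined through eigenvalues, so that [opE] and [opF] shift them without
    side conditions. A negative bidegree forces h = 0 by [bihom_neg], which starts the inductions on
    weights. *)
Definition bihom k l h := degx h = k%:~R *: h /\ degy h = l%:~R *: h.

Lemma bihom0 k l : bihom k l 0.
Proof. by split; rewrite raddf0 scaler0. Qed.
Lemma bihomD k l g h : bihom k l g -> bihom k l h -> bihom k l (g + h).
Proof. by move=> [gx gy] [hx hy]; split; rewrite raddfD /= ?gx ?gy ?hx ?hy scalerDr. Qed.
Lemma bihomZ k l c h : bihom k l h -> bihom k l (c *: h).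
Proof. by move=> [hx hy]; split; rewrite linearZ /= ?hx ?hy !scalerA mulrC. Qed.
Lemma bihomB k l g h : bihom k l g -> bihom k l h -> bihom k l (g - h).
Proof. by move=> gkl hkl; rewrite -scaleN1r; apply/bihomD/bihomZ. Qed.
Lemma bihomM k l k' l' g h :
  bihom k l g -> bihom k' l' h -> bihom (k + k') (l + l') (g * h).
Proof.
move=> [gx gy] [hx hy].
by split; rewrite /degx /degy derivationM -/degx -/degy ?gx ?gy ?hx ?hy
  -scalerAl -scalerAr -scalerDl intrD.
Qed.
Lemma bihom_sum k l (I : Type) (r : seq I) (Q : pred I) (f : I -> P) :
  (forall i, Q i -> bihom k l (f i)) -> bihom k l (\sum_(i <- r | Q i) f i).
Proof.
by move=> fkl; apply: big_ind => //; [exact: bihom0 | move=> *; exact: bihomD].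
Qed.
Lemma bihomC c : bihom 0 0 c%:MP.
Proof. by split; rewrite scale0r [LHS]derivationC. Qed.
Lemma bihomX k l h (p : nat) : bihom k l h -> bihom (k *+ p) (l *+ p) (h ^+ p).
Proof.
move=> hkl; elim: p => [|p IH]; first by rewrite expr0 -mpolyC1; exact: bihomC.
by rewrite exprS !mulrS; exact: bihomM.
Qed.
Lemma bihom_xv i : bihom 1 0 (xv i). Proof. by split; rewrite opX ?scale1r ?scale0r. Qed.
Lemma bihom_yv i : bihom 0 1 (yv i). Proof. by split; rewrite opX ?scale1r ?scale0r. Qed.

Lemma bihom_opE k l h : bihom k l h -> bihom (k + 1) (l - 1) (opE h).
Proof.
move=> [hx hy]; split; rewrite ?degxE ?degyE ?hx ?hy linearZ /=.
  by rewrite intrD scalerDl scale1r.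
by rewrite intrD scalerDl scaleN1r.
Qed.
Lemma bihom_opF k l h : bihom k l h -> bihom (k - 1) (l + 1) (opF h).
Proof.
move=> [hx hy]; split; rewrite ?degxF ?degyF ?hx ?hy linearZ /=.
  by rewrite intrD scalerDl scaleN1r.
by rewrite intrD scalerDl scale1r.
Qed.
Lemma bihomEF k l h : bihom k l h -> opE (opF h) = opF (opE h) + (k - l)%:~R *: h.
Proof. by move=> [hx hy]; rewrite opEF hx hy -scalerBl intrB. Qed.

Definition mdegx (m : 'X_{1..n + n}) := (\sum_(i < n) m (lshift n i))%N.
Definition mdegy (m : 'X_{1..n + n}) := (\sum_(i < n) m (rshift n i))%N.

Lemma mulX_mderivX i (m : 'X_{1..n + n}) :
  'X_i * ('X_[m])^`M(i) = (m i)%:R *: 'X_[m] :> P.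
Proof.
rewrite mderivX -scalerAr; case: (posnP (m i)) => [->|mi]; first by rewrite !scale0r.
by rewrite -mpolyXD addmC submK //; apply/mnm_lepP => j; rewrite mnm1E; case: eqP => [<-|].
Qed.

Lemma degx_X m : degx 'X_[m] = (mdegx m)%:R *: 'X_[m].
Proof.
rewrite [LHS]derivation_vf [X in _ + X]big1 ?addr0 => [|i _]; last by rewrite mul0r.
by rewrite natr_sum scaler_suml; apply: eq_bigr => i _; exact: mulX_mderivX.
Qed.
Lemma degy_X m : degy 'X_[m] = (mdegy m)%:R *: 'X_[m].
Proof.
rewrite [LHS]derivation_vf [X in X + _]big1 ?add0r => [|i _]; last by rewrite mul0r.
by rewrite natr_sum scaler_suml; apply: eq_bigr => i _; exact: mulX_mderivX.
Qed.

Lemma bihom_monom m : bihom (mdegx m) (mdegy m) 'X_[m].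
Proof. by split; rewrite ?degx_X ?degy_X. Qed.

Lemma coef_diag (T : {linear P -> P}) (w : 'X_{1..n + n} -> K) :
  (forall m, T 'X_[m] = w m *: 'X_[m]) -> forall h m, (T h)@_m = w m * h@_m.
Proof.
move=> TX h m; elim/mpolyind: h => [|c m' h _ _ IH].
  by rewrite linear0 mcoeff0 mulr0.
rewrite linearD linearZ /= TX !mcoeffD IH mulrDr !mcoeffZ mcoeffX.
by case: eqP => [->|]; rewrite ?mulr0 // mulrCA.
Qed.

Lemma coef_degx h m : (degx h)@_m = (mdegx m)%:R * h@_m.
Proof. exact: (coef_diag (T := degx) degx_X). Qed.
Lemma coef_degy h m : (degy h)@_m = (mdegy m)%:R * h@_m.
Proof. exact: (coef_diag (T := degy) degy_X). Qed.

Lemma bihom_supp k l h m :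
  bihom k l h -> m \in msupp h -> (mdegx m)%:Z = k /\ (mdegy m)%:Z = l.
Proof.
rewrite mcoeff_msupp => -[hx hy] m0.
split; apply/eqP; rewrite -(eqr_int K) -subr_eq0 -(mulIr_eq0 _ (mulIf m0)) mulrBl subr_eq0;
  apply/eqP.
  by rewrite -coef_degx hx mcoeffZ.
by rewrite -coef_degy hy mcoeffZ.
Qed.

Lemma bihom_neg k l h : bihom k l h -> (k < 0) || (l < 0) -> h = 0.
Proof.
move=> hkl neg; apply/mpolyP => m; rewrite mcoeff0; apply/eqP; rewrite mcoeff_eq0.
by apply/negP => /(bihom_supp hkl)[kE lE]; move: neg; rewrite -kE -lE.
Qed.

Definition biproj k l h : P :=
  \sum_(m <- msupp h | ((mdegx m)%:Z == k) && ((mdegy m)%:Z == l)) h@_m *: 'X_[m].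

Lemma bihom_biproj k l h : bihom k l (biproj k l h).
Proof.
by apply: bihom_sum => m /andP[/eqP<- /eqP<-]; apply/bihomZ/bihom_monom.
Qed.

Lemma coef_biproj k l h m :
  (biproj k l h)@_m = if ((mdegx m)%:Z == k) && ((mdegy m)%:Z == l) then h@_m else 0.
Proof.
rewrite raddf_sum /= (eq_bigr (fun m' => h@_m' * (m' == m)%:R)) => [|m' _]; last first.
  by rewrite mcoeffZ mcoeffX.
rewrite big_mkcond /=; case: (boolP (m \in msupp h)) => [mh|/memN_msupp_eq0 mh].
  rewrite (bigD1_seq m) ?msupp_uniq //= eqxx mulr1 big1 ?addr0 //.
  by move=> m' /negPf->; rewrite mulr0 if_same.
rewrite mh if_same big1 // => m' _; case: (m' =P m) => [->|]; last by rewrite mulr0 if_same.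
by rewrite mh mul0r if_same.
Qed.

Fact biproj_is_linear k l : linear (biproj k l).
Proof.
move=> c g h; apply/mpolyP => m; rewrite mcoeffD mcoeffZ !coef_biproj.
by case: ifP; rewrite ?mulr0 ?addr0 // mcoeffD mcoeffZ.
Qed.
HB.instance Definition _ k l :=
  GRing.isLinear.Build K P P _ (biproj k l) (biproj_is_linear k l).

Lemma biproj_id k l h : bihom k l h -> biproj k l h = h.
Proof.
move=> hkl; apply/mpolyP => m; rewrite coef_biproj; case: ifP => // mkl.
apply/esym/eqP; rewrite mcoeff_eq0; apply: contraFN mkl => /(bihom_supp hkl)[-> ->].
by rewrite !eqxx.
Qed.

Lemma biproj_monom k l m : biproj k l 'X_[m] =
  if ((mdegx m)%:Z == k) && ((mdegy m)%:Z == l) then 'X_[m] else 0.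
Proof.
apply/mpolyP => m'; rewrite coef_biproj mcoeffX; case: (m =P m') => [->|mm'].
  by case: ifP; rewrite ?mcoeff0 // mcoeffX eqxx.
by rewrite if_same; case: ifP; rewrite ?mcoeff0 // mcoeffX; case: (m =P m').
Qed.

Lemma mdegxD m m' : mdegx (m + m') = (mdegx m + mdegx m')%N.
Proof. by rewrite /mdegx -big_split; apply: eq_bigr => i _; rewrite mnmDE. Qed.
Lemma mdegyD m m' : mdegy (m + m') = (mdegy m + mdegy m')%N.
Proof. by rewrite /mdegy -big_split; apply: eq_bigr => i _; rewrite mnmDE. Qed.

(** It allows the cofactors in an ideal with bihomogeneous generators to be replaced by their
    components of the right bidegree. *)
Lemma biprojM i j k l g h : bihom i j g ->
  biproj k l (g * h) = g * biproj (k - i) (l - j) h.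
Proof.
move=> gij; elim/mpolyind: h => [|c m' h _ _ IH].
  by rewrite mulr0 !linear0 mulr0.
rewrite mulrDr !linearD /= IH mulrDr -scalerAr !linearZ /= -scalerAr; congr (c *: _ + _).
rewrite {1 2}[g]mpolyE !big_distrl linear_sum big_seq [RHS]big_seq.
apply: eq_bigr => m /(bihom_supp gij)[mi mj] /=.
rewrite -!scalerAl linearZ /= -mpolyXD !biproj_monom mdegxD mdegyD !PoszD mi mj.
have e (a b d : int) : (a + b == d) = (b == d - a).
  by rewrite [RHS]eq_sym subr_eq addrC eq_sym.
rewrite !e.
by case: ifP; rewrite ?mulr0 // mpolyXD.
Qed.
End Bigraded.
Arguments bihom_xv {K n} i.
Arguments bihom_yv {K n} i.

(** * Surjectivity and injectivity of E on weight spaces *)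

Section SL2.
Variables (K : numFieldType) (n : nat).
Local Notation P := {mpoly K[n + n]}.
Implicit Types (f g h : P) (k l : int).
Local Notation E := (@opE K n).
Local Notation F := (@opF K n).

Lemma bihom_eq k l k' l' h : k = k' -> l = l' -> bihom k l h -> bihom k' l' h.
Proof. by move=> -> ->. Qed.

(* On weight spaces of positive weight [E F] has positive eigenvalues. *)
Lemma opEF_surj k l (c : K) h : l < k -> 0 <= c -> bihom k l h ->
  exists2 g, bihom k l g & E (F g) + c *: g = h.
Proof.
have [l0|] := ltP l 0.
  move=> _ _ hkl; exists 0; first exact: bihom0.
  by rewrite !linear0 addr0 (bihom_neg hkl) // l0 orbT.
case: l => // l _; elim: l k c h => [|l IH] k c h lk c0 hkl.
  have kc : k%:~R + c != 0 :> K by rewrite gt_eqF // ltr_pwDl ?ltr0z.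
  exists ((k%:~R + c)^-1 *: h); first exact: bihomZ.
  have Eh : E h = 0 by apply: bihom_neg (bihom_opE hkl) _; rewrite orbT.
  rewrite !linearZ /= (bihomEF hkl) Eh linear0 add0r subr0 !scalerA -scalerDl.
  by rewrite -[RHS]scale1r; congr (_ *: _); rewrite -mulrDr mulVf.
(* As E F = F E + w on this weight space, the equation reads F E g + (w + c) g = h. Applying E gives
   an equation for E g of the original kind, in lower y-degree and with w + c in place of c; its
   solution z is put in place of E g. *)
pose w : K := (k - Posz l.+1)%:~R.
have w0 : 0 < w by rewrite ltr0z subr_gt0.
have Ehkl := bihom_opE hkl; rewrite -addn1 PoszD addrK in Ehkl.
have lk' : (Posz l < k + 1)%R.
  by rewrite ltzD1 ltW // (lt_trans _ lk) // ltz_nat.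
have [z zkl Ez] := IH _ (w + c) _ lk' (addr_ge0 (ltW w0) c0) Ehkl.
have wc : w + c != 0 by rewrite gt_eqF // ltr_pwDl.
have Fz : bihom k l.+1 (F z).
  by apply: bihom_eq (bihom_opF zkl); rewrite ?addrK // -addn1 PoszD.
exists ((w + c)^-1 *: (h - F z)); first exact/bihomZ/bihomB.
rewrite !linearZ !linearB /= (bihomEF hkl) (bihomEF Fz) -/w -Ez.
rewrite -scalerDr; apply: (canLR (scalerK wc)); rewrite linearD linearZ /= !scalerDl.
move: (F (E (F z))) (w *: F z) (c *: F z) (w *: h) (c *: h) => a b d e f; ring.
Qed.

(** Dual to [opEF_surj]. The element F h satisfies E F h = -(w + c) h with w = l - k, hence an
    equation of the same kind in lower x-degree with w + c in place of c. By induction F h = 0, and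
    then (w + c) h = 0. *)
Lemma opFE_inj k l (c : K) h : k < l -> 0 <= c -> bihom k l h ->
  F (E h) + c *: h = 0 -> h = 0.
Proof.
have [k0 _ _ hkl _|] := ltP k 0; first by rewrite (bihom_neg hkl) // k0.
case: k => // k _; elim: k l c h => [|k IH] l c h kl c0 hkl.
  have Fh : F h = 0 by apply: bihom_neg (bihom_opF hkl) _.
  have := bihomEF hkl; rewrite Fh linear0 => /esym/eqP; rewrite addr_eq0 => /eqP->.
  rewrite -scaleNr -scalerDl => /eqP; rewrite scaler_eq0 => /orP[|/eqP//].
  rewrite sub0r -intrN opprK => /eqP lc; have : 0 < l%:~R + c by rewrite ltr_pwDl ?ltr0z.
  by rewrite lc ltxx.
pose w : K := (l - Posz k.+1)%:~R.
have w0 : 0 < w by rewrite ltr0z subr_gt0.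
move=> h0.
have Fhkl := bihom_opF hkl; rewrite -addn1 PoszD addrK in Fhkl.
have kl' : (Posz k < l + 1)%R.
  by rewrite ltzD1 ltW // (lt_trans _ kl) // ltz_nat.
have EFh : E (F h) = - (w + c) *: h.
  rewrite (bihomEF hkl); move/eqP: h0; rewrite addr_eq0 => /eqP->.
  by rewrite -scaleNr -scalerDl -(opprB l) intrN -/w opprD addrC.
have Fh : F h = 0.
  apply: (IH _ (w + c) _ kl' (addr_ge0 (ltW w0) c0) Fhkl).
  by rewrite EFh linearZ /= scaleNr addNr.
move/eqP: EFh; rewrite Fh linear0 eq_sym scaler_eq0 oppr_eq0 => /orP[|/eqP//].
by rewrite gt_eqF // ltr_pwDl.
Qed.

Lemma opE_surj k l h : l < k -> bihom k l h -> exists2 g, bihom (k - 1) (l + 1) g & E g = h.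
Proof.
move=> lk hkl; have [g gkl] := opEF_surj lk (lexx 0) hkl.
by rewrite scale0r addr0 => <-; exists (F g) => //; exact: bihom_opF.
Qed.

(** Complete reducibility in weight 0: up to the image of E every element is an invariant. *)
Lemma opE_invariant k h : bihom k k h ->
  exists2 g, bihom (k - 1) (k + 1) g & E (h - E g) = 0.
Proof.
move=> hkk; have k1 : k - 1 < k + 1 by lia.
have [z zk Ez] := opEF_surj k1 (lexx 0) (bihom_opE hkk).
rewrite scale0r addr0 in Ez; have [d dk Ed] := opE_surj k1 zk.
rewrite addrK subrK in dk.
(* On d, of weight 0, E and F commute, so E (E (F d)) = E (F (E d)) = E (F z) = E h. *)
exists (F d); first exact: bihom_opF.
by rewrite linearB /= (bihomEF dk) subrr scale0r addr0 Ed Ez subrr.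
Qed.

(** On E h, of weight 0, E and F commute, so E (E h) = 0 gives E (F (E h)) = 0. Two applications of
    [opFE_inj], to F (E h) and to h, conclude. *)
Lemma opE2_inj k h : bihom (k - 1) (k + 1) h -> E (E h) = 0 -> h = 0.
Proof.
move=> hk E2; have k1 : k - 1 < k + 1 by lia.
have FEh : bihom (k - 1) (k + 1) (F (E h)).
  by apply: bihom_eq (bihom_opF (bihom_opE hk)); lia.
have Ehk := bihom_opE hk; rewrite subrK addrK in Ehk.
apply: (opFE_inj k1 (lexx 0) hk); rewrite scale0r addr0.
apply: (opFE_inj k1 (lexx 0) FEh); rewrite scale0r addr0.
by rewrite (bihomEF Ehk) E2 linear0 subrr scale0r addr0 linear0.
Qed.

End SL2.

(** * Invariants of SL_2 *)

Section FirstFundamentalTheorem.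
Variables (K : numFieldType) (n : nat).
Local Notation P := {mpoly K[n + n]}.
Implicit Types (f g h : P) (k l : int).
Local Notation E := (@opE K n).
Local Notation F := (@opF K n).
Local Notation x := (@xv K n).
Local Notation y := (@yv K n).

HB.instance Definition _ i := GRing.Linear.copy (@dx K n i) (@dx K n i).
HB.instance Definition _ i := GRing.Linear.copy (@dy K n i) (@dy K n i).

Definition minor (i j : 'I_n) : P := x i * y j - x j * y i.

Lemma mderivXU (N : nat) i j : ('X_j : {mpoly K[N]})^`M(i) = (j == i)%:R.
Proof.
rewrite mderivX mnm1E; case: eqP => [->|_]; last by rewrite scale0r.
by rewrite mnm_subUU mpolyX0 scale1r.
Qed.


Lemma dx_xv i j : dx i (x j) = (j == i)%:R.
Proof. by rewrite /dx mderivXU (inj_eq (@lshift_inj _ _)). Qed.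
Lemma dx_yv i j : dx i (y j) = 0.
Proof. by rewrite /dx mderivXU eq_rlshift. Qed.
Lemma dy_xv i j : dy i (x j) = 0.
Proof. by rewrite /dy mderivXU eq_lrshift. Qed.
Lemma dy_yv i j : dy i (y j) = (j == i)%:R.
Proof. by rewrite /dy mderivXU (inj_eq (@rshift_inj _ _)). Qed.
Definition dxyE := (dx_xv, dx_yv, dy_xv, dy_yv).

Lemma dxM i g h : dx i (g * h) = dx i g * h + g * dx i h. Proof. exact: mderivM. Qed.
Lemma dyM i g h : dy i (g * h) = dy i g * h + g * dy i h. Proof. exact: mderivM. Qed.

Lemma opEE h : E h = \sum_i x i * dy i h.
Proof. by rewrite [LHS]derivation_vf big1 ?add0r // => i _; rewrite mul0r. Qed.
Lemma opFE h : F h = \sum_i y i * dx i h.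
Proof. by rewrite [LHS]derivation_vf [X in _ + X]big1 ?addr0 // => i _; rewrite mul0r. Qed.
Lemma degxEq h : degx h = \sum_i x i * dx i h.
Proof. by rewrite [LHS]derivation_vf [X in _ + X]big1 ?addr0 // => i _; rewrite mul0r. Qed.
Lemma degyEq h : degy h = \sum_i y i * dy i h.
Proof. by rewrite [LHS]derivation_vf big1 ?add0r // => i _; rewrite mul0r. Qed.

Lemma sum_pick (c : 'I_n -> P) i : \sum_j (j == i)%:R * c j = c i.
Proof.
by rewrite (bigD1 i) //= eqxx mul1r big1 ?addr0 // => j /negPf->; rewrite mul0r.
Qed.

Lemma dx_opE i h : dx i (E h) = E (dx i h) + dy i h.
Proof.
rewrite !opEE linear_sum -(sum_pick (fun j => dy j h)) -big_split.
by apply: eq_bigr => j _ /=; rewrite dxM !dxyE addrC; congr (_ + _ * _); exact: mderiv_comm.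
Qed.
Lemma dy_opE i h : dy i (E h) = E (dy i h).
Proof.
rewrite !opEE linear_sum; apply: eq_bigr => j _ /=.
by rewrite dyM !dxyE mul0r add0r; congr (_ * _); exact: mderiv_comm.
Qed.
Lemma bihom_dx i k l h : bihom k l h -> bihom (k - 1) l (dx i h).
Proof.
move=> [hx hy]; split.
  transitivity (dx i (degx h) - dx i h); last by rewrite hx linearZ intrB scalerBl scale1r.
  rewrite !degxEq linear_sum -[X in _ - X](sum_pick (fun j => dx j h)) -sumrB.
  apply: eq_bigr => j _ /=; rewrite dxM !dxyE addrAC subrr add0r; congr (_ * _).
  exact: mderiv_comm.
transitivity (dx i (degy h)); last by rewrite hy linearZ.
rewrite !degyEq linear_sum; apply: eq_bigr => j _ /=.
by rewrite dxM !dxyE mul0r add0r; congr (_ * _); exact: mderiv_comm.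
Qed.
Lemma bihom_dy i k l h : bihom k l h -> bihom k (l - 1) (dy i h).
Proof.
move=> [hx hy]; split; last first.
  transitivity (dy i (degy h) - dy i h); last by rewrite hy linearZ intrB scalerBl scale1r.
  rewrite !degyEq linear_sum -[X in _ - X](sum_pick (fun j => dy j h)) -sumrB.
  apply: eq_bigr => j _ /=; rewrite dyM !dxyE addrAC subrr add0r; congr (_ * _).
  exact: mderiv_comm.
transitivity (dy i (degx h)); last by rewrite hx linearZ.
rewrite !degxEq linear_sum; apply: eq_bigr => j _ /=.
by rewrite dyM !dxyE mul0r add0r; congr (_ * _); exact: mderiv_comm.
Qed.

(* Cayley's operator. *)
Definition omega (i j : 'I_n) h := dx i (dy j h) - dx j (dy i h).

Lemma omega_opE i j h : omega i j (E h) = E (omega i j h).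
Proof.
rewrite /omega !dy_opE !dx_opE linearB /= /dy (mderiv_comm (rshift n i)); ring.
Qed.

(** Both compositions are brought to normal order, with coefficients before derivatives. In F E the
    derivative of the coefficient x_i contributes the term [degy h]; [degx (degy h)] has no such
    term. *)
Lemma capelli h : \sum_i \sum_j x i * y j * omega i j h = degx (degy h) + degy h - F (E h).
Proof.
have -> : degx (degy h) = \sum_i \sum_j x i * y j * dx i (dy j h).
  rewrite degxEq degyEq; apply: eq_bigr => i _; rewrite linear_sum big_distrr.
  by apply: eq_bigr => j _ /=; rewrite dxM !dxyE mul0r add0r mulrA.
have -> : F (E h) = degy h + \sum_i \sum_j x i * y j * dx j (dy i h).
  rewrite opFE opEE degyEq exchange_big -big_split; apply: eq_bigr => j _ /=.
  rewrite linear_sum big_distrr /= -[in RHS](sum_pick (fun i => dy i h)) big_distrr.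
  rewrite -big_split; apply: eq_bigr => i _ /=.
  by rewrite dxM !dxyE mulrDr; congr (_ + _); ring.
rewrite opprD addrA addrK -sumrB; apply: eq_bigr => i _; rewrite -sumrB.
by apply: eq_bigr => j _; rewrite -mulrBr.
Qed.

Lemma bihom00 h : bihom 0 0 h -> h = (h@_0)%:MP.
Proof.
move=> h00; apply/mpolyP => m; rewrite mcoeffC.
case: (eqVneq m 0%MM) => [->|m0]; first by rewrite mulr1.
rewrite mulr0; apply/eqP; rewrite mcoeff_eq0; apply: contraNN m0 => mh.
have [[/eqP mx] [/eqP my]] := bihom_supp h00 mh.
apply/eqP/mnmP => k; rewrite mnm0E; apply/eqP.
move: mx my; rewrite !sum_nat_eq0 => /forallP mx /forallP my.
case: (splitP k) => i ki.
  by have -> : k = lshift n i by [apply: val_inj]; exact: (implyP (mx i)).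
by have -> : k = rshift n i by [apply: val_inj]; exact: (implyP (my i)).
Qed.

(* Invariants of SL_2 are polynomials in the minors. *)
Lemma minor_ind (S : nat -> P -> Prop) :
  (forall c, S 0%N c%:MP) -> (forall p, S p 0) -> (forall p g h, S p g -> S p h -> S p (g + h)) ->
  (forall p c i j g, S p g -> S p.+1 (c *: (minor i j * g))) ->
  forall (p : nat) h, bihom p p h -> E h = 0 -> S p h.
Proof.
move=> SC S0 SD SM; elim=> [|p IH] h hpp Eh; first by rewrite (bihom00 hpp).
have S_sum (I : finType) (f : I -> P) : (forall i, S p.+1 (f i)) -> S p.+1 (\sum_i f i).
  by move=> Sf; apply: big_ind => // *; exact: SD.
(* The right-hand side of [capelli] in bidegree (d, d) with E h = 0 is d ^ 2 + d times h; here d = p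
   + 1. *)
pose c : K := (p.+1 * p.+2)%:R.
have hE : \sum_i \sum_j x i * y j * omega i j h = c *: h.
  have [hx hy] := hpp; rewrite capelli Eh linear0 subr0 hy linearZ /= hx scalerA -scalerDl.
  by congr (_ *: _); rewrite /c natrM -[p.+2]addn1 natrD mulrDr mulr1.
(* Antisymmetrizing in i and j produces the minors and doubles the eigenvalue. *)
have hE2 : \sum_i \sum_j minor i j * omega i j h = (c + c) *: h.
  rewrite scalerDl -{1}hE -{1}hE [X in _ = _ + X]exchange_big -big_split.
  apply: eq_bigr => i _; rewrite -big_split; apply: eq_bigr => j _ /=.
  by rewrite /minor /omega; ring.
have c0 : c + c != 0 by rewrite -mulr2n mulrn_eq0 pnatr_eq0.
rewrite -[h](scalerK c0) -hE2 scaler_sumr; apply: (S_sum) => i.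
rewrite scaler_sumr; apply: (S_sum) => j; apply: (SM); apply: IH.
  apply: bihomB; apply: bihom_eq (bihom_dx _ (bihom_dy _ hpp)) => //;
    by rewrite -addn1 PoszD addrK.
by rewrite -omega_opE Eh /omega !linear0 ?addr0.
Qed.
End FirstFundamentalTheorem.

(** * Regular elements *)

Section Substitution.
Variables (K : comNzRingType) (N M : nat).

Definition subst (th : 'I_N -> {mpoly K[M]}) (h : {mpoly K[N]}) : {mpoly K[M]} :=
  mmap (@mpolyC M K) th h.
HB.instance Definition _ th := GRing.RMorphism.copy (subst th) (subst th).

Lemma substX th i : subst th 'X_i = th i.
Proof. by rewrite [LHS]mmapX mmap1U. Qed.
Lemma substC th a : subst th a%:MP = a%:MP.
Proof. exact: mmapC. Qed.
Lemma substZ th a h : subst th (a *: h) = a *: subst th h.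
Proof. by rewrite -!mul_mpolyC rmorphM /= substC. Qed.

Lemma meval_subst th h v : (subst th h).@[v] = h.@[fun i => (th i).@[v]].
Proof.
elim/mpoly_ind: h => [a|i|f g IHf IHg|f g IHf IHg].
- by rewrite substC !mevalC.
- by rewrite substX mevalXU.
- by rewrite rmorphD !mevalD IHf IHg.
- by rewrite rmorphM !mevalM IHf IHg.
Qed.

Lemma rmorph_eq_subst (phi : {rmorphism {mpoly K[N]} -> {mpoly K[M]}}) th :
  (forall a, phi a%:MP = a%:MP) -> (forall i, phi 'X_i = th i) -> phi =1 subst th.
Proof.
move=> pC pX; elim/mpoly_ind => [a|i|f g IHf IHg|f g IHf IHg].
- by rewrite substC pC.
- by rewrite substX pX.
- by rewrite !rmorphD IHf IHg.
- by rewrite !rmorphM IHf IHg.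
Qed.

Lemma eq_subst th th' h : th =1 th' -> subst th h = subst th' h.
Proof.
by move=> e; apply: (rmorph_eq_subst (phi := subst th)) => [a|i] /=; rewrite ?substC ?substX ?e.
Qed.
End Substitution.

Section Kill.
Variables (K : idomainType) (N : nat).
Local Notation P := {mpoly K[N]}.
Implicit Types (f g h q s t : P).

Definition kill (i : 'I_N) : P -> P := subst (fun j => if j == i then 0 else 'X_j).
HB.instance Definition _ i := GRing.RMorphism.copy (kill i) (kill i).

Lemma killX i j : kill i 'X_j = if j == i then 0 else 'X_j.
Proof. exact: substX. Qed.
Lemma killC i a : kill i a%:MP = a%:MP. Proof. exact: substC. Qed.

Lemma kill_idem i h : kill i (kill i h) = kill i h.
Proof.
rewrite -[LHS]/((kill i \o kill i) h); apply: rmorph_eq_subst => [a|j] /=.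
  by rewrite !killC.
by rewrite killX; case: eqP => // ji; rewrite ?rmorph0 // killX; case: eqP.
Qed.

Lemma killP i f : exists g, f = 'X_i * g + kill i f.
Proof.
elim/mpoly_ind: f => [a|j|f g [f' fE] [g' gE]|f g [f' fE] [g' gE]].
- by exists 0; rewrite mulr0 add0r killC.
- rewrite killX; case: eqP => [->|]; first by exists 1; rewrite mulr1 addr0.
  by exists 0; rewrite mulr0 add0r.
- by exists (f' + g'); rewrite rmorphD {1}fE {1}gE; ring.
- exists (f' * g + kill i f * g'); rewrite rmorphM {1}fE mulrDl {2}gE; ring.
Qed.

Lemma kill_eq0 i f : kill i f = 0 -> exists g, f = 'X_i * g.
Proof. by move=> f0; have [g] := killP i f; rewrite f0 addr0 => ->; exists g. Qed.

Lemma mpolyX_neq0 (i : 'I_N) : 'X_i != 0 :> P.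
Proof. by rewrite -msize_poly_eq0 msizeX mdeg1. Qed.

Definition nzd_mod q s := forall z w, s * z = q * w -> exists z', z = q * z'.

(** Modulo ['X_i] the ring is a domain in which q does not vanish, so ['X_i] divides w. *)
Lemma nzd_modX q i : kill i q != 0 -> nzd_mod q 'X_i.
Proof.
move=> q0 z w zw; have /(congr1 (kill i)) := zw; rewrite !rmorphM /= killX eqxx mul0r.
move/esym/eqP; rewrite mulf_eq0 (negPf q0) => /eqP/kill_eq0[w' wE].
by exists w'; apply: (mulfI (mpolyX_neq0 i)); rewrite zw wE; ring.
Qed.

Lemma nzd_modM q s t : nzd_mod q s -> nzd_mod q t -> nzd_mod q (s * t).
Proof. by move=> qs qt z w; rewrite -mulrA => /qs[z' /qt]. Qed.

Definition mvar (i : 'I_N) (m : 'X_{1..N}) : nat := m i.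
Fact mvar0 i : mvar i 0%MM = 0%N. Proof. exact: mnm0E. Qed.
Fact mvarD i : {morph mvar i : m1 m2 / (m1 + m2)%MM >-> (m1 + m2)%N}.
Proof. by move=> a b; exact: mnmDE. Qed.
HB.instance Definition _ i := isMeasure.Build N (mvar i) (mvar0 i) (mvarD i).

Lemma mvar_homX i j : ('X_j : P) \is (i == j : nat).-homog for (mvar i).
Proof. by rewrite dhomogX /= /mvar mnm1E (eq_sym j) eqxx. Qed.

Lemma pihomogM (mf : measure N) d e g h : g \is d.-homog for mf ->
  pihomog mf (d + e) (g * h) = g * pihomog mf e h.
Proof.
move=> gd; rewrite {1}[h](pihomog_partitionE (leqnn (mmeasure mf h))).
rewrite big_distrr linear_sum /=.
have piM e' : pihomog mf (d + e) (g * pihomog mf e' h) =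
    if e' == e then g * pihomog mf e h else 0.
  case: eqP => [->|/eqP ee']; first by rewrite pihomog_dE // dhomogM // pihomogP.
  by apply: pihomog_ne0 (dhomogM gd (pihomogP _ e' h)); rewrite eqn_add2l.
under eq_bigr => e' _ do rewrite piM.
have [eh|he] := ltnP e (mmeasure mf h).
  by rewrite -big_mkcond (big_pred1 (Ordinal eh)).
rewrite big1 => [|e' _]; last by case: eqP => // ee; move: (ltn_ord e'); rewrite ee ltnNge he.
rewrite pihomogE big_seq_cond big_pred0 ?mulr0 // => m.
by apply/negP => /andP[/(mmeasure_mnm_lt mf) mh /eqP me]; move: mh; rewrite me ltnNge he.
Qed.

(* The leading coefficient of s in the grading mf decides. *)
Lemma nzd_mod_lead (mf : measure N) q s1 s0 :
  q \is 0.-homog for mf -> s1 \is 1.-homog for mf -> s0 \is 0.-homog for mf ->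
  nzd_mod q s1 -> nzd_mod q (s1 + s0).
Proof.
move=> q0 s1h s0h qs1 z w zw.
have [k zk] : exists k, forall d, (k <= d)%N -> pihomog mf d z = 0.
  exists (mmeasure mf z) => d dz; rewrite pihomogE big_seq_cond big_pred0 // => m.
  by apply/negP => /andP[/(mmeasure_mnm_lt mf) mz /eqP md]; move: mz; rewrite md ltnNge dz.
elim: k z w zk zw => [|k IH] z w zk zw.
  exists 0; rewrite mulr0 [z](pihomog_partitionE (leqnn (mmeasure mf z))) big1 // => d _.
  exact: zk.
(* In degree k + 1 only the product of s1 with the degree k component of z is left. That component
   is therefore a multiple of q and can be subtracted. *)
have := congr1 (pihomog mf (1 + k)) zw.
rewrite mulrDl linearD /= pihomogM // -[X in pihomog mf X (s0 * z)]add0n pihomogM //.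
rewrite (zk (1 + k)%N) // mulr0 addr0 -[X in pihomog mf X (q * w)]add0n pihomogM // => /qs1[t tE].
have [||z' z'E] := IH (z - q * t) (w - (s1 + s0) * t).
- move=> d; rewrite leq_eqVlt => /orP[/eqP<-|kd].
    by rewrite linearB /= -tE pihomog_id subrr.
  by rewrite linearB /= zk // -tE (pihomog_ne0 _ (pihomogP mf k z)) ?subr0 // neq_ltn kd.
- by rewrite !mulrBr zw; ring.
by exists (z' + t); rewrite mulrDr -z'E subrK.
Qed.
End Kill.

(** * The incidence ideal *)

Section Forms.
Variables (m : nat).
Definition i0 : 'I_m.+2 := ord0.
Definition i1 : 'I_m.+2 := lift ord0 ord0.
Definition iu (i : 'I_m) : 'I_m.+2 := lift ord0 (lift ord0 i).

Lemma i01P (S : 'I_m.+2 -> Prop) : S i0 -> S i1 -> (forall i, S (iu i)) -> forall i, S i.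
Proof.
move=> S0 S1 Su i; case: (unliftP ord0 i) => [j|] -> //.
by case: (unliftP (ord0 : 'I_m.+1) j) => [k|] ->; [exact: Su | exact: S1].
Qed.

Lemma i10 : (i1 == i0) = false. Proof. by apply/negbTE/eqP => /(congr1 val). Qed.
Lemma i01 : (i0 == i1) = false. Proof. by apply/negbTE/eqP => /(congr1 val). Qed.
Lemma iu0 i : (iu i == i0) = false. Proof. by apply/negbTE/eqP => /(congr1 val). Qed.
Lemma iu1 i : (iu i == i1) = false. Proof. by apply/negbTE/eqP => /(congr1 val). Qed.
Lemma i0u i : (i0 == iu i) = false. Proof. by apply/negbTE/eqP => /(congr1 val). Qed.
Lemma i1u i : (i1 == iu i) = false. Proof. by apply/negbTE/eqP => /(congr1 val). Qed.
Lemma iuu i j : (iu i == iu j) = (i == j).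
Proof. by rewrite !(inj_eq lift_inj). Qed.
Definition iE := (i10, i01, iu0, iu1, i0u, i1u, iuu, @eqxx _ i0, @eqxx _ i1).

Section Ring.
Variable R : comNzRingType.
Implicit Types (x y z : 'I_m.+2 -> R).

Definition qform x : R := x i0 * x i1 + \sum_i x (iu i) ^+ 2.
(* Twice the polar form of qform. *)
Definition bform x y : R :=
  x i0 * y i1 + x i1 * y i0 + 2%:R * \sum_i x (iu i) * y (iu i).
End Ring.

Lemma qform_morph (R S : comNzRingType) (phi : {rmorphism R -> S}) (x : 'I_m.+2 -> R) :
  phi (qform x) = qform (phi \o x).
Proof.
rewrite /qform rmorphD rmorphM rmorph_sum /=; congr (_ + _).
by apply: eq_bigr => i _; rewrite rmorphXn.
Qed.
Lemma bform_morph (R S : comNzRingType) (phi : {rmorphism R -> S}) (x y : 'I_m.+2 -> R) :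
  phi (bform x y) = bform (phi \o x) (phi \o y).
Proof.
rewrite /bform !rmorphD !rmorphM rmorph_sum /= rmorph_nat; congr (_ + _ * _).
by apply: eq_bigr => i _; rewrite rmorphM.
Qed.
Lemma eq_qform (R : comNzRingType) (x y : 'I_m.+2 -> R) : x =1 y -> qform x = qform y.
Proof.
by move=> e; rewrite /qform !e; congr (_ + _); apply: eq_bigr => i _; rewrite e.
Qed.
Lemma eq_bform (R : comNzRingType) (x x' y y' : 'I_m.+2 -> R) :
  x =1 x' -> y =1 y' -> bform x y = bform x' y'.
Proof.
move=> e e'; rewrite /bform !e !e'; congr (_ + _ * _).
by apply: eq_bigr => i _; rewrite e e'.
Qed.
End Forms.
Arguments i0 {m}.
Arguments i1 {m}.

Section Ideal.
Variables (K : numFieldType) (m : nat).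
Hypothesis m_gt0 : (0 < m)%N.
Local Notation n := m.+2.
Local Notation P := {mpoly K[n + n]}.
Implicit Types (f g h z w : P) (k l : int).
Local Notation E := (@opE K n).
Local Notation x := (@xv K n).
Local Notation y := (@yv K n).

Definition Q1 : P := qform x.
Definition Q2 : P := qform y.
Definition LL : P := bform x y.
Definition inJ h := exists f g, h = Q1 * f + LL * g.

Lemma inJ0 : inJ 0. Proof. by exists 0, 0; rewrite !mulr0 addr0. Qed.
Lemma inJD f g : inJ f -> inJ g -> inJ (f + g).
Proof. by move=> [a [b ->]] [c [d ->]]; exists (a + c), (b + d); ring. Qed.
Lemma inJM f g : inJ g -> inJ (f * g).
Proof. by move=> [a [b ->]]; exists (f * a), (f * b); ring. Qed.
Lemma inJB f g : inJ f -> inJ g -> inJ (f - g).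
Proof. by move=> fJ gJ; rewrite -mulN1r; apply/inJD/inJM. Qed.

Definition qu : P := \sum_i x (iu i) ^+ 2.
Definition ux : P := 2%:R * \sum_i x (iu i) * y (iu i).
Definition l0 : P := x i1 * y i0 + ux.
Lemma Q1E : Q1 = x i0 * x i1 + qu. Proof. by []. Qed.
Lemma LLE : LL = x i0 * y i1 + l0. Proof. by rewrite /LL /bform addrA. Qed.

Lemma opE_M f g : E (f * g) = E f * g + f * E g. Proof. exact: derivationM. Qed.
Lemma opE_Q1 : E Q1 = 0.
Proof.
rewrite /Q1 /qform linearD linear_sum /= opE_M !opX mul0r mulr0 !add0r.
by rewrite big1 // => i _; rewrite opE_M !opX mul0r mulr0 addr0.
Qed.
Lemma opE_natl (k : nat) h : E (k%:R * h) = k%:R * E h.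
Proof. by rewrite !mulr_natl linearMn. Qed.
Lemma opE_LL : E LL = 2%:R * Q1.
Proof.
rewrite /Q1 /LL /qform /bform !linearD /= opE_natl !opE_M !opX linear_sum /=.
rewrite (eq_bigr (fun i => x (iu i) ^+ 2)) => [|i _]; first by ring.
by rewrite opE_M !opX; ring.
Qed.
Lemma opE_Q2 : E Q2 = LL.
Proof.
rewrite /Q2 /LL /qform /bform !linearD /= !opE_M !opX linear_sum /=.
rewrite big_distrr (eq_bigr (fun i => 2%:R * (x (iu i) * y (iu i)))) /=; first by ring.
by move=> i _; rewrite opE_M !opX; ring.
Qed.

Lemma bihom_sq i : bihom 2 0 (x i ^+ 2).
Proof. by apply: bihom_eq (bihomX 2 (bihom_xv i)). Qed.
Lemma bihom_qu : bihom 2 0 qu.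
Proof. by apply: bihom_sum => i _; exact: bihom_sq. Qed.
Lemma bihom_Q1 : bihom 2 0 Q1.
Proof. by apply: bihomD bihom_qu; exact: (bihomM (bihom_xv _) (bihom_xv _)). Qed.
Lemma bihom_xy i j : bihom 1 1 (x i * y j).
Proof. exact: (bihomM (bihom_xv _) (bihom_yv _)). Qed.
Lemma bihom_ux : bihom 1 1 ux.
Proof.
rewrite /ux mulr_natl -scaler_nat; apply/bihomZ/bihom_sum => i _; exact: bihom_xy.
Qed.
Lemma bihom_l0 : bihom 1 1 l0.
Proof. by apply: bihomD bihom_ux; exact: bihom_xy. Qed.
Lemma bihom_LL : bihom 1 1 LL.
Proof. by rewrite LLE; apply: bihomD bihom_l0; exact: bihom_xy. Qed.
Lemma bihom_Q2 : bihom 0 2 Q2.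
Proof.
apply: bihomD; first exact: (bihomM (bihom_yv _) (bihom_yv _)).
by apply: bihom_sum => i _; by apply: bihom_eq (bihomX 2 (bihom_yv (iu i))).
Qed.

Lemma inJ_bihom k l h : bihom k l h -> inJ h ->
  exists f g, [/\ bihom (k - 2) l f, bihom (k - 1) (l - 1) g & h = Q1 * f + LL * g].
Proof.
move=> hkl [f [g hE]]; exists (biproj (k - 2) l f), (biproj (k - 1) (l - 1) g).
split; try exact: bihom_biproj.
by rewrite -{1}(biproj_id hkl) hE linearD /= (biprojM _ _ _ bihom_Q1)
  (biprojM _ _ _ bihom_LL) subr0.
Qed.

Lemma kx_x i j : kill (lshift n i) (x j) = if j == i then 0 else x j.
Proof. by rewrite killX (inj_eq (@lshift_inj _ _)). Qed.
Lemma kx_y i j : kill (lshift n i) (y j) = y j.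
Proof. by rewrite killX eq_rlshift. Qed.
Lemma ky_x i j : kill (rshift n i) (x j) = x j.
Proof. by rewrite killX eq_lrshift. Qed.
Lemma ky_y i j : kill (rshift n i) (y j) = if j == i then 0 else y j.
Proof. by rewrite killX (inj_eq (@rshift_inj _ _)). Qed.
Definition kE := (kx_x, kx_y, ky_x, ky_y, iE).

Lemma meval_qu v : qu.@[v] = \sum_i v (lshift n (iu i)) ^+ 2.
Proof. by rewrite rmorph_sum; apply: eq_bigr => i _ /=; rewrite rmorphXn /= mevalXU. Qed.

Lemma qu_neq0 : qu != 0.
Proof.
apply/eqP => /(congr1 (meval (fun=> 1))); rewrite meval_qu meval0.
rewrite sumr_const card_ord expr1n => /eqP; rewrite pnatr_eq0.
by case: m m_gt0.
Qed.
Lemma kill_qu j : (forall i, j != lshift n (iu i)) -> kill j qu = qu.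
Proof.
move=> jn; rewrite rmorph_sum; apply: eq_bigr => i _.
by rewrite rmorphXn /= killX eq_sym (negPf (jn i)).
Qed.
Lemma kill_qu0 : kill (lshift n i0) qu = qu.
Proof. by apply: kill_qu => i; rewrite (inj_eq (@lshift_inj _ _)) iE. Qed.
Lemma kill_qu1 : kill (lshift n i1) qu = qu.
Proof. by apply: kill_qu => i; rewrite (inj_eq (@lshift_inj _ _)) iE. Qed.
Lemma kill_quy i : kill (rshift n i) qu = qu.
Proof. by apply: kill_qu => j; rewrite eq_rlshift. Qed.

Lemma kill_Q1 : kill (lshift n i0) Q1 = qu.
Proof. by rewrite Q1E rmorphD rmorphM /= kill_qu0 !kE mul0r add0r. Qed.
Lemma Q1_neq0 : Q1 != 0.
Proof. by apply: contraNneq qu_neq0 => Q0; rewrite -kill_Q1 Q0 rmorph0. Qed.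
Lemma kill_Q1y i : kill (rshift n i) Q1 = Q1.
Proof. by rewrite Q1E rmorphD rmorphM /= kill_quy !kE. Qed.

Lemma mvar_x i j : x j \is (i == lshift n j : nat).-homog for (mvar i).
Proof. exact: mvar_homX. Qed.
Lemma mvar_y i j : y j \is (i == rshift n j : nat).-homog for (mvar i).
Proof. exact: mvar_homX. Qed.

Lemma mvar_qu i : qu \is 0.-homog for (mvar (rshift n i)).
Proof.
apply: rpred_sum => j _; rewrite expr2.
by have := dhomogM (mvar_x (rshift n i) (iu j)) (mvar_x (rshift n i) (iu j)); rewrite eq_rlshift.
Qed.
Lemma mvar_Q1 i : Q1 \is 0.-homog for (mvar (rshift n i)).
Proof.
rewrite Q1E rpredD ?mvar_qu //.
by have := dhomogM (mvar_x (rshift n i) i0) (mvar_x (rshift n i) i1); rewrite !eq_rlshift.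
Qed.
Lemma mvar_xy i j j' : x j * y j' \is (i == j' : nat).-homog for (mvar (rshift n i)).
Proof.
have := dhomogM (mvar_x (rshift n i) j) (mvar_y (rshift n i) j').
by rewrite !eq_rlshift (inj_eq (@rshift_inj _ _)).
Qed.
Lemma mvar_ux i : i = i0 \/ i = i1 -> ux \is 0.-homog for (mvar (rshift n i)).
Proof.
move=> ii; rewrite /ux mulr_natl; apply/rpredMn/rpred_sum => j _.
by have := mvar_xy i (iu j) (iu j); case: ii => ->; rewrite iE.
Qed.
Lemma mvar_l0 : l0 \is 0.-homog for (mvar (rshift n i1)).
Proof.
rewrite /l0 rpredD ?mvar_ux //; last by right.
by have := mvar_xy i1 i1 i0; rewrite iE.
Qed.

(** In the variable y_1 the leading term of [LL] is x_0 y_1. Killing x_0 turns [Q1] into [qu], and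
    killing y_1 leaves [Q1] as it is; neither result is 0, so both factors are regular modulo
    [Q1]. *)
Lemma nzd_LL : nzd_mod Q1 LL.
Proof.
rewrite LLE; apply: (@nzd_mod_lead _ _ (mvar (rshift n i1))).
- exact: mvar_Q1.
- by have := mvar_xy i1 i0 i1; rewrite eqxx.
- exact: mvar_l0.
- apply: nzd_modM; apply: nzd_modX; rewrite ?kill_Q1 ?kill_Q1y; [exact: qu_neq0|exact: Q1_neq0].
Qed.

(** Modulo x_0 the pair [Q1], [LL] becomes [qu], [l0]. The leading term in y_0 is now x_1 y_0, and
    [qu] contains neither variable. *)
Lemma nzd_l0 : nzd_mod qu l0.
Proof.
apply: (@nzd_mod_lead _ _ (mvar (rshift n i0))).
- exact: mvar_qu.
- by have := mvar_xy i0 i1 i0; rewrite eqxx.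
- by apply: mvar_ux; left.
- by apply: nzd_modM; apply: nzd_modX; rewrite ?kill_qu1 ?kill_quy qu_neq0.
Qed.

Lemma kill_l0 : kill (lshift n i0) l0 = l0.
Proof.
rewrite /l0 /ux rmorphD !rmorphM rmorph_sum rmorph_nat /= !kE; congr (_ + _ * _).
by apply: eq_bigr => i _; rewrite rmorphM /= !kE.
Qed.
Lemma kill_LL : kill (lshift n i0) LL = l0.
Proof. by rewrite LLE rmorphD rmorphM /= kill_l0 !kE mul0r add0r. Qed.

(** Setting x_0 = 0 leaves a syzygy of [qu] and [l0], which is a multiple of the Koszul syzygy by
    [nzd_l0]. The latter lifts to [Q1] and [LL], and subtracting it makes the relation divisible by
    x_0. *)
Lemma x0_nzd h : inJ (x i0 * h) -> inJ h.
Proof.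
move=> [f [g hE]].
have := congr1 (kill (lshift n i0)) hE.
rewrite rmorphD !rmorphM /= kill_Q1 kill_LL kx_x eqxx mul0r.
have [f1 fE] := killP (lshift n i0) f; have [g1 gE] := killP (lshift n i0) g.
move: (kill _ f) (kill _ g) fE gE => f0 g0 fE gE e0.
have [c cE] : exists c, g0 = qu * c.
  by apply: (nzd_l0 (w := - f0)); apply/eqP; rewrite mulrN -addr_eq0 addrC -e0.
have f0E : f0 = - l0 * c.
  apply: (mulfI qu_neq0); apply/eqP; rewrite -subr_eq0 e0 cE; apply/eqP; ring.
(* The terms in c come from [qu] = Q1 - x_0 x_1 and [l0] = LL - x_0 y_1, substituted in the Koszul
   syzygy (-l0 c, qu c). *)
exists (f1 + y i1 * c), (g1 - x i1 * c); apply: (mulfI (mpolyX_neq0 K (lshift n i0))).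
rewrite hE fE gE f0E cE Q1E LLE -/(x i0); ring.
Qed.

End Ideal.
Arguments Q1 {K m}.
Arguments Q2 {K m}.
Arguments LL {K m}.
Arguments qu {K m}.
Arguments ux {K m}.
Arguments l0 {K m}.
Arguments bihom_Q1 {K m}.
Arguments bihom_Q2 {K m}.
Arguments bihom_LL {K m}.

(** * Scaling of bihomogeneous polynomials, and vanishing on a chart *)

Section Scaling.
Variables (K : numFieldType) (n : nat).
Local Notation P := {mpoly K[n + n]}.
Local Notation x := (@xv K n).
Local Notation y := (@yv K n).

Lemma subst_monom (N M : nat) (th : 'I_N -> {mpoly K[M]}) (m : 'X_{1..N}) :
  subst th 'X_[m] = \prod_i th i ^+ m i.
Proof.
rewrite mpolyXE_id rmorph_prod; apply: eq_bigr => i _.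
by rewrite rmorphXn /= substX.
Qed.

Lemma subst_scale (k l : nat) (s t : P) h : bihom k l h ->
  subst (vf (fun i => s * x i) (fun i => t * y i)) h = s ^+ k * t ^+ l * h.
Proof.
move=> hkl; rewrite {1}[h]mpolyE rmorph_sum /= [in RHS](mpolyE h) big_distrr /=.
rewrite big_seq [RHS]big_seq; apply: eq_bigr => m /(bihom_supp hkl)[[<-] [<-]].
rewrite substZ -scalerAr; congr (_ *: _); rewrite subst_monom mpolyXE_id !big_split_ord /=.
under eq_bigr do rewrite vf_l exprMn.
under [X in _ * X = _]eq_bigr do rewrite vf_r exprMn.
by rewrite !big_split !prodrXr /=; ring.
Qed.

Lemma eval_scale (k l : nat) (s t : K) (a b : 'I_n -> K) h : bihom k l h ->
  h.@[vf (fun i => s * a i) (fun i => t * b i)] = s ^+ k * t ^+ l * h.@[vf a b].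
Proof.
move=> /(@subst_scale _ _ s%:MP t%:MP)/(congr1 (meval (vf a b))).
rewrite !mevalM !rmorphXn /= !mevalC => <-; rewrite meval_subst; apply: meval_eq => i.
by case: (splitP i) => j ij; [have -> : i = lshift n j by apply: val_inj |
   have -> : i = rshift n j by apply: val_inj]; rewrite ?vf_l ?vf_r mevalM mevalC mevalXU
   ?vf_l ?vf_r.
Qed.

Lemma subst_x0 (k l : nat) h : bihom k l h -> (0 < k)%N -> subst (vf (fun=> 0) y) h = 0.
Proof.
move=> hkl k0; transitivity (subst (vf (fun i => 0 * x i) (fun i => 1 * y i)) h).
  apply: eq_subst => i; case: (splitP i) => j ij;
    [have -> : i = lshift n j by apply: val_inj | have -> : i = rshift n j by apply: val_inj];
    by rewrite ?vf_l ?vf_r ?mul0r ?mul1r.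
by rewrite (subst_scale _ _ hkl) expr0n; case: k k0 {hkl} => // k _; rewrite !mul0r.
Qed.
End Scaling.

Section IdealMore.
Variables (K : numFieldType) (m : nat).
Hypothesis m_gt0 : (0 < m)%N.
Local Notation n := m.+2.
Local Notation P := {mpoly K[n + n]}.
Implicit Types (f g h z w : P) (k l : int).
Local Notation x := (@xv K n).
Local Notation y := (@yv K n).

Lemma inJ_subst (th th' : 'I_(n + n) -> P) h :
  (forall i, inJ (th i - th' i)) -> inJ (subst th h - subst th' h).
Proof.
move=> tt; elim/mpoly_ind: h => [a|i|f g IHf IHg|f g IHf IHg].
- by rewrite !substC subrr; exact: inJ0.
- by rewrite !substX.
- by rewrite !rmorphD opprD addrACA; exact: inJD.
- rewrite !rmorphM /=.
  have -> a b c d : a * b - c * d = a * (b - d) + d * (a - c) :> P by ring.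
  by apply: inJD; exact: inJM.
Qed.

Lemma x0X_nzd N h : inJ (x i0 ^+ N * h) -> inJ h.
Proof. by elim: N h => [|N IH] h; rewrite ?mul1r // exprSr -mulrA => /IH/(x0_nzd m_gt0). Qed.

(* The cone over the affine chart x_0 <> 0 of the incidence variety is parametrized by
   polynomials; chart is this parametrization. *)
Definition chartx (i : 'I_n) : P :=
  if i == i1 then - qu else x i0 * x i.
Definition charty (i : 'I_n) : P :=
  if i == i1 then qu * y i0 - x i0 * ux else x i0 ^+ 2 * y i.

Lemma qform_chart : qform chartx = 0.
Proof.
rewrite /qform /chartx !iE (eq_bigr (fun i => x i0 ^+ 2 * x (iu i) ^+ 2)) => [|i _].
  by rewrite -big_distrr /= -/qu; ring.
by rewrite iE; ring.
Qed.

Lemma bform_chart : bform chartx charty = 0.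
Proof.
rewrite /bform /chartx /charty !iE.
rewrite (eq_bigr (fun i => x i0 ^+ 3 * (x (iu i) * y (iu i)))) => [|i _].
  by rewrite -big_distrr /= /ux; ring.
by rewrite iE; ring.
Qed.

Lemma eval_vf (th th' : 'I_n -> P) v :
  (fun i => (vf th th' i).@[v]) =1 vf (fun i => (th i).@[v]) (fun i => (th' i).@[v]).
Proof.
by move=> i; case: (splitP i) => j ij; [have -> : i = lshift n j by apply: val_inj |
   have -> : i = rshift n j by apply: val_inj]; rewrite ?vf_l ?vf_r.
Qed.

(** A Nullstellensatz for J with explicit means. Modulo J the parametrization is the scaling of x by
    x_0 and of y by x_0 ^ 2, so x_0 ^ (k + 2 l) h is congruent to h on the chart, which is 0; the
    power of x_0 is then cancelled by [x0X_nzd]. *)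
Lemma inJ_vanish (k l : nat) h : bihom k l h ->
  (forall a b : 'I_n -> K, a i0 != 0 -> qform a = 0 -> bform a b = 0 -> h.@[vf a b] = 0) ->
  inJ h.
Proof.
move=> hkl h0; have chart0 : subst (vf chartx charty) h = 0.
  (* The factor x_0 takes care of the parameters with x_0 = 0, where the hypothesis says nothing. *)
  apply: (mulfI (mpolyX_neq0 K (lshift n i0))); rewrite mulr0; apply: mpoly_eq0 => v.
  rewrite mevalM mevalXU; case: (eqVneq (v (lshift n i0)) 0) => [->|v0]; first by rewrite mul0r.
  rewrite meval_subst (meval_eq _ (eval_vf _ _ v)) h0 ?mulr0 //.
  - by rewrite /chartx iE mevalM mevalXU mulf_neq0.
  - by have := congr1 (meval v) qform_chart; rewrite qform_morph meval0.
  - by have := congr1 (meval v) bform_chart; rewrite bform_morph meval0.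
suff : inJ (x i0 ^+ (k + 2 * l) * h) by move/x0X_nzd.
have -> : x i0 ^+ (k + 2 * l) * h =
    subst (vf (fun i => x i0 * x i) (fun i => x i0 ^+ 2 * y i)) h - subst (vf chartx charty) h.
  by rewrite chart0 subr0 (subst_scale _ _ hkl) exprD exprM.
apply: inJ_subst => i; case: (splitP i) => j ij;
  [have -> : i = lshift n j by apply: val_inj | have -> : i = rshift n j by apply: val_inj].
  rewrite !vf_l /chartx; case: eqP => [->|_]; last by rewrite subrr; exact: inJ0.
  by exists 1, 0; rewrite Q1E; ring.
rewrite !vf_r /charty; case: eqP => [->|_]; last by rewrite subrr; exact: inJ0.
by exists (- y i0), (x i0); rewrite Q1E LLE /l0; ring.
Qed.

Lemma inJ_eval h (a b : 'I_n -> K) : inJ h -> qform a = 0 -> bform a b = 0 -> h.@[vf a b] = 0.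
Proof.
move=> [f [g ->]] qa bab; rewrite mevalD !mevalM.
have -> : Q1.@[vf a b] = 0.
  by rewrite /Q1 qform_morph -[RHS]qa; apply: eq_qform => i /=; rewrite mevalXU vf_l.
have -> : LL.@[vf a b] = 0.
  by rewrite /LL bform_morph -[RHS]bab; apply: eq_bform => i /=; rewrite mevalXU ?vf_l ?vf_r.
by rewrite !mul0r addr0.
Qed.

Lemma bihom_subst (th : 'I_(n + n) -> P) k l h :
  (forall i, bihom 1 0 (th (lshift n i))) -> (forall i, bihom 0 1 (th (rshift n i))) ->
  bihom k l h -> bihom k l (subst th h).
Proof.
move=> tx ty hkl; rewrite [h]mpolyE rmorph_sum /= big_seq; apply: bihom_sum => mm.
move=> /(bihom_supp hkl)[<- <-]; rewrite substZ; apply: bihomZ.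
have bprod (I : finType) (kk ll : I -> nat) (f : I -> P) : (forall i, bihom (kk i) (ll i) (f i)) ->
    bihom (\sum_i kk i)%N (\sum_i ll i)%N (\prod_i f i).
  move=> fkl; apply: (big_ind3 (fun (a b : nat) c => bihom a b c)) => //.
    by rewrite -mpolyC1; exact: bihomC.
  by move=> a b c a' b' c' ? ?; rewrite !PoszD; exact: bihomM.
rewrite subst_monom big_split_ord /= -[Posz (mdegx mm)]addr0 -[Posz (mdegy mm)]add0r.
apply: bihomM.
  have := bprod _ (fun i => mm (lshift n i)) (fun=> 0%N) (fun i => th (lshift n i) ^+ mm (lshift n i)).
  rewrite sum_nat_const muln0; apply => i; apply: bihom_eq (bihomX _ (tx i)) => //.
    by rewrite natz.
  by rewrite mul0rn.
have := bprod _ (fun=> 0%N) (fun i => mm (rshift n i)) (fun i => th (rshift n i) ^+ mm (rshift n i)).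
rewrite sum_nat_const muln0; apply => i; apply: bihom_eq (bihomX _ (ty i)) => //.
  by rewrite mul0rn.
by rewrite natz.
Qed.
End IdealMore.

Section KillComm.
Variables (K : idomainType) (N : nat).
Lemma kill_comm (i j : 'I_N) (h : {mpoly K[N]}) : kill i (kill j h) = kill j (kill i h).
Proof.
pose th k : {mpoly K[N]} := if (k == i) || (k == j) then 0 else 'X_k.
transitivity (subst th h).
  rewrite -[LHS]/((kill i \o kill j) h); apply: rmorph_eq_subst => [a|k] /=.
    by rewrite !killC.
  by rewrite killX /th orbC; case: (k == j); rewrite ?rmorph0 //= killX.
apply/esym; rewrite -[LHS]/((kill j \o kill i) h); apply: rmorph_eq_subst => [a|k] /=.
  by rewrite !killC.
by rewrite killX /th; case: (k == i); rewrite ?rmorph0 //= killX.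
Qed.
End KillComm.

(** * Division by powers of x_0 modulo the incidence ideal *)

Section Saturation.
Variables (K : numFieldType) (m : nat).
Hypothesis m_gt0 : (0 < m)%N.
Local Notation n := m.+2.
Local Notation P := {mpoly K[n + n]}.
Implicit Types (f g h z w : P) (k l : int).
Local Notation x := (@xv K n).
Local Notation y := (@yv K n).

Let j0 : 'I_m := Ordinal m_gt0.
Local Notation u0 := (iu j0).

Lemma ord_unique : m = 1%N -> forall i j : 'I_m, i = j.
Proof.
move=> m1 i j; apply: val_inj => /=; have := ltn_ord i; have := ltn_ord j; lia.
Qed.

Lemma bihom_kill i k l h : bihom k l h -> bihom k l (kill i h).
Proof.
move=> hkl; apply: bihom_subst hkl => j; case: eqP => _; try exact: bihom0.
  exact: bihom_xv.
exact: bihom_yv.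
Qed.

Lemma kill_div i f g : f = 'X_i * g -> forall j, j != i -> kill j f = f -> kill j g = g.
Proof.
move=> -> j ji; rewrite rmorphM /= killX eq_sym (negPf ji).
exact: (mulfI (mpolyX_neq0 K i)).
Qed.

(** For m = 1 a polynomial free of x_0 and x_1 has a single x-variable left, so positive x-degree
    means divisibility by it. *)
Lemma divide_u0 k l f : m = 1%N -> 0 < k -> bihom k l f ->
  kill (lshift n i0) f = f -> kill (lshift n i1) f = f ->
  exists g, [/\ f = x u0 * g, bihom (k - 1) l g, kill (lshift n i0) g = g &
     kill (lshift n i1) g = g].
Proof.
move=> m1 k0 fkl f0 f1.
have l0 : 0 <= l \/ f = 0.
  by case: (lerP 0 l) => l0; [left | right; rewrite (bihom_neg fkl) // l0 orbT].
have fu : kill (lshift n u0) f = 0.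
  case: l0 => [l0|->]; last by rewrite rmorph0.
  case: k k0 fkl => // k k0; case: l l0 => // l _ fkl.
  rewrite -(subst_x0 fkl) // -{1}f0 -{1}f1.
  rewrite -[LHS]/((kill (lshift n u0) \o (kill (lshift n i0) \o kill (lshift n i1))) f).
  apply: rmorph_eq_subst => [a|j] /=; first by rewrite !killC.
  case: (splitP j) => i ji;
    [have -> : j = lshift n i by apply: val_inj | have -> : j = rshift n i by apply: val_inj].
    rewrite vf_l -/(x i) kx_x; move: i {ji}; apply: i01P.
    - by rewrite !iE kx_x !iE rmorph0.
    - by rewrite !iE !rmorph0.
    - move=> i; rewrite !iE kx_x !iE kx_x iuu.
      by rewrite (ord_unique m1 i j0) eqxx.
  by rewrite vf_r -/(y i) !kx_y.
have [g fg] := kill_eq0 fu; have fg' : f = x u0 * biproj (k - 1) l g.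
  by rewrite -{1}(biproj_id fkl) fg (biprojM _ _ _ (bihom_xv u0)) subr0.
exists (biproj (k - 1) l g); split => //; first exact: bihom_biproj.
  by apply: (kill_div fg') => //; rewrite (inj_eq (@lshift_inj _ _)) iE.
by apply: (kill_div fg') => //; rewrite (inj_eq (@lshift_inj _ _)) iE.
Qed.

Lemma qu_m1 : m = 1%N -> qu = x u0 ^+ 2.
Proof.
move=> m1; rewrite /qu (bigD1 j0) //= big1 ?addr0 // => i /eqP[]; exact: ord_unique.
Qed.

(** Up to the factor 2, the leading coefficient of [ux] in the variable y_u is x_u. Killing x_u
    leaves a nonzero part of [qu] because there is a second index. *)
Lemma nzd_ux f g : (1 < m)%N -> qu * f + ux * g = 0 -> exists c, g = qu * c.
Proof.
move=> m1 fg; pose s0 : P := \sum_(i | i != j0) x (iu i) * y (iu i).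
have nz : nzd_mod qu (x u0 * y u0 + s0).
  apply: (@nzd_mod_lead _ _ (mvar (rshift n u0))).
  - exact: mvar_qu.
  - by have := mvar_xy K u0 u0 u0; rewrite eqxx.
  - apply: rpred_sum => i ij; have := mvar_xy K u0 (iu i) (iu i).
    by rewrite iuu eq_sym (negPf ij).
  - apply: nzd_modM; apply: nzd_modX; last by rewrite kill_quy qu_neq0.
    have -> : kill (lshift n u0) qu = \sum_(i | i != j0) x (iu i) ^+ 2.
      rewrite /qu rmorph_sum (bigD1 j0) //= rmorphXn /= kx_x eqxx expr0n add0r.
      by apply: eq_bigr => i ij; rewrite rmorphXn /= kx_x iuu (negPf ij).
    apply/eqP => /(congr1 (meval (fun=> 1))); rewrite meval0 rmorph_sum /=.
    rewrite (eq_bigr (fun=> 1)) => [|i _]; last by rewrite rmorphXn /= mevalXU expr1n.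
    rewrite sumr_const => /eqP; rewrite pnatr_eq0 (eq_card (B := predC1 j0)) // cardC1.
    by rewrite card_ord => /eqP; lia.
have {nz} := nz g (- (2%:R^-1 *: f)); apply.
have n2 : 2%:R != 0 :> K by rewrite pnatr_eq0.
apply: (scalerI n2); rewrite mulrN scalerN -scalerAr scalerA divff // scale1r.
apply/eqP; rewrite -addr_eq0 addrC -[_ == _]/(_ == _) -{}fg /ux (bigD1 j0) //=.
by apply/eqP; rewrite -/s0 scaler_nat; ring.
Qed.

(** Setting x_0 = 0 and then x_1 = 0 leaves a syzygy of [qu] and [ux], which must be shown to be a
    Koszul one. For m = 1 the two share the factor x_u, and the second component has to be divisible
    by x_u ^ 2: it is when its x-degree k is at least 2, and for l = 0 it is zero, having negative
    y-degree. *)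
Lemma x1_nzd k l z w : bihom k l z -> [|| (1 < m)%N, 2 <= k | l == 0] ->
  inJ (x i1 * z - x i0 * w) -> exists2 w', bihom (k - 1) l w' & inJ (z - x i0 * w').
Proof.
move=> zkl cond [f' [g' zw']].
have [w0 [f [g [fk gk zw]]]] : exists w0 f g, [/\ bihom (k - 1) l f, bihom k (l - 1) g &
    x i1 * z = x i0 * w0 + Q1 * f + LL * g].
  exists (biproj k l w), (biproj (k - 1) l f'), (biproj k (l - 1) g').
  split; try exact: bihom_biproj.
  have x1z : bihom (1 + k) l (x i1 * z).
    by apply: bihom_eq (bihomM (bihom_xv i1) zkl); rewrite ?add0r.
  rewrite -(biproj_id x1z) -[x i1 * z](subrK (x i0 * w)) zw' !linearD /=.
  rewrite (biprojM _ _ _ bihom_Q1) (biprojM _ _ _ bihom_LL) (biprojM _ _ _ (bihom_xv _)).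
  have -> : 1 + k - 1 = k by lia.
  have -> : 1 + k - 2 = k - 1 by lia.
  by rewrite !subr0; ring.
suff [w' [f1 [g1 zE]]] : exists w' f1 g1, z = x i0 * w' + Q1 * f1 + LL * g1.
  exists (biproj (k - 1) l w'); first exact: bihom_biproj.
  exists (biproj (k - 2) l f1), (biproj (k - 1) (l - 1) g1).
  rewrite -{1}(biproj_id zkl) zE !linearD /=.
  rewrite (biprojM _ _ _ bihom_Q1) (biprojM _ _ _ bihom_LL) (biprojM _ _ _ (bihom_xv _)).
  by rewrite !subr0; ring.
have := congr1 (kill (lshift n i0)) zw.
rewrite !rmorphD !rmorphM /= kill_Q1 kill_LL !kx_x !iE mul0r add0r.
have [z1 zE] := killP (lshift n i0) z.
have f0k := bihom_kill (lshift n i0) fk; have g0k := bihom_kill (lshift n i0) gk.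
have fkk := kill_idem (lshift n i0) f; have gkk := kill_idem (lshift n i0) g.
move: (kill _ f) (kill _ g) (kill _ z) f0k g0k fkk gkk zE => f0 g0 z0 f0k g0k fkk gkk zE.
have [f1 f0E] := killP (lshift n i1) f0; have [g1 g0E] := killP (lshift n i1) g0.
move=> e; have := congr1 (kill (lshift n i1)) e.
rewrite rmorphD !rmorphM /= kill_qu1 !kx_x !iE mul0r.
have -> : kill (lshift n i1) l0 = ux :> P.
  rewrite /l0 /ux rmorphD !rmorphM rmorph_sum rmorph_nat /= !kE mul0r add0r.
  by congr (_ * _); apply: eq_bigr => i _; rewrite rmorphM /= !kE.
have g00k := bihom_kill (lshift n i1) g0k.
have g00a : kill (lshift n i0) (kill (lshift n i1) g0) = kill (lshift n i1) g0.
  by rewrite kill_comm gkk.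
have g00b := kill_idem (lshift n i1) g0.
move: (kill _ f0) (kill _ g0) f0E g0E g00k g00a g00b => f00 g00 f0E g0E g00k g00a g00b.
move/esym => e0.
have [c cE] : exists c, g00 = qu * c.
  case: (ltnP 1 m) cond => [m1 _|m1 /= cond]; first exact: nzd_ux m1 e0.
  have {m1} m1 : m = 1%N by apply/eqP; rewrite eqn_leq m1.
  case/orP: cond => [k2|/eqP l0]; last first.
    by exists 0; rewrite mulr0; apply: bihom_neg g00k _; rewrite l0 orbT.
  have [|a [-> ak aa ab]] := divide_u0 m1 _ g00k g00a g00b; first by lia.
  have [|b [-> _ _ _]] := divide_u0 m1 _ ak aa ab; first by lia.
  by exists b; rewrite (qu_m1 m1); ring.
have f00E : f00 = - ux * c.
  apply: (mulfI (qu_neq0 K m_gt0)); apply/eqP; rewrite -subr_eq0 -e0 cE; apply/eqP; ring.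
have z0E : z0 = qu * (f1 + y i0 * c) + l0 * g1.
  apply: (mulfI (mpolyX_neq0 K (lshift n i1))); rewrite -/(x i1) e f0E g0E f00E cE /l0.
  by rewrite -/(x i1); ring.
exists (z1 - x i1 * (f1 + y i0 * c) - y i1 * g1), (f1 + y i0 * c), g1.
by rewrite zE z0E Q1E LLE -/(x i0); ring.
Qed.

Lemma x1X_nzd N k l z w : bihom k l z -> [|| (1 < m)%N, 2 <= k | l == 0] ->
  inJ (x i1 ^+ N * z - x i0 * w) -> exists2 w', bihom (k - 1) l w' & inJ (z - x i0 * w').
Proof.
elim: N w => [|N IH] w zkl cond zw.
  by apply: (x1_nzd (w := x i1 * w)) => //; rewrite mul1r in zw;
    have := inJM (x i1) zw; rewrite mulrBr mulrCA.
have xz : bihom (k + N%:Z) l (x i1 ^+ N * z).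
  apply: bihom_eq (bihomM (bihomX N (bihom_xv i1)) zkl); first by rewrite natz addrC.
  by rewrite mul0rn add0r.
have [||w' _ zw'] := x1_nzd (w := w) xz; rewrite ?mulrA -?exprS //.
  by case/or3P: cond => [->|k2|->]; rewrite ?orbT //; apply/orP; right; apply/orP; left; lia.
exact: IH zw'.
Qed.

(** Each division by x_0 lowers the x-degree by one, and j + 1 <= k keeps it at least 2 up to the
    last division. After each one [x0_nzd] cancels x_0 from the relation with x_1 ^ N. *)
Lemma clear_x0 N j k l z w : bihom k l z -> (j%:Z + 1 <= k) || (l == 0) ->
  inJ (x i1 ^+ N * z - x i0 ^+ j * w) ->
  exists2 z', bihom (k - j%:Z) l z' & inJ (z - x i0 ^+ j * z').
Proof.
elim: j k z => [|j IH] k z zkl cond zw.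
  by exists z; rewrite ?subr0 ?mul1r ?subrr //; exact: inJ0.
have [||z1 z1k zz1] := x1X_nzd (N := N) (w := x i0 ^+ j * w) zkl; rewrite ?mulrA -?exprS //.
  by case/orP: cond => [k2|->]; rewrite ?orbT //; apply/orP; right; apply/orP; left; lia.
have zw1 : inJ (x i1 ^+ N * z1 - x i0 ^+ j * w).
  apply: (x0_nzd m_gt0); have := inJB zw (inJM (x i1 ^+ N) zz1).
  by congr inJ; rewrite exprS; ring.
have [|z' z'k z1z'] := IH _ _ z1k _ zw1.
  by case/orP: cond => [k2|->]; rewrite ?orbT //; apply/orP; left; lia.
exists z'; first by apply: bihom_eq z'k => //; lia.
have := inJD zz1 (inJM (x i0) z1z'); congr inJ; rewrite exprS; ring.
Qed.
End Saturation.

(** * Invariants inside and modulo the incidence ideal *)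

Section Invariants.
Variables (K : numFieldType) (m : nat).
Hypothesis m_gt0 : (0 < m)%N.
Local Notation n := m.+2.
Local Notation P := {mpoly K[n + n]}.
Implicit Types (f g h : P) (k l : int).
Local Notation E := (@opE K n).

Lemma opE_inJ f g : E (Q1 * f + LL * g) = Q1 * (E f + 2%:R * g) + LL * E g.
Proof. by rewrite linearD /= !opE_M opE_Q1 opE_LL; ring. Qed.

(** Write h = Q1 f + LL g. Since [Q1], [LL] is a regular sequence, E h = 0 yields E g = - Q1 r and E
    f + 2 g = LL r for one and the same r. Once r is invariant, f and g are determined by it: f = 2
    Q2 r and 2 g = - LL r. *)
Lemma invariant_inJ k h : bihom k k h -> E h = 0 -> inJ h ->
  exists r, [/\ h = (4%:R * Q1 * Q2 - LL ^+ 2) * r, bihom (k - 2) (k - 2) r & E r = 0].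
Proof.
move=> hkk Eh /(inJ_bihom hkk)[f [g [fk gk hE]]].
have {}Eh : Q1 * (E f + 2%:R * g) + LL * E g = 0 by rewrite -opE_inJ -hE.
have [r0 r0E] : exists r0, E g = Q1 * r0.
  apply: (nzd_LL m_gt0 (w := - (E f + 2%:R * g))).
  by move/eqP: Eh; rewrite addrC addr_eq0 mulrN => /eqP.
have Egk : bihom k (k - 2) (E g) by apply: bihom_eq (bihom_opE gk); lia.
pose r := - biproj (k - 2) (k - 2) r0.
have rk : bihom (k - 2) (k - 2) r by rewrite /r -scaleN1r; apply/bihomZ/bihom_biproj.
have EgE : E g = - Q1 * r.
  by rewrite /r mulrNN -{1}(biproj_id Egk) r0E (biprojM _ _ _ bihom_Q1) subr0.
have EfE : E f + 2%:R * g = LL * r.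
  apply: (mulfI (Q1_neq0 K m_gt0)); apply/eqP; rewrite -subr_eq0 -[X in _ == X]Eh EgE; apply/eqP; ring.
have [a ak Ea] := opE_invariant rk.
(* Adding the Koszul syzygy with coefficient a leaves h unchanged and replaces r by r - E a, which E
   kills. *)
pose f' := f - LL * a; pose g' := g + Q1 * a; pose r' := r - E a.
have Er' : E r' = 0 by [].
have r'k : bihom (k - 2) (k - 2) r'.
  by apply: bihomB rk _; apply: bihom_eq (bihom_opE ak); lia.
have f'k : bihom (k - 2) k f'.
  by apply: bihomB fk _; apply: bihom_eq (bihomM bihom_LL ak); lia.
have hE' : h = Q1 * f' + LL * g' by rewrite hE /f' /g'; ring.
have Eg' : E g' = - Q1 * r' by rewrite /g' linearD /= opE_M opE_Q1 EgE /r'; ring.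
have Ef' : E f' = LL * r' - 2%:R * g'.
  have -> : E f' = E f - (2%:R * Q1 * a + LL * E a) by rewrite linearB /= opE_M opE_LL.
  by rewrite -[E f](addrK (2%:R * g)) EfE /r' /g'; ring.
clearbody f' g' r'.
(* Both sides have bidegree (k - 2, k), hence weight -2, and the same image under the square of
   E. *)
have f'E : f' = 2%:R * Q2 * r'.
  apply/eqP; rewrite -subr_eq0; apply/eqP; apply: (@opE2_inj K _ (k - 1)).
    apply: bihomB; first by apply: bihom_eq f'k; lia.
    rewrite -mulrA mulr_natl -scaler_nat; apply: bihomZ.
    by apply: bihom_eq (bihomM bihom_Q2 r'k); lia.
  rewrite !linearB /= Ef' -mulrA opE_natl opE_M opE_Q2 Er' mulr0 addr0.
  by rewrite !linearB /= !opE_natl !opE_M !opE_LL Er' Eg'; ring.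
have g'E : 2%:R * g' = - LL * r'.
  have -> : 2%:R * g' = LL * r' - E f' by rewrite Ef'; ring.
  by rewrite f'E -mulrA opE_natl opE_M opE_Q2 Er'; ring.
have n2 : 2%:R != 0 :> K by rewrite pnatr_eq0.
exists (2%:R^-1 *: r'); split; last by rewrite linearZ /= Er' scaler0.
  have h2 : 2%:R * h = (4%:R * Q1 * Q2 - LL ^+ 2) * r'.
    rewrite hE' (_ : _ * _ = 2%:R * Q1 * f' + LL * (2%:R * g')); last by ring.
    by rewrite f'E g'E; ring.
  by apply: (scalerI n2); rewrite -scalerAr scalerA divff // scale1r -h2 scaler_nat mulr_natl.
exact: bihomZ.
Qed.

(** A correction Q1 a + LL d in J with the same image under E as h is needed. If E h = Q1 f + LL g,
    it is enough by [opE_inJ] that E d = g and E a + 2 d = f. *)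
Lemma invariant_lift k h : bihom k k h -> inJ (E h) ->
  exists h', [/\ bihom k k h', E h' = 0 & inJ (h - h')].
Proof.
move=> hkk /(inJ_bihom (bihom_opE hkk))[f [g [fk gk EhE]]].
have fk' : bihom (k - 1) (k - 1) f by apply: bihom_eq fk; lia.
have k1 : k - 1 - 1 < k + 1 - 1 by lia.
have [b bk Eb] := opE_surj k1 gk.
have bk' : bihom (k - 1) (k - 1) b by apply: bihom_eq bk; lia.
have n2 : 2%:R != 0 :> K by rewrite pnatr_eq0.
have [a ak Ea] := opE_invariant (bihomB fk' (bihomZ 2%:R bk')).
(* Here c is the invariant part of f - 2 b. Adding half of it to b yields E a + 2 d = f without
   disturbing E d = g. *)
pose c := f - 2%:R *: b - E a; pose d := b + 2%:R^-1 *: c.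
have ck : bihom (k - 1) (k - 1) c.
  apply: bihomB; first exact/bihomB/bihomZ.
  by apply: bihom_eq (bihom_opE ak); lia.
have Ed : E d = g by rewrite linearD linearZ /= Eb [E c]Ea scaler0 addr0.
have d2 : 2%:R * d = 2%:R * b + c.
  rewrite /d mulrDr; congr (_ + _).
  by rewrite mulr_natl -scaler_nat scalerA divff // scale1r.
have dk : bihom (k - 1) (k - 1) d by apply: bihomD bk' (bihomZ _ ck).
clearbody d.
exists (h - (Q1 * a + LL * d)); split.
- apply: bihomB hkk _; apply: bihomD.
    by apply: bihom_eq (bihomM bihom_Q1 ak); lia.
  by apply: bihom_eq (bihomM bihom_LL dk); lia.
- by rewrite linearB /= opE_inJ EhE Ed d2 /c scaler_nat -mulr_natl; ring.
- by rewrite subKr; exists a, d.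
Qed.
End Invariants.

(** * Locally rational functions are polynomials *)

Section RegularFunctions.
Variable K : numClosedFieldType.

(** Induction on the size of a denominator. A nonconstant one has a root t0, and comparison with a
    fraction whose denominator is nonzero at t0 shows that the factor 'X - t0 cancels. *)
Lemma regular_poly1 (phi : K -> K) :
  (forall t0, exists f g : {poly K}, g.[t0] != 0 /\ forall t, g.[t] * phi t = f.[t]) ->
  exists r : {poly K}, forall t, phi t = r.[t].
Proof.
move=> loc.
have [s] : exists s, exists f g : {poly K},
    [/\ g != 0, (size g <= s)%N & forall t, g.[t] * phi t = f.[t]].
  have [f [g [g0 gf]]] := loc 0; exists (size g), f, g; split => //.
  by apply: contraNneq g0 => ->; rewrite horner0.
elim: s => [|s IH] [f [g [g0 gs gf]]].
  by move: gs; rewrite leqn0 size_poly_eq0 (negPf g0).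
have [/size_poly1P[c c0 gc]|/closed_rootP[t0 gt0]] := boolP (size g == 1%N).
  exists (c^-1 *: f) => t; rewrite hornerZ -gf gc hornerC mulrA mulVf ?mul1r //.
apply: IH; have [f' [g' [g't0 gf']]] := loc t0.
have fg' : f * g' = f' * g.
  apply/eqP; rewrite -subr_eq0; apply/eqP/(@poly_eq0_inf _ _ 0) => t _.
  by rewrite hornerD hornerN !hornerM -gf -gf'; ring.
have [g1 gE] : exists g1, g = g1 * ('X - t0%:P) by exact/factor_theorem.
have [f1 fE] : exists f1, f = f1 * ('X - t0%:P).
  by apply/factor_theorem; rewrite rootE -gf (rootP gt0) mul0r.
have g10 : g1 != 0 by apply: contraNneq g0 => g10; rewrite gE g10 mul0r.
have fg1 : f1 * g' = f' * g1.
  have X0 : 'X - t0%:P != 0 by rewrite polyXsubC_eq0.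
  by apply: (mulIf X0); rewrite mulrAC -fE fg' gE mulrA.
exists f1, g1; split => // [|t].
  by move: gs; rewrite gE size_Mmonic ?monicXsubC // size_XsubC addn2.
(* At t0 itself the reduced identity does not follow from the old one; the second fraction provides
   it. *)
have [->|tt0] := eqVneq t t0; last first.
  have X0 : t - t0 != 0 by rewrite subr_eq0.
  have := gf t; rewrite gE fE !hornerM hornerXsubC mulrAC => e.
  exact: (mulIf X0).
apply: (mulIf g't0); rewrite -[RHS]hornerM fg1 hornerM -gf'; ring.
Qed.

Lemma lagrange_interpolation (N : nat) (p : {poly K}) : (size p <= N)%N ->
  p = \sum_(i < N) p.[i%:R] *:
        \prod_(j < N | j != i) ((i%:R - j%:R)^-1 *: ('X - j%:R%:P)).
Proof.
move=> pN; pose ell (i : 'I_N) : {poly K} :=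
  \prod_(j < N | j != i) ((i%:R - j%:R)^-1 *: ('X - j%:R%:P)).
have ellE (i j : 'I_N) : (ell i).[j%:R] = (i == j)%:R.
  rewrite horner_prod; case: eqP => [<-|/eqP ij].
    rewrite big1 // => k ki; rewrite hornerZ hornerXsubC mulVf // subr_eq0 eqr_nat.
    by rewrite eq_sym.
  by rewrite (bigD1 j) 1?eq_sym //= hornerZ hornerXsubC subrr mulr0 mul0r.
apply/eqP; rewrite -subr_eq0; apply/negPn/negP => d0.
have ellN i : (size (ell i) <= N)%N.
  apply: leq_trans (size_prod_leq _ _) _.
  have -> : \sum_(j < N | j != i) size ((i%:R - j%:R)^-1 *: ('X - j%:R%:P) : {poly K}) =
            (\sum_(j < N | j != i) 2)%N.
    apply: eq_bigr => j ij; rewrite size_scale ?size_XsubC // invr_eq0 subr_eq0 eqr_nat.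
    by rewrite eq_sym.
  rewrite sum_nat_const (eq_card (B := predC1 i)) // cardC1 card_ord.
  by have := ltn_ord i; lia.
pose s : seq K := [seq i%:R | i <- iota 0 N].
have /(max_poly_roots d0) : all (root (p - \sum_(i < N) p.[i%:R] *: ell i)) s.
  apply/allP => t /mapP[k]; rewrite mem_iota add0n => kN ->.
  rewrite rootE hornerD hornerN horner_sum (bigD1 (Ordinal kN)) //= hornerZ (ellE (Ordinal kN) (Ordinal kN)) eqxx mulr1.
  rewrite big1 ?addr0 ?subrr // => i ik.
  by rewrite hornerZ (ellE i (Ordinal kN)) (negPf ik) mulr0.
rewrite map_inj_uniq ?iota_uniq; last by apply: mulrIn; exact: oner_neq0.
rewrite size_map size_iota => /(_ isT); apply/negP; rewrite -leqNgt.
apply: leq_trans (size_polyD _ _) _; rewrite size_polyN geq_max pN.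
apply: leq_trans (size_sum _ _ _) _; apply/bigmax_leqP => i _.
exact: leq_trans (size_scale_leq _ _) (ellN i).
Qed.

Definition ocons (T : Type) k (t : T) (y : 'I_k -> T) (i : 'I_k.+1) : T :=
  if unlift ord0 i is Some j then y j else t.
Lemma ocons0 (T : Type) k (t : T) (y : 'I_k -> T) : ocons t y ord0 = t.
Proof. by rewrite /ocons unlift_none. Qed.
Lemma oconsS (T : Type) k (t : T) (y : 'I_k -> T) i : ocons t y (lift ord0 i) = y i.
Proof. by rewrite /ocons liftK. Qed.
Lemma ocons_eta (T : Type) k (x : 'I_k.+1 -> T) :
  x = ocons (x ord0) (fun i => x (lift ord0 i)).
Proof.
by apply/funext => i; case: (unliftP ord0 i) => [j|] ->; rewrite ?ocons0 ?oconsS.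
Qed.
Lemma comp_ocons (T U : Type) (u : T -> U) k t (y : 'I_k -> T) i :
  u (ocons t y i) = ocons (u t) (u \o y) i.
Proof. by case: (unliftP ord0 i) => [j|] ->; rewrite ?ocons0 ?oconsS. Qed.

Lemma size_along (k : nat) (c : 'I_k -> {poly K}) (h : {mpoly K[k]}) :
  (forall i, size (c i) <= 2)%N -> (size (along c h) <= msize h)%N.
Proof.
move=> c2; rewrite /along /mmap; apply: leq_trans (size_sum _ _ _) _.
rewrite big_seq; apply/bigmax_leqP_seq => mm mh _; rewrite mul_polyC.
apply: leq_trans (size_scale_leq _ _) _; apply: leq_trans (msize_mdeg_lt mh).
have sM (p q : {poly K}) a b : (size p <= a.+1)%N -> (size q <= b.+1)%N ->
    (size (p * q)%R <= (a + b).+1)%N.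
  by move=> pa qb; apply: leq_trans (size_polyMleq _ _) _; lia.
rewrite mdegE; apply: (big_rec2 (fun (p : {poly K}) a => size p <= a.+1)%N).
  by rewrite size_poly1.
move=> i p a _ pa; apply: (sM) => //.
elim: (mm i) => [|e IH]; first by rewrite expr0 size_poly1.
by rewrite exprS; apply: (sM _ _ 1%N e).
Qed.

Definition uni (N : nat) (i : 'I_N) (p : {poly K}) : {mpoly K[N]} :=
  (map_poly (@mpolyC N K) p).['X_i].
Lemma meval_uni N (i : 'I_N) p v : (uni i p).@[v] = p.[v i].
Proof.
rewrite /uni -horner_map /= -map_poly_comp mevalXU (eq_map_poly (g := idfun)) ?map_poly_id //.
by move=> a /=; rewrite mevalC.
Qed.

(** Induction on the number of variables. The slices of phi at fixed first coordinate are
    polynomials by induction, and its restrictions to lines in the first direction are polynomials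
    by [regular_poly1]. On lines of bounded degree phi is recovered from N slices by interpolation;
    this gives R, and the local fractions extend phi = R from a dense set to all points. *)
Lemma regular_poly k (phi : ('I_k -> K) -> K) :
  (forall x0, exists f g : {mpoly K[k]}, g.@[x0] != 0 /\ forall x, g.@[x] * phi x = f.@[x]) ->
  exists r : {mpoly K[k]}, forall x, phi x = r.@[x].
Proof.
elim: k phi => [|k IH] phi loc.
  exists (phi (fun=> 0))%:MP => x; rewrite mevalC; congr phi.
  by apply/funext => -[].
have slice (t : K) : {r : {mpoly K[k]} | forall y, phi (ocons t y) = r.@[y]}.
  apply/cid; apply: IH => y0; have [f [g [g0 gf]]] := loc (ocons t y0).
  pose th i : {mpoly K[k]} := ocons t%:MP (fun j => 'X_j) i.
  have thE h y : (subst th h).@[y] = h.@[ocons t y].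
    rewrite meval_subst; apply: meval_eq => i; rewrite /th (comp_ocons (meval y)) mevalC.
    by congr ocons; apply/funext => j /=; rewrite mevalXU.
  by exists (subst th f), (subst th g); split => [|y]; rewrite !thE.
pose line (y : 'I_k -> K) i : {poly K} := ocons 'X (fun j => (y j)%:P) i.
have lineE h y t : (along (line y) h).[t] = h.@[ocons t y].
  rewrite horner_along; apply: meval_eq => i; rewrite /line (comp_ocons (horner^~ t)) hornerX.
  by congr ocons; apply/funext => j /=; rewrite hornerC.
(* A single fraction bounds the degree on most lines: if g0 is not zero on the line, g0 p = f0 there
   gives that the size of p is at most N. *)
have [f0 [g0 [g00 gf0]]] := loc (fun=> 0); pose N := msize f0.
pose lift_ (h : {mpoly K[k]}) : {mpoly K[k.+1]} := subst (fun i => 'X_(lift ord0 i)) h.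
have liftE h t y : (lift_ h).@[ocons t y] = h.@[y].
  by rewrite meval_subst; apply: meval_eq => i; rewrite mevalXU oconsS.
pose R : {mpoly K[k.+1]} := \sum_(i < N) lift_ (sval (slice i%:R)) *
   uni ord0 (\prod_(j < N | j != i) ((i%:R - j%:R)^-1 *: ('X - j%:R%:P))).
pose t1 : K := 0; pose y1 : 'I_k -> K := fun=> 0.
have g01 : g0.@[ocons t1 y1] != 0.
  by rewrite [X in meval X](_ : _ = (fun=> 0)) //; apply/esym; rewrite [LHS]ocons_eta.
have phiR y : g0.@[ocons t1 y] != 0 -> forall t, phi (ocons t y) = R.@[ocons t y].
  move=> gy; have [|p pE] := @regular_poly1 (fun t => phi (ocons t y)).
    move=> t0; have [f [g [g_0 gf]]] := loc (ocons t0 y).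
    by exists (along (line y) f), (along (line y) g); split => [|t]; rewrite !lineE.
  have gp : along (line y) g0 * p = along (line y) f0.
    apply/eqP; rewrite -subr_eq0; apply/eqP/(@poly_eq0_inf _ _ 0) => t _.
    by rewrite hornerD hornerN hornerM !lineE -pE gf0 subrr.
  have pN : (size p <= N)%N.
    have [->|p0] := eqVneq p 0; first by rewrite size_poly0.
    have gy0 : along (line y) g0 != 0.
      by apply: contraNneq gy => g_0; rewrite -lineE g_0 horner0.
    have : (size (along (line y) f0) <= N)%N.
      apply: size_along => i; case: (unliftP ord0 i) => [j|] ->; rewrite /line ?ocons0 ?oconsS.
        by apply: leq_trans (size_polyC_leq1 _) _.
      by rewrite size_polyX.
    rewrite -gp size_mul //; move: gy0 p0; rewrite -!size_poly_gt0.
    by move: (size _) (size p); lia.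
  move=> t; rewrite pE {1}(lagrange_interpolation pN) horner_sum raddf_sum.
  apply: eq_bigr => i _ /=; rewrite hornerZ mevalM liftE meval_uni ocons0 -pE.
  by rewrite (svalP (slice i%:R)).
exists R => x; have [f [g [gx gf]]] := loc x.
(* [ga] is g0 with its first variable frozen at t1, so that where it is nonzero phi and R agree on
   the whole line. *)
pose ga := lift_ (subst (fun i => ocons t1%:MP (fun j => 'X_j) i) g0).
have gaE t y : ga.@[ocons t y] = g0.@[ocons t1 y].
  rewrite liftE meval_subst; apply: meval_eq => i; rewrite (comp_ocons (meval y)) mevalC.
  by congr ocons; apply/funext => j /=; rewrite mevalXU.
have : ga * (g * R - f) = 0.
  apply: mpoly_eq0 => z; rewrite (ocons_eta z); move: (z _) (fun _ => _) => t y.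
  rewrite mevalM mevalB mevalM gaE; have [->|gy] := eqVneq (g0.@[ocons t1 y]) 0.
    by rewrite mul0r.
  by rewrite -(phiR _ gy) gf subrr mulr0.
move/eqP; rewrite mulf_eq0 => /orP[/eqP ga0|/eqP/(congr1 (meval x))].
  by have := gaE t1 y1; rewrite ga0 meval0 => /esym/eqP; rewrite (negPf g01).
by rewrite mevalB mevalM meval0 -gf -mulrBr => /eqP; rewrite mulf_eq0 (negPf gx) subr_eq0 => /eqP.
Qed.
End RegularFunctions.

(** * Extension of functions on the incidence variety *)

Section BiprojEval.
Variables (K : numFieldType) (n : nat).

Lemma coef_poly_scale (I : eqType) (r : seq I) (c : I -> K) (d : I -> nat) (k : nat) (e : K) :
  (forall s, s != 0 -> \sum_(i <- r) c i * s ^+ d i = e * s ^+ k) ->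
  \sum_(i <- r | d i == k) c i = e.
Proof.
move=> H; pose p : {poly K} := \sum_(i <- r) c i *: 'X^(d i) - e *: 'X^k.
have p0 : p = 0.
  apply: (@poly_eq0_inf _ _ 0) => s s0.
  rewrite hornerD hornerN horner_sum hornerZ hornerXn -H //.
  by apply/eqP; rewrite subr_eq0; apply/eqP/eq_bigr => i _; rewrite hornerZ hornerXn.
have /eqP := congr1 (fun q : {poly K} => q`_k) p0.
rewrite coef0 coefB coef_sum coefZ coefXn eqxx mulr1 subr_eq0 => /eqP <-.
rewrite big_mkcond; apply: eq_bigr => i _; rewrite coefZ coefXn eq_sym.
by case: eqP; rewrite ?mulr1 ?mulr0.
Qed.

(** Comparison of the coefficients of s ^ k t ^ l. It lets a polynomial that represents a function
    of bidegree (k, l) be replaced by its component of that bidegree. *)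
Lemma biproj_eval (k l : nat) (h : {mpoly K[n + n]}) (a b : 'I_n -> K) e :
  (forall s t, s != 0 -> t != 0 ->
     h.@[vf (fun i => s * a i) (fun i => t * b i)] = s ^+ k * t ^+ l * e) ->
  (biproj k l h).@[vf a b] = e.
Proof.
move=> H; pose w (mm : 'X_{1..n + n}) : K := h@_mm * ('X_[mm] : {mpoly K[n + n]}).@[vf a b].
have hE s t : h.@[vf (fun i => s * a i) (fun i => t * b i)] =
    \sum_(mm <- msupp h) w mm * s ^+ mdegx mm * t ^+ mdegy mm.
  rewrite {1}[h]mpolyE raddf_sum; apply: eq_bigr => mm _ /=.
  by rewrite mevalZ (eval_scale _ _ _ _ (bihom_monom K mm)) /w; ring.
have : \sum_(mm <- [seq mm <- msupp h | mdegx mm == k] | mdegy mm == l) w mm = e.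
  apply: coef_poly_scale => t t0; rewrite big_filter.
  have := @coef_poly_scale _ (msupp h) (fun mm => w mm * t ^+ mdegy mm) (@mdegx n) k (e * t ^+ l).
  apply=> s s0; rewrite -mulrA [RHS](_ : _ = s ^+ k * t ^+ l * e); last by ring.
  by rewrite -H // hE; apply: eq_bigr => mm _; rewrite mulrAC.
move=> <-; rewrite big_filter_cond raddf_sum; apply: eq_bigr => mm _ /=.
by rewrite mevalZ.
Qed.
End BiprojEval.

Section Extension.
Variables (K : numClosedFieldType) (m : nat).
Hypothesis m_gt0 : (0 < m)%N.
Local Notation n := m.+2.
Local Notation P := {mpoly K[n + n]}.
Local Notation E := (@opE K n).
Local Notation x := (@xv K n).
Local Notation y := (@yv K n).

Definition incident (a b : 'I_n -> K) :=
  [/\ exists i, a i != 0, qform a = 0 & bform a b = 0].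

Lemma splitl (i : 'I_(n + n)) : (exists j, i = lshift n j) \/ (exists j, i = rshift n j).
Proof.
by case: (splitP i) => j ij; [left | right]; exists j; apply: val_inj.
Qed.

(** With [cell1], the normal form of an incident pair with x_0 <> 0: scaling achieves x_0 = 1, a
    shift of the second vector by the first achieves y_0 = 0, and the entries at [i1] are forced by
    the two equations. The parameters (u, v) range over an affine space. *)
Definition cell0 (R : comNzRingType) (u : 'I_m -> R) : 'I_n -> R :=
  ocons 1 (ocons (- \sum_i u i ^+ 2) u).
Definition cell1 (R : comNzRingType) (u v : 'I_m -> R) : 'I_n -> R :=
  ocons 0 (ocons (- (2%:R * \sum_i u i * v i)) v).

Lemma iuE (T : Type) (t t' : T) (u : 'I_m -> T) i : ocons t (ocons t' u) (iu i) = u i.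
Proof. by rewrite !oconsS. Qed.
Lemma i0E (T : Type) (t t' : T) (u : 'I_m -> T) : ocons t (ocons t' u) i0 = t.
Proof. exact: ocons0. Qed.
Lemma i1E (T : Type) (t t' : T) (u : 'I_m -> T) : ocons t (ocons t' u) i1 = t'.
Proof. by rewrite oconsS ocons0. Qed.

Lemma bform_shift (R : comNzRingType) (c : R) (a b : 'I_n -> R) :
  bform a (fun i => b i + c * a i) = bform a b + 2%:R * c * qform a.
Proof.
rewrite /bform /qform.
have -> : \sum_i a (iu i) * (b (iu i) + c * a (iu i)) =
    \sum_i a (iu i) * b (iu i) + c * \sum_i a (iu i) ^+ 2 :> R.
  by rewrite big_distrr -big_split; apply: eq_bigr => i _ /=; ring.
ring.
Qed.

Lemma incident_shift c a b : incident a b -> incident a (fun i => b i + c * a i).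
Proof. by move=> [a0 qa ab]; split=> //; rewrite bform_shift qa ab; ring. Qed.

Lemma cell_incident (u v : 'I_m -> K) : incident (cell0 u) (cell1 u v).
Proof.
rewrite /cell0 /cell1; split; first by exists i0; rewrite i0E oner_neq0.
  rewrite /qform i0E i1E [X in _ + X](eq_bigr (fun i => u i ^+ 2)) => [|i _]; last by rewrite iuE.
  by rewrite mul1r addNr.
rewrite /bform !i0E !i1E [X in _ + _ * X](eq_bigr (fun i => u i * v i)) => [|i _]; last by rewrite !iuE.
by rewrite mul1r mulr0 addr0 addNr.
Qed.

Section Function.
Variables (p : nat) (phi : ('I_n -> K) -> ('I_n -> K) -> K).
Hypothesis phi_scale : forall s t a b, s != 0 -> t != 0 -> incident a b ->
  phi (fun i => s * a i) (fun i => t * b i) = s ^+ p * t ^+ p * phi a b.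
Hypothesis phi_shift : forall c a b, incident a b -> phi a (fun i => b i + c * a i) = phi a b.
Hypothesis phi_local : forall a0 b0, incident a0 b0 -> exists (k : nat) (g f : P),
  [/\ bihom k 0 g, bihom (k + p)%N p f, g.@[vf a0 b0] != 0
    & forall a b, incident a b -> g.@[vf a b] * phi a b = f.@[vf a b]].

(** The first vector is divided by x_0 and the second multiplied by it, so that the scaling factors
    cancel in bidegree (p, p). *)
Lemma phi_cell a b : incident a b -> a i0 != 0 -> phi a b =
  phi (cell0 (fun i => a (iu i) / a i0))
      (cell1 (fun i => a (iu i) / a i0) (fun i => a i0 * b (iu i) - b i0 * a (iu i))).
Proof.
move=> [_ qa ab] a0; set u := fun i => _ / _; set v := fun i => _ - _.
pose S := \sum_i a (iu i) * b (iu i); pose T := \sum_i a (iu i) ^+ 2.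
have uu : \sum_i u i ^+ 2 = T / a i0 ^+ 2.
  by rewrite big_distrl; apply: eq_bigr => i _; rewrite /u expr_div_n.
have uv : \sum_i u i * v i = S - b i0 / a i0 * T.
  rewrite big_distrr -sumrB; apply: eq_bigr => i _; rewrite /u /v /=; field.
  exact: a0.
have TE : T = - (a i0 * a i1) by apply/eqP; rewrite -addr_eq0 addrC -qa.
have SE : 2%:R * S = - (a i0 * b i1 + a i1 * b i0).
  by apply/eqP; rewrite -addr_eq0 addrC -ab.
have aE : a = fun i => a i0 * cell0 u i.
  apply/funext; apply: i01P; rewrite /cell0.
  - by rewrite i0E mulr1.
  - by rewrite i1E uu TE; field.
  - by move=> i; rewrite iuE /u mulrC divfK.
have bE : b = fun i => (a i0)^-1 * (cell1 u v i + b i0 * a i0 * cell0 u i).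
  apply/funext; apply: i01P; rewrite /cell0 /cell1.
  - by rewrite !i0E add0r mulr1 mulrC mulfK.
  - rewrite !i1E uu uv mulrBr SE TE; field.
    exact: a0.
  - by move=> i; rewrite !iuE /u /v; field.
rewrite {1}aE {1}bE phi_scale ?invr_eq0 //; last exact/incident_shift/cell_incident.
by rewrite -exprMn divff // expr1n mul1r phi_shift //; exact: cell_incident.
Qed.

Lemma subst_vf (N : nat) (th : 'I_(n + n) -> {mpoly K[N]}) (a b : 'I_n -> K) v h :
  (forall i, (th (lshift n i)).@[v] = a i) -> (forall i, (th (rshift n i)).@[v] = b i) ->
  (subst th h).@[v] = h.@[vf a b].
Proof.
move=> ta tb; rewrite meval_subst; apply: meval_eq => i.
by case: (splitl i) => -[j ->]; rewrite ?vf_l ?vf_r ?ta ?tb.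
Qed.

Lemma phi_chart : exists r : {mpoly K[m + m]}, forall u v,
  phi (cell0 u) (cell1 u v) = r.@[vf u v].
Proof.
pose X i : {mpoly K[m + m]} := 'X_(lshift m i); pose Y i : {mpoly K[m + m]} := 'X_(rshift m i).
have cX (z : 'I_(m + m) -> K) i : (cell0 X i).@[z] = cell0 (fun i => z (lshift m i)) i.
  rewrite /cell0; elim/i01P: i => [||i]; rewrite ?i0E ?i1E ?iuE ?meval1 ?mevalXU //.
  rewrite mevalN; congr (- _); rewrite raddf_sum; apply: eq_bigr => i _ /=.
  by rewrite rmorphXn /= mevalXU.
have cY (z : 'I_(m + m) -> K) i : (cell1 X Y i).@[z] =
    cell1 (fun i => z (lshift m i)) (fun i => z (rshift m i)) i.
  rewrite /cell1; elim/i01P: i => [||i]; rewrite ?i0E ?i1E ?iuE ?meval0 ?mevalXU //.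
  rewrite mevalN mevalM rmorph_nat; congr (- (_ * _)); rewrite raddf_sum; apply: eq_bigr => i _ /=.
  by rewrite mevalM !mevalXU.
have [|r rE] := @regular_poly K _ (fun z => phi (cell0 (fun i => z (lshift m i)))
   (cell1 (fun i => z (lshift m i)) (fun i => z (rshift m i)))).
  move=> z0; have [k [g [f [_ _ g0 gf]]]] :=
    phi_local (cell_incident (fun i => z0 (lshift m i)) (fun i => z0 (rshift m i))).
  exists (subst (vf (cell0 X) (cell1 X Y)) f), (subst (vf (cell0 X) (cell1 X Y)) g).
  have sE h z : (subst (vf (cell0 X) (cell1 X Y)) h).@[z] =
      h.@[vf (cell0 (fun i => z (lshift m i)))
             (cell1 (fun i => z (lshift m i)) (fun i => z (rshift m i)))].
    by apply: subst_vf => i; rewrite ?vf_l ?vf_r.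
  split=> [|z]; rewrite !sE // gf //; exact: cell_incident.
exists r => u v; rewrite -rE; congr (phi (cell0 _) (cell1 _ _)); apply/funext => i;
  by rewrite ?vf_l ?vf_r.
Qed.

Lemma phi_x0 : exists (N : nat) (h : P), bihom (p + N)%N p h /\
  forall a b, incident a b -> a i0 ^+ N * phi a b = h.@[vf a b].
Proof.
have [r rE] := phi_chart.
have [N [h hE]] : exists N (h : P), forall a b, a i0 != 0 -> a i0 ^+ N *
    r.@[vf (fun i => a (iu i) / a i0) (fun i => a i0 * b (iu i) - b i0 * a (iu i))] =
    h.@[vf a b].
  elim/mpoly_ind: (r) => [c|i|f g [N [h hE]] [N' [h' hE']]|f g [N [h hE]] [N' [h' hE']]].
  - by exists 0%N, c%:MP => a b _; rewrite !mevalC mul1r.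
  - case: (splitP i) => j ij.
      have -> : i = lshift m j by exact: val_inj.
      by exists 1%N, (x (iu j)) => a b a0; rewrite !mevalXU !vf_l; field.
    have -> : i = rshift m j by exact: val_inj.
    exists 0%N, (x i0 * y (iu j) - y i0 * x (iu j)) => a b a0.
    by rewrite mevalB !mevalM !mevalXU !vf_l !vf_r mul1r.
  - exists (N + N')%N, (x i0 ^+ N' * h + x i0 ^+ N * h') => a b a0.
    by rewrite !mevalD !mevalM !rmorphXn /= mevalXU vf_l -hE // -hE' // exprD; ring.
  - exists (N + N')%N, (h * h') => a b a0.
    by rewrite !mevalM -hE // -hE' // exprD; ring.
(* The additional factor x_0 makes both sides vanish where x_0 = 0, as [hE] is known only
   elsewhere. *)
exists N.+1, (biproj (p + N.+1)%N p (x i0 * h)); split; first exact: bihom_biproj.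
move=> a b ab; apply/esym/biproj_eval => s t s0 t0; rewrite mevalM mevalXU vf_l.
have [a0|a0] := eqVneq (a i0) 0; first by rewrite a0 mulr0 !mul0r expr0n mul0r mulr0.
have ab' : incident (fun i => s * a i) (fun i => t * b i).
  case: ab => [[i ai] qa bab]; split; first by exists i; rewrite mulf_neq0.
    have -> : qform (fun i => s * a i) = s ^+ 2 * qform a.
      rewrite /qform mulrDr big_distrr; congr (_ + _); first by ring.
      by apply: eq_bigr => j _; rewrite exprMn.
    by rewrite qa mulr0.
  have -> : bform (fun i => s * a i) (fun i => t * b i) = s * t * bform a b.
    rewrite /bform (eq_bigr (fun i => s * t * (a (iu i) * b (iu i)))) => [|j _]; last by ring.
    by rewrite -big_distrr /=; ring.
  by rewrite bab mulr0.
have sa0 : s * a i0 != 0 by rewrite mulf_neq0.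
have := hE (fun i => s * a i) (fun i => t * b i) sa0.
rewrite -rE -(phi_cell ab' sa0) phi_scale // => <-.
by rewrite exprMn exprD !exprS; ring.
Qed.
End Function.

(** The symmetry of [qform] and [bform] that carries the chart x_0 <> 0 to the chart x_1 <> 0. *)
Definition swap01 : 'I_n -> 'I_n := ocons i1 (ocons i0 (@iu m)).
Lemma swap01K : involutive swap01.
Proof. by apply: i01P; rewrite /swap01 ?i0E ?i1E ?i0E // => i; rewrite !iuE. Qed.
Lemma qform_swap (R : comNzRingType) (a : 'I_n -> R) : qform (a \o swap01) = qform a.
Proof.
rewrite /qform /= /swap01 i0E i1E mulrC; congr (_ + _).
by apply: eq_bigr => i _; rewrite iuE.
Qed.
Lemma bform_swap (R : comNzRingType) (a b : 'I_n -> R) :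
  bform (a \o swap01) (b \o swap01) = bform a b.
Proof.
rewrite /bform /= /swap01 !i0E !i1E addrC [in RHS]addrC; congr (_ * _ + _); last exact: addrC.
by apply: eq_bigr => i _; rewrite !iuE.
Qed.
Lemma incident_swap a b : incident a b -> incident (a \o swap01) (b \o swap01).
Proof.
move=> [[i ai] qa ab]; split; rewrite ?qform_swap ?bform_swap //.
by exists (swap01 i); rewrite /= swap01K.
Qed.
Lemma comp_swapK (T : Type) (a : 'I_n -> T) : (a \o swap01) \o swap01 = a.
Proof. by apply/funext => i /=; rewrite swap01K. Qed.

Section Function.
Variables (p : nat) (phi : ('I_n -> K) -> ('I_n -> K) -> K).
Hypothesis phi_scale : forall s t a b, s != 0 -> t != 0 -> incident a b ->
  phi (fun i => s * a i) (fun i => t * b i) = s ^+ p * t ^+ p * phi a b.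
Hypothesis phi_shift : forall c a b, incident a b -> phi a (fun i => b i + c * a i) = phi a b.
Hypothesis phi_local : forall a0 b0, incident a0 b0 -> exists (k : nat) (g f : P),
  [/\ bihom k 0 g, bihom (k + p)%N p f, g.@[vf a0 b0] != 0
    & forall a b, incident a b -> g.@[vf a b] * phi a b = f.@[vf a b]].

Lemma phi_x1 : exists (N : nat) (h : P), bihom (p + N)%N p h /\
  forall a b, incident a b -> a i1 ^+ N * phi a b = h.@[vf a b].
Proof.
pose sw h : P := subst (vf (fun i => x (swap01 i)) (fun i => y (swap01 i))) h.
have swE h a b : (sw h).@[vf a b] = h.@[vf (a \o swap01) (b \o swap01)].
  by apply: subst_vf => i; rewrite ?vf_l ?vf_r mevalXU ?vf_l ?vf_r.
have swh k l h : bihom k l h -> bihom k l (sw h).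
  by apply: bihom_subst => i; rewrite ?vf_l ?vf_r; [exact: bihom_xv|exact: bihom_yv].
have [|||N [h [hh hE]]] := @phi_x0 p (fun a b => phi (a \o swap01) (b \o swap01)).
- by move=> s t a b s0 t0 /incident_swap ab; exact: (phi_scale s0 t0 ab).
- by move=> c a b /incident_swap ab; exact: (phi_shift c ab).
- move=> a0 b0 /incident_swap/phi_local[k [g [f [gk fk g0 gf]]]].
  exists k, (sw g), (sw f); split; [exact: swh|exact: swh|by rewrite swE|].
  by move=> a b /incident_swap ab; rewrite !swE gf.
exists N, (sw h); split; first exact: swh.
move=> a b ab; rewrite swE -hE; last exact: incident_swap.
by rewrite !comp_swapK /= /swap01 i0E.
Qed.

Lemma extension : exists h : P, [/\ bihom p p h, E h = 0 &
  forall a b, incident a b -> phi a b = h.@[vf a b]].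
Proof.
have [N [h0 [h0k h0E]]] := phi_x0 phi_scale phi_shift phi_local.
have [M [h1 [h1k h1E]]] := phi_x1.
have inc (a b : 'I_n -> K) : a i0 != 0 -> qform a = 0 -> bform a b = 0 -> incident a b.
  by move=> a0 qa ab; split=> //; exists i0.
(* On the chart x_0 <> 0 both x_1 ^ M h0 and x_0 ^ N h1 are x_0 ^ N x_1 ^ M phi, so their difference
   lies in J. *)
have [||z zk zJ] := @clear_x0 K m m_gt0 M N (p + N)%N p h0 h1 h0k.
- by case: (p) => [|p']; [rewrite orbT | apply/orP; left; lia].
- apply: (@inJ_vanish K m m_gt0 (p + N + M) p).
    apply: bihomB.
      by apply: bihom_eq (bihomM (bihomX M (bihom_xv i1)) h0k); rewrite ?natz ?mul0rn; lia.
    by apply: bihom_eq (bihomM (bihomX N (bihom_xv i0)) h1k); rewrite ?natz ?mul0rn; lia.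
  move=> a b a0 qa ab; have abI := inc _ _ a0 qa ab.
  by rewrite mevalB !mevalM !rmorphXn /= !mevalXU !vf_l -h0E // -h1E //; ring.
have {}zk : bihom p p z by apply: bihom_eq zk => //; lia.
have zE0 a b : incident a b -> a i0 != 0 -> phi a b = z.@[vf a b].
  move=> abI a0; have [_ qa ab] := abI; have := inJ_eval zJ qa ab.
  rewrite mevalB mevalM rmorphXn /= mevalXU vf_l -h0E // -mulrBr => /eqP.
  by rewrite mulf_eq0 expf_eq0 (negPf a0) andbF /= subr_eq0 => /eqP.
(* At points with x_0 = 0 a local fraction f / g of phi is used: g z - f vanishes on the chart,
   hence lies in J and vanishes on all incident pairs. *)
have zE a b : incident a b -> phi a b = z.@[vf a b].
  move=> abI; have [_ qa ab] := abI.
  have [k [g [f [gk fk g0 gf]]]] := phi_local abI.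
  have J : inJ (g * z - f).
    apply: (@inJ_vanish K m m_gt0 (k + p) p).
      by apply: bihomB fk; apply: bihom_eq (bihomM gk zk); lia.
    move=> a' b' a'0 qa' ab'; have abI' := inc _ _ a'0 qa' ab'.
    by rewrite mevalB mevalM -zE0 // gf // subrr.
  have := inJ_eval J qa ab; rewrite mevalB mevalM -gf // -mulrBr => /eqP.
  by rewrite mulf_eq0 (negPf g0) subr_eq0 eq_sym => /eqP.
(* The value of E z at (a, b) is the derivative of z along b + t a at t = 0, and phi is constant on
   that line. For p = 0 the y-degree of E z is negative. *)
have EzJ : inJ (E z).
  case: (posnP p) => [p0|p0].
    rewrite (bihom_neg (bihom_opE zk)); first exact: inJ0.
    by rewrite p0 orbT.
  apply: (@inJ_vanish K m m_gt0 p.+1 p.-1).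
    by apply: bihom_eq (bihom_opE zk); lia.
  move=> a b a0 qa ab; have abI := inc _ _ a0 qa ab.
  pose c : 'I_(n + n) -> {poly K} :=
    vf (fun i => (a i)%:P) (fun i => (b i)%:P + (a i) *: 'X).
  have cE t i : (c i).[t] = vf a (fun i => b i + t * a i) i.
    by case: (splitl i) => -[j ->]; rewrite /c ?vf_l ?vf_r !hornerE // mulrC.
  have along_c : along c z = (phi a b)%:P.
    apply/eqP; rewrite -subr_eq0; apply/eqP/(@poly_eq0_inf _ _ 0) => t _.
    rewrite hornerD hornerN hornerC horner_along (meval_eq _ (cE t)) -zE.
      by rewrite phi_shift // subrr.
    exact: incident_shift.
  have := deriv_along_at c z 0; rewrite along_c derivC horner0 big_split_ord /=.
  rewrite [X in X + _]big1 ?add0r => [|i _]; last by rewrite /c vf_l derivC horner0 mulr0.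
  rewrite opEE raddf_sum => e; rewrite [RHS]e; apply: eq_bigr => i _ /=.
  rewrite mevalM mevalXU vf_l mulrC /c vf_r derivD derivC derivZ derivX add0r.
  rewrite hornerZ hornerC mulr1; congr (_ * _); apply: meval_eq => j.
  by rewrite cE; case: (splitl j) => -[j' ->]; rewrite ?vf_l ?vf_r // mul0r addr0.
have [h [hk Eh zh]] := invariant_lift m_gt0 zk EzJ.
exists h; split => // a b abI; have [_ qa ab] := abI.
have := inJ_eval zh qa ab; rewrite mevalB -zE // => /eqP.
by rewrite subr_eq0 => /eqP.
Qed.
End Function.
End Extension.

(** * Adapted bases *)

Section Frames.
Variables (K : numClosedFieldType) (V : vectType K) (q : V -> K).
Hypotheses (quad_q : quadratic_form q) (nondeg_q : nondegenerate_quad q).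
Implicit Types (u v w z : V).
Local Notation B := (polar q).

Let n2 : 2%:R != 0 :> K. Proof. by rewrite pnatr_eq0. Qed.

Lemma polarC v w : B v w = B w v.
Proof. by rewrite /polar (addrC v) addrAC. Qed.
Lemma polar_vv v : B v v = q v. Proof. exact: polar_id. Qed.

Definition polarl w v : K^o := B v w.
Fact polarl_is_linear w : linear (polarl w).
Proof. by move=> a u v; exact: quad_q.2. Qed.
HB.instance Definition _ w := GRing.isLinear.Build K V K^o _ (polarl w) (polarl_is_linear w).

Lemma polarDl u v w : B (u + v) w = B u w + B v w. Proof. exact: (linearD (polarl w)). Qed.
Lemma polarBl u v w : B (u - v) w = B u w - B v w. Proof. exact: (linearB (polarl w)). Qed.
Lemma polarZl a v w : B (a *: v) w = a * B v w. Proof. exact: (linearZ_LR (polarl w)). Qed.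
Lemma polar0l w : B 0 w = 0. Proof. exact: (linear0 (polarl w)). Qed.
Lemma polar_suml (I : Type) (r : seq I) (Q : pred I) (f : I -> V) w :
  B (\sum_(i <- r | Q i) f i) w = \sum_(i <- r | Q i) B (f i) w.
Proof. exact: (linear_sum (polarl w)). Qed.
Lemma polarDr u v w : B w (u + v) = B w u + B w v.
Proof. by rewrite !(polarC w) polarDl. Qed.
Lemma polarBr u v w : B w (u - v) = B w u - B w v.
Proof. by rewrite !(polarC w) polarBl. Qed.
Lemma polarZr a v w : B w (a *: v) = a * B w v.
Proof. by rewrite !(polarC w) polarZl. Qed.
Lemma polar0r w : B w 0 = 0. Proof. by rewrite polarC polar0l. Qed.
Lemma polar_sumr (I : Type) (r : seq I) (Q : pred I) (f : I -> V) w :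
  B w (\sum_(i <- r | Q i) f i) = \sum_(i <- r | Q i) B w (f i).
Proof. by rewrite polarC polar_suml; apply: eq_bigr => i _; exact: polarC. Qed.

Lemma quadZ a v : q (a *: v) = a ^+ 2 * q v. Proof. exact: quad_q.1. Qed.
Lemma quadD u v : q (u + v) = q u + q v + 2%:R * B u v.
Proof. by rewrite /polar mulrC divfK //; ring. Qed.

(* Coordinate functions dual to a family e whose Gram matrix is that of the standard
   form [qform]. *)
Definition co k (e : 'I_k.+2 -> V) (i : 'I_k.+2) v : K :=
  ocons (2%:R * B v (e i1)) (ocons (2%:R * B v (e i0)) (fun j => B v (e (iu j)))) i.
Definition gram k (e : 'I_k.+2 -> V) := forall i j, co e i (e j) = (i == j)%:R.
Definition span_pt k (e : 'I_k.+2 -> V) (a : 'I_k.+2 -> K) : V := \sum_i a i *: e i.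

Lemma co0 k (e : 'I_k.+2 -> V) v : co e i0 v = 2%:R * B v (e i1). Proof. by rewrite /co i0E. Qed.
Lemma co1 k (e : 'I_k.+2 -> V) v : co e i1 v = 2%:R * B v (e i0). Proof. by rewrite /co i1E. Qed.
Lemma cou k (e : 'I_k.+2 -> V) j v : co e (iu j) v = B v (e (iu j)). Proof. by rewrite /co iuE. Qed.

Section Family.
Variables (k : nat) (e : 'I_k.+2 -> V).

Definition col i v : K^o := co e i v.
Fact col_is_linear i : linear (col i).
Proof.
move=> a u v; rewrite /col; elim/i01P: i => [||i]; rewrite ?co0 ?co1 ?cou polarDl polarZl //.
  by rewrite mulrDr mulrCA.
by rewrite mulrDr mulrCA.
Qed.
HB.instance Definition _ i := GRing.isLinear.Build K V K^o _ (col i) (col_is_linear i).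

Lemma coB i u v : co e i (u - v) = co e i u - co e i v. Proof. exact: (linearB (col i)). Qed.
Lemma coD i u v : co e i (u + v) = co e i u + co e i v. Proof. exact: (linearD (col i)). Qed.
Lemma coZ i a v : co e i (a *: v) = a * co e i v. Proof. exact: (linearZ_LR (col i)). Qed.

Lemma polar_co_eq0 v : (forall i, co e i v = 0) -> forall i, B v (e i) = 0.
Proof.
move=> v0; apply: i01P.
- by have /eqP := v0 i1; rewrite co1 mulf_eq0 (negPf n2) => /eqP.
- by have /eqP := v0 i0; rewrite co0 mulf_eq0 (negPf n2) => /eqP.
- by move=> i; rewrite -cou.
Qed.

Hypothesis Ge : gram e.

Lemma co_pt a i : co e i (span_pt e a) = a i.
Proof.
rewrite /span_pt -[LHS]/(col i _) linear_sum (bigD1 i) //= big1 => [|j ji].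
  by rewrite /col coZ Ge eqxx addr0 mulr1.
by rewrite /col coZ Ge eq_sym (negPf ji) mulr0.
Qed.

Lemma polar_pt a b : 2%:R * B (span_pt e a) (span_pt e b) = bform a b.
Proof.
rewrite {2}/span_pt polar_sumr !big_ord_recl /= !polarZr -/i0 -/i1 !mulrDr.
rewrite [2%:R * (b i0 * _)]mulrCA -co1 [2%:R * (b i1 * _)]mulrCA -co0 !co_pt /bform.
rewrite (eq_bigr (fun i => a (iu i) * b (iu i))) => [|i _]; last first.
  by rewrite polarZr -/(iu i) -cou co_pt mulrC.
ring.
Qed.

Lemma quad_pt a : q (span_pt e a) = qform a.
Proof.
apply: (mulfI n2); rewrite -polar_vv polar_pt /bform /qform.
by rewrite (eq_bigr (fun i => a (iu i) ^+ 2)) => [|i _]; [ring | rewrite expr2].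
Qed.

Lemma gram_dim : (k.+2 <= \dim {:V})%N.
Proof.
have fr : free [tuple e i | i < k.+2].
  apply/freeP => a a0 i; have := co_pt a i; rewrite [span_pt e a](_ : _ = 0) => [<-|].
    exact: (linear0 (col i)).
  by rewrite -a0; apply: eq_bigr => j _; rewrite -tnth_nth tnth_mktuple.
have := dimvS (subvf <<[tuple e i | i < k.+2]>>).
by rewrite (eqP fr) size_tuple.
Qed.

(** Gram-Schmidt, with care for isotropic vectors: a vector z orthogonal to the family with q z <> 0
    is found and then normalized by a square root. Nondegeneracy supplies a y that pairs
    nontrivially with the orthogonal part of v. *)
Lemma gram_extend v : v != span_pt e (fun i => co e i v) ->
  exists e' : 'I_k.+3 -> V, [/\ gram e', e' i0 = e i0 & e' i1 = e i1].
Proof.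
rewrite -subr_eq0; pose pr u := u - span_pt e (fun i => co e i u).
have coPr u i : co e i (pr u) = 0 by rewrite coB co_pt subrr.
rewrite -/(pr v) => z0.
have [z coz qz] : exists2 z, forall i, co e i z = 0 & q z != 0.
  have [qz|qz] := eqVneq (q (pr v)) 0; last by exists (pr v).
  have [y By] : exists y, B (pr v) y != 0.
    apply: contrapT => no; case/eqP: z0; apply: nondeg_q => y; apply: contrapT => By.
    by apply: no; exists y; apply/eqP.
  have Bpy : B (pr v) (pr y) = B (pr v) y.
    rewrite polarBr polar_sumr big1 ?subr0 // => i _.
    by rewrite polarZr polar_co_eq0 ?mulr0.
  have [qy|qy] := eqVneq (q (pr y)) 0; last by exists (pr y).
  (* Both orthogonal parts are isotropic here, so q of the sum is twice their pairing, which is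
     nonzero. *)
  exists (pr v + pr y) => [i|]; first by rewrite coD !coPr addr0.
  by rewrite quadD qz qy !add0r Bpy mulf_neq0.
pose u := (sqrtC (q z))^-1 *: z.
have qu : q u = 1 by rewrite quadZ exprVn sqrtCK mulVf.
have Bu i : B u (e i) = 0 by rewrite polarZl polar_co_eq0 ?mulr0.
pose e' := ocons (e i0) (ocons (e i1) (ocons u (fun i => e (iu i)))).
have e0 : e' i0 = e i0 by rewrite /e' i0E.
have e1 : e' i1 = e i1 by rewrite /e' i1E.
have eu : e' (iu ord0) = u by rewrite /e' iuE ocons0.
have ev i : e' (iu (lift ord0 i)) = e (iu i) by rewrite /e' iuE oconsS.
exists e'; split => //.
have Bu' i : B (e i) u = 0 by rewrite polarC.
have eE i : (i = ord0 /\ e' (iu i) = u) \/ exists2 j, i = lift ord0 j & e' (iu i) = e (iu j).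
  by case: (unliftP ord0 i) => [j|] ->; [right; exists j | left].
have Gu i j : B (e (iu i)) (e (iu j)) = (i == j)%:R by rewrite -cou Ge iuu eq_sym.
apply: i01P => [||i]; [| |case: (eE i) => [[-> iE']|[i' -> iE']]];
  apply: i01P => [||j]; try case: (eE j) => [[-> jE']|[j' -> jE']];
  rewrite ?co0 ?co1 ?cou ?e0 ?e1 ?eu ?ev ?Bu ?Bu' ?mulr0 ?iE ?(inj_eq lift_inj) ?polar_vv ?qu
   ?Gu -?co0 -?co1 ?Ge ?iE //.
- by rewrite -polar_vv -co0 Ge iE.
- by rewrite -polar_vv -co1 Ge iE.
- by rewrite -cou Ge iE.
- by rewrite -cou Ge iE.
- by rewrite eq_sym.
Qed.
End Family.

Definition frame k (e : 'I_k.+2 -> V) := gram e /\ forall v, v = span_pt e (fun i => co e i v).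

(** A hyperbolic pair containing v0 is enlarged by [gram_extend] until it spans V. *)
Lemma frame_exists v0 : v0 != 0 -> q v0 = 0 ->
  exists k, exists e : 'I_k.+2 -> V, frame e /\ e i0 = v0.
Proof.
move=> v0n qv0.
have [w [qw Bw]] : exists w, q w = 0 /\ 2%:R * B v0 w = 1.
  have [y By] : exists y, B v0 y != 0.
    apply: contrapT => no; case/eqP: v0n; apply: nondeg_q => y; apply: contrapT => By.
    by apply: no; exists y; apply/eqP.
  (* The coefficient comes from q (y - c v0) = q y - 2 c B(v0, y), as v0 is isotropic; the pairing
     with v0 is not affected. *)
  pose y1 := y - (q y / (2%:R * B v0 y)) *: v0.
  have By1 : B v0 y1 = B v0 y by rewrite polarBr polarZr polar_vv qv0 mulr0 subr0.
  have qy1 : q y1 = 0.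
    rewrite /y1 -scaleNr quadD quadZ qv0 polarZr (polarC y) mulr0 addr0; field.
    exact: By.
  exists ((2%:R * B v0 y)^-1 *: y1); rewrite quadZ qy1 mulr0 polarZr By1; split=> //.
  by field; exact: By.
pose e : 'I_2 -> V := ocons v0 (ocons w (fun=> 0)).
have Ge : gram (k := 0) e.
  apply: i01P => [||[]//]; apply: i01P => [||[]//];
    rewrite ?co0 ?co1 /e ?i0E ?i1E ?polar_vv ?qv0 ?qw ?Bw ?(polarC w) ?mulr0 ?iE ?Bw //.
have e0 : e i0 = v0 by rewrite /e i0E.
(* The number d of extensions still possible bounds the recursion; it cannot run out, by
   [gram_dim]. *)
have : (\dim {:V} < 2 + \dim {:V})%N by rewrite addSn ltnS leq_addl.
move: {-1}(\dim _) => d; move: {v0n qv0 w qw Bw} 0%N e Ge e0.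
elim: d => [|d IH] k e Ge e0 dk.
  by have := leq_ltn_trans (gram_dim Ge) dk; rewrite addn0 ltnn.
have [all|] := pselect (forall v, v = span_pt e (fun i => co e i v)); first by exists k, e.
move=> /existsNP[v /eqP/(gram_extend Ge)[e' [Ge' e'0 _]]].
by apply: (IH k.+1 e') => //; [rewrite e'0 | rewrite addSnnS].
Qed.
End Frames.

(** * Tangent spaces and vector fields *)

Lemma meval_homog (K : comNzRingType) N d (f : {mpoly K[N]}) (t : K) (a : 'I_N -> K) :
  f \is d.-homog -> f.@[fun i => t * a i] = t ^+ d * f.@[a].
Proof.
move=> /dhomogP fd; rewrite !mevalE big_distrr /= big_seq [RHS]big_seq.
apply: eq_bigr => m /fd <-; under eq_bigr do rewrite exprMn.
by rewrite big_split /= prodrXr mdegE mulrCA.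
Qed.

Section DirectionalDerivative.
Variables (K : numFieldType) (V : vectType K).
Local Notation N := (\dim {:V}).
Local Notation form := {mpoly K[N]}.
Implicit Types (f g : form) (v w : V).

Definition cv v (i : 'I_N) : K := coord (vbasis {:V}) i v.
Definition dirder f v w : K := \sum_i f^`M(i).@[cv v] * cv w i.

Lemma cvD v w i : cv (v + w) i = cv v i + cv w i. Proof. exact: linearD. Qed.
Lemma cvZ a v i : cv (a *: v) i = a * cv v i. Proof. exact: linearZ. Qed.
Lemma cv_sum (I : Type) (r : seq I) (Q : pred I) (u : I -> V) i :
  cv (\sum_(j <- r | Q j) u j) i = \sum_(j <- r | Q j) cv (u j) i.
Proof. exact: linear_sum. Qed.
Lemma cv_vec v : v = \sum_(i < N) cv v i *: (vbasis {:V})`_i.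
Proof. by rewrite {1}(coord_vbasis (memvf v)). Qed.

Lemma poly_funE f v : poly_fun f v = f.@[cv v]. Proof. by []. Qed.
Lemma poly_funM f g v : poly_fun (f * g) v = poly_fun f v * poly_fun g v.
Proof. exact: mevalM. Qed.
Lemma poly_funD f g v : poly_fun (f + g) v = poly_fun f v + poly_fun g v.
Proof. exact: mevalD. Qed.
Lemma poly_funB f g v : poly_fun (f - g) v = poly_fun f v - poly_fun g v.
Proof. exact: mevalB. Qed.
Lemma poly_funZ a f v : poly_fun (a *: f) v = a * poly_fun f v.
Proof. exact: mevalZ. Qed.
Lemma poly_fun_homog d f a v : f \is d.-homog -> poly_fun f (a *: v) = a ^+ d * poly_fun f v.
Proof.
by move=> fd; rewrite !poly_funE -meval_homog //; apply: meval_eq => i; rewrite cvZ.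
Qed.

Lemma dirderM f g v w :
  dirder (f * g) v w = dirder f v w * poly_fun g v + poly_fun f v * dirder g v w.
Proof.
rewrite /dirder big_distrl big_distrr -big_split; apply: eq_bigr => i _ /=.
by rewrite mderivM mevalD !mevalM !poly_funE; ring.
Qed.
Lemma dirderD f g v w : dirder (f + g) v w = dirder f v w + dirder g v w.
Proof. by rewrite /dirder -big_split; apply: eq_bigr => i _ /=; rewrite mderivD mevalD mulrDl. Qed.
Lemma dirderB f g v w : dirder (f - g) v w = dirder f v w - dirder g v w.
Proof. by rewrite /dirder -sumrB; apply: eq_bigr => i _ /=; rewrite mderivB mevalB mulrBl. Qed.
Lemma dirderZ a f v w : dirder (a *: f) v w = a * dirder f v w.
Proof. by rewrite /dirder big_distrr; apply: eq_bigr => i _ /=; rewrite mderivZ mevalZ mulrA. Qed.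
Lemma dirder_Dr f v w w' : dirder f v (w + w') = dirder f v w + dirder f v w'.
Proof. by rewrite /dirder -big_split; apply: eq_bigr => i _ /=; rewrite cvD mulrDr. Qed.
Lemma dirder_Zr f v a w : dirder f v (a *: w) = a * dirder f v w.
Proof. by rewrite /dirder big_distrr; apply: eq_bigr => i _ /=; rewrite cvZ mulrCA. Qed.

Definition linform (l : V -> K) : form := \sum_(i < N) l (vbasis {:V})`_i *: 'X_i.

Lemma linform_homog l : linform l \is 1.-homog.
Proof. by apply: rpred_sum => i _; apply: rpredZ; rewrite dhomogX /= mdeg1. Qed.

Lemma poly_fun_linform (l : V -> K) (ll : linear (l : V -> K^o)) v :
  poly_fun (linform l) v = l v.
Proof.
pose h := HB.pack_for {linear V -> K^o} (l : V -> K^o) (GRing.isLinear.Build K V K^o _ _ ll).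
rewrite {2}(cv_vec v) -[RHS]/(h _) linear_sum poly_funE raddf_sum; apply: eq_bigr => i _.
by rewrite (linearZ_LR h) /= mevalZ mevalXU mulrC.
Qed.

Lemma dirder_linform (l : V -> K) (ll : linear (l : V -> K^o)) v w :
  dirder (linform l) v w = l w.
Proof.
rewrite -(poly_fun_linform ll w) poly_funE raddf_sum; apply: eq_bigr => i _ /=.
rewrite mevalZ mevalXU; congr (_ * _).
have -> : (linform l)^`M(i) = (l (vbasis {:V})`_i)%:MP.
  rewrite [LHS](linear_sum (mderiv i)) (bigD1 i) //= big1 => [|j /negPf ji].
    by rewrite addr0 mderivZ mderivXU eqxx -mul_mpolyC mulr1.
  by rewrite mderivZ mderivXU ji scaler0.
exact: mevalC.
Qed.

(** The quadratic term is what a curve with velocity w needs to stay on a quadric. The exceptional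
    parameter b covers the line v + t v, which meets the origin at t = -1. *)
Lemma dirder_curve f v w z b :
  (forall t, t != b -> poly_fun f (v + t *: w + t ^+ 2 *: z) = 0) -> dirder f v w = 0.
Proof.
move=> f0; pose c i : {poly K} := (cv v i)%:P + cv w i *: 'X + cv z i *: 'X^2.
have cE t i : (c i).[t] = cv (v + t *: w + t ^+ 2 *: z) i.
  by rewrite /c !hornerE /= !cvD !cvZ; ring.
have c0 : along c f = 0.
  apply: (@poly_eq0_inf _ _ b) => t tb; rewrite horner_along -(f0 _ tb).
  exact/meval_eq/cE.
have := deriv_along_at c f 0; rewrite c0 deriv0 horner0 => e; rewrite [RHS]e.
apply: eq_bigr => i _; congr (_ * _).
  by apply: meval_eq => j; rewrite cE scale0r expr0n /= scale0r !addr0.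
by rewrite /c !derivD derivC !derivZ derivX derivXn !hornerE /=; ring.
Qed.
End DirectionalDerivative.

Section Points.
Variables (K : numClosedFieldType) (V : vectType K) (q : V -> K).
Hypotheses (quad_q : quadratic_form q) (nondeg_q : nondegenerate_quad q).
Local Notation B := (polar q).
Local Notation Q := (quadric q).
Local Notation point := (set_type Q).
Local Notation form := {mpoly K[\dim {:V}]}.
Local Notation fn := (point -> K).
Implicit Types (x y : point) (u v w : V) (f g : form) (F G : fn).

Definition vec x : V := vpick (val (val x)).

Lemma vec_neq0 x : vec x != 0.
Proof.
rewrite /vec vpick0 -dimv_eq0; case: (val x) => L /= /eqP; lia.
Qed.

Lemma quad_vec x : q (vec x) = 0.
Proof. by have := set_valP x; apply; exact: memv_pick. Qed.

Lemma vec_surj v : v != 0 -> q v = 0 -> exists x t, t != 0 /\ v = t *: vec x.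
Proof.
move=> v0 qv; have dL : \dim <[v]> == 1%N by rewrite dim_vline v0.
pose L : proj V := exist _ <[v]>%VS dL.
have QL : L \in Q.
  by apply/mem_set => w /vlineP[a ->]; rewrite (quadZ quad_q) qv mulr0.
exists (SigSub QL : point).
have /vlineP[a aE] : vec (SigSub QL : point) \in <[v]>%VS by exact: memv_pick.
have a0 : a != 0.
  by apply: contraNneq (vec_neq0 (SigSub QL : point)) => a0; rewrite aE a0 scale0r.
by exists a^-1; rewrite invr_eq0 aE scalerA mulVf // scale1r.
Qed.

Lemma hvalE f x : hval f (val x) = poly_fun f (vec x). Proof. by []. Qed.

Lemma dirder_tangent d f v w : f \is d.-homog ->
  (forall u, u != 0 -> q u = 0 -> poly_fun f u = 0) ->
  v != 0 -> q v = 0 -> B v w = 0 -> dirder f v w = 0.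
Proof.
move=> fd f0 v0 qv vw.
have [k [e [[Ge _] e0]]] := frame_exists quad_q nondeg_q v0 qv.
set e1 := e i1; have Bve : 2%:R * B v e1 = 1 by rewrite -e0 -co0 Ge eqxx.
have qe : q e1 = 0.
  have /eqP := Ge i0 i1; rewrite co0 (polar_vv quad_q) iE mulf_eq0 pnatr_eq0 /=.
  by move/eqP.
pose b := 2%:R * B w e1; pose w' := w - b *: v.
have vw' : B v w' = 0 by rewrite (polarBr quad_q) (polarZr quad_q) vw (polar_vv quad_q) qv; ring.
have we' : B w' e1 = 0.
  by rewrite (polarBl quad_q) (polarZl quad_q) /b mulrAC Bve; ring.
have wE : w = w' + b *: v by rewrite subrK.
clearbody w' b; rewrite wE.
have d1 : dirder f v w' = 0.
  (* As e1 is isotropic with 2 B(v, e1) = 1 and w' is orthogonal to v and e1, the curve v + t w' - t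
     ^ 2 q(w') e1 is isotropic. It avoids 0 because its pairing with e1 is constant. *)
  apply: (@dirder_curve _ _ _ _ _ (- (q w') *: e1) (-1)) => t _.
  set u := _ + _ + _.
  have Bu : 2%:R * B u e1 = 1.
    rewrite /u !(polarDl quad_q) !(polarZl quad_q) we' (polar_vv quad_q) qe -[RHS]Bve; ring.
  apply: f0; first by apply: contra_eq_neq Bu => ->; rewrite (polar0l quad_q) mulr0 eq_sym oner_eq0.
  rewrite /u !quadD !(quadZ quad_q) !(polarDl quad_q) !(polarZl quad_q).
  rewrite !(polarZr quad_q) qv qe vw' we'.
  transitivity (t ^+ 2 * q w' * (1 - 2%:R * B v e1)); first by ring.
  by rewrite Bve subrr mulr0.
have d2 : dirder f v v = 0.
  apply: (@dirder_curve _ _ _ _ _ 0 (-1)) => t t1; rewrite scaler0 addr0 -{1}[v]scale1r -scalerDl.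
  apply: f0; last by rewrite (quadZ quad_q) qv mulr0.
  by rewrite scaler_eq0 negb_or v0 andbT addrC addr_eq0.
by rewrite dirder_Dr dirder_Zr d1 d2 mulr0 addr0.
Qed.

(** [regular_at] with the fraction exposed, so that the quotient rule [quot_der] applies to it. *)
Definition rep F x f g := exists d, [/\ f \is d.-homog, g \is d.-homog
  & zariski_near x (fun y => hval g (val y) != 0 /\ F y = hval f (val y) / hval g (val y))].

Lemma regular_rep F x : regular_at F x <-> exists f g, rep F x f g.
Proof.
by split=> [[f [g [d H]]]|[f [g [d H]]]]; [exists f, g, d | exists f, g, d].
Qed.

Lemma zariski_near_pt x (P : point -> Prop) : zariski_near x P -> P x.
Proof. by move=> [h [d [_ hx]]]; apply. Qed.

Lemma zariski_near_near x (P : point -> Prop) :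
  zariski_near x P -> zariski_near x (fun y => zariski_near y P).
Proof. by move=> [h [d [hd hx hP]]]; exists h, d; split=> // y hy; exists h, d. Qed.

Definition quot_der f g v w :=
  (dirder f v w * poly_fun g v - poly_fun f v * dirder g v w) / poly_fun g v ^+ 2.

(** The product of f g' - f' g with the form h that cuts out the neighbourhood vanishes on the whole
    cone, hence so does its derivative in a tangent direction. As h is nonzero at x, the two
    quotient rules agree. *)
Lemma quot_der_unique F x f g f' g' w : B (vec x) w = 0 -> rep F x f g -> rep F x f' g' ->
  quot_der f g (vec x) w = quot_der f' g' (vec x) w.
Proof.
move=> xw [d [fd gd r]] [d' [fd' gd' r']].
have [gx Fx] := zariski_near_pt r; have [gx' Fx'] := zariski_near_pt r'.
have [h [e [he hx hr]]] := zariski_near_and r r'.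
have kd : h * (f * g' - f' * g) \is (e + (d + d')).-homog.
  apply: dhomogM => //; apply: rpredB; first exact: dhomogM.
  by rewrite addnC; exact: dhomogM.
have k0 u : u != 0 -> q u = 0 -> poly_fun (h * (f * g' - f' * g)) u = 0.
  move=> u0 qu; have [y [t [t0 ->]]] := vec_surj u0 qu.
  rewrite (poly_fun_homog _ _ kd) poly_funM.
  have [->|hy] := eqVneq (poly_fun h (vec y)) 0; first by rewrite mul0r mulr0.
  have [[gy Fy] [gy' Fy']] := hr _ hy.
  rewrite [X in _ * X](_ : _ = 0) ?mulr0 //; rewrite [X in _ * X](_ : _ = 0) ?mulr0 //.
  move: Fy; rewrite Fy' !hvalE in gy gy' * => /eqP; rewrite eqr_div // => /eqP e'.
  by rewrite poly_funB !poly_funM -e' subrr.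
have := dirder_tangent kd k0 (vec_neq0 x) (quad_vec x) xw.
move: Fx; rewrite Fx' !hvalE in gx gx' hx * => /eqP; rewrite eqr_div // => /eqP e'.
rewrite dirderM poly_funB !poly_funM -e' subrr mulr0 add0r => /eqP.
rewrite mulf_eq0 (negPf hx) dirderB !dirderM /= => /eqP e2.
apply/eqP; rewrite /quot_der eqr_div ?expf_neq0 //; apply/eqP.
move: (poly_fun f _) (poly_fun g _) (poly_fun f' _) (poly_fun g' _) (dirder f _ _)
  (dirder g _ _) (dirder f' _ _) (dirder g' _ _) gx gx' e' e2 => a b a' b' da db da' db'.
move=> b0 b'0 e' e2.
have e3 : a * b' - a' * b = 0 by rewrite e' subrr.
apply/eqP; rewrite -subr_eq0; apply/eqP.
transitivity (b * b' * (da * b' + a * db' - (da' * b + a' * db)) -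
  (a * b' - a' * b) * (db * b' + db' * b)); first by ring.
by rewrite e2 e3 mulr0 mul0r subrr.
Qed.

(** The quotient rule for an arbitrarily chosen fraction; the default 0 is the value that
    [is_tangent] imposes on functions not regular at x. *)
Definition tangent_fun x w F : K^o :=
  if pselect (exists fg : form * form, rep F x fg.1 fg.2) is left H then
    let fg := sval (cid H) in quot_der fg.1 fg.2 (vec x) w
  else 0.

Lemma tangent_funE x w F f g : B (vec x) w = 0 -> rep F x f g ->
  tangent_fun x w F = quot_der f g (vec x) w.
Proof.
move=> xw r; rewrite /tangent_fun; case: pselect => [H|[]]; last by exists (f, g).
exact: (quot_der_unique xw (svalP (cid H)) r).
Qed.

Lemma rep_near F G x f g : zariski_near x (fun y => F y = G y) -> rep F x f g -> rep G x f g.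
Proof.
move=> FG [d [fd gd r]]; exists d; split => //.
by apply: zariski_nearW (zariski_near_and FG r) => y [<-].
Qed.

Lemma repM F G x f g f' g' : rep F x f g -> rep G x f' g' ->
  rep (fun y => F y * G y) x (f * f') (g * g').
Proof.
move=> [d [fd gd r]] [d' [fd' gd' r']]; exists (d + d')%N; split; try exact: dhomogM.
apply: zariski_nearW (zariski_near_and r r') => y [[gy ->] [gy' ->]].
by rewrite !hvalE in gy gy' *; rewrite !poly_funM mulf_neq0 //; split=> //; rewrite mulf_div.
Qed.

Lemma repD a F G x f g f' g' : rep F x f g -> rep G x f' g' ->
  rep (fun y => a * F y + G y) x (a *: (f * g') + f' * g) (g * g').
Proof.
move=> [d [fd gd r]] [d' [fd' gd' r']]; exists (d + d')%N; split; try exact: dhomogM.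
  apply: rpredD; first by apply: rpredZ; exact: dhomogM.
  by rewrite addnC; exact: dhomogM.
apply: zariski_nearW (zariski_near_and r r') => y [[gy ->] [gy' ->]].
rewrite !hvalE in gy gy' *; rewrite poly_funD poly_funZ !poly_funM mulf_neq0 //; split=> //.
by field; rewrite gy gy'.
Qed.

Lemma regular_atD a F G x : regular_at F x -> regular_at G x ->
  regular_at (fun y => a * F y + G y) x.
Proof.
move=> /regular_rep[f [g r]] /regular_rep[f' [g' r']]; apply/regular_rep.
by do 2!eexists; exact: repD r r'.
Qed.

Lemma rep_val F x f g : rep F x f g ->
  poly_fun g (vec x) != 0 /\ F x = poly_fun f (vec x) / poly_fun g (vec x).
Proof. by move=> [d [_ _ /zariski_near_pt]]. Qed.

Lemma tangent_fun_tangent x w : B (vec x) w = 0 -> is_tangent x (tangent_fun x w).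
Proof.
move=> xw; split.
- move=> a F G /regular_rep[f [g r]] /regular_rep[f' [g' r']].
  rewrite (tangent_funE xw (repD a r r')) (tangent_funE xw r) (tangent_funE xw r').
  have [g0 _] := rep_val r; have [g0' _] := rep_val r'.
  rewrite /quot_der dirderD dirderZ !dirderM poly_funD poly_funZ !poly_funM.
  by field; rewrite g0 g0'.
- move=> F G /regular_rep[f [g r]] /regular_rep[f' [g' r']].
  rewrite (tangent_funE xw (repM r r')) (tangent_funE xw r) (tangent_funE xw r').
  have [g0 ->] := rep_val r; have [g0' ->] := rep_val r'.
  rewrite /quot_der !dirderM !poly_funM.
  by field; rewrite g0 g0'.
- move=> F G /regular_rep[f [g r]] _ FG.
  by rewrite (tangent_funE xw r) (tangent_funE xw (rep_near FG r)).
- move=> F nF; rewrite /tangent_fun; case: pselect => // -[[f g] r].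
  by case: nF; apply/regular_rep; exists f, g.
Qed.

(* The derivative in the direction w, as a tangent vector at x. *)
Definition tau x w (xw : B (vec x) w = 0) : tangent_space x :=
  Tangent (asboolT (tangent_fun_tangent xw)).
End Points.

(** * Cotangent vectors given by vectors orthogonal to the point *)

Section TangentSpaces.
Variables (K : numClosedFieldType) (V : vectType K) (q : V -> K).
Hypotheses (quad_q : quadratic_form q) (nondeg_q : nondegenerate_quad q).
Local Notation B := (polar q).
Local Notation Q := (quadric q).
Local Notation point := (set_type Q).
Local Notation form := {mpoly K[\dim {:V}]}.
Local Notation fn := (point -> K).
Implicit Types (x y : point) (u v w c : V) (f g : form) (F G : fn).

Section Derivation.
Variables (x : point) (D : tangent_space x).

Lemma tangentP : is_tangent x D.
Proof. by have /asboolP := valP D. Qed.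

Lemma tangent_lin a F G : regular_at F x -> regular_at G x ->
  D (fun y => a * F y + G y) = a * D F + D G.
Proof. by have [H _ _ _] := tangentP; exact: H. Qed.
Lemma tangent_mul F G : regular_at F x -> regular_at G x ->
  D (fun y => F y * G y) = F x * D G + G x * D F.
Proof. by have [_ H _ _] := tangentP; exact: H. Qed.
Lemma tangent_near F G : regular_at F x -> regular_at G x ->
  zariski_near x (fun y => F y = G y) -> D F = D G.
Proof. by have [_ _ H _] := tangentP; exact: H. Qed.
Lemma tangent_nreg F : ~ regular_at F x -> D F = 0.
Proof. by have [_ _ _ H] := tangentP; exact: H. Qed.

Lemma tangent_cst (c : K) : D (fun=> c) = 0.
Proof.
have r (a : K) := @regular_at_cst _ _ Q a x.
have D0 : D (fun=> 0) = 0.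
  have : D (fun=> 0) = 1 * D (fun=> 0) + D (fun=> 0).
    by rewrite -tangent_lin //; congr (tangent_val D); apply/funext => y; rewrite mul1r addr0.
  by move/eqP; rewrite mul1r -subr_eq0 opprD addrA subrr sub0r oppr_eq0 => /eqP.
have D1 : D (fun=> 1) = 0.
  have : D (fun=> 1) = 1 * D (fun=> 1) + 1 * D (fun=> 1).
    by rewrite -tangent_mul //; congr (tangent_val D); apply/funext => y; rewrite mul1r.
  by move/eqP; rewrite mul1r -subr_eq0 opprD addrA subrr sub0r oppr_eq0 => /eqP.
transitivity (c * D (fun=> 1) + D (fun=> 0)); last by rewrite D0 D1 mulr0 addr0.
by rewrite -tangent_lin //; congr (tangent_val D); apply/funext => y; rewrite mulr1 addr0.
Qed.

Lemma tangent_sum (I : Type) (s : seq I) (a : I -> K) (F : I -> fn) :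
  (forall i, regular_at (F i) x) ->
  regular_at (fun y => \sum_(i <- s) a i * F i y) x /\
  D (fun y => \sum_(i <- s) a i * F i y) = \sum_(i <- s) a i * D (F i).
Proof.
move=> rF; elim: s => [|i s [IHr IH]].
  rewrite big_nil (_ : (fun=> _) = (fun=> 0) :> fn); last by apply/funext => y; rewrite big_nil.
  by split; [exact: regular_at_cst | exact: tangent_cst].
rewrite (_ : (fun y => \sum_(j <- i :: s) _) =
   (fun y => a i * F i y + \sum_(j <- s) a j * F j y) :> fn); last first.
  by apply/funext => y; rewrite big_cons.
by split; [exact: regular_atD | rewrite tangent_lin // IH big_cons].
Qed.

Lemma tangent_comp N (h : {mpoly K[N]}) (F : 'I_N -> fn) :
  (forall i, regular_at (F i) x) ->
  regular_at (fun y => h.@[fun i => F i y]) x /\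
  D (fun y => h.@[fun i => F i y]) = \sum_i h^`M(i).@[fun i => F i x] * D (F i).
Proof.
move=> rF; elim/mpoly_ind: h => [a|i|f g [rf Df] [rg Dg]|f g [rf Df] [rg Dg]].
- rewrite (_ : (fun=> _) = (fun=> a) :> fn); last by apply/funext => y; rewrite mevalC.
  split; first exact: regular_at_cst.
  by rewrite tangent_cst big1 // => i _; rewrite mderivC meval0 mul0r.
- rewrite (_ : (fun=> _) = F i :> fn); last by apply/funext => y; rewrite mevalXU.
  split => //; rewrite (bigD1 i) //= big1 => [|j ji]; rewrite mderivXU.
    by rewrite eqxx meval1 mul1r addr0.
  by rewrite eq_sym (negPf ji) meval0 mul0r.
- rewrite (_ : (fun=> _) = (fun y => 1 * f.@[fun i => F i y] + g.@[fun i => F i y]) :> fn).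
    split; first exact: regular_atD.
    rewrite tangent_lin // Df Dg mul1r -big_split; apply: eq_bigr => i _ /=.
    by rewrite mderivD mevalD mulrDl.
  by apply/funext => y; rewrite mevalD mul1r.
- rewrite (_ : (fun=> _) = (fun y => f.@[fun i => F i y] * g.@[fun i => F i y]) :> fn).
    split; first exact: regular_atM.
    rewrite tangent_mul // Df Dg !big_distrr -big_split; apply: eq_bigr => i _ /=.
    by rewrite mderivM mevalD !mevalM; ring.
  by apply/funext => y; rewrite mevalM.
Qed.
End Derivation.

Definition rat c w : fn := fun y => B (vec y) w / B (vec y) c.

Lemma rep_rat c w x : B (vec x) c != 0 ->
  rep (rat c w) x (linform (polarl q w)) (linform (polarl q c)).
Proof.
move=> xc; exists 1%N; split; try exact: linform_homog.
have lE u v : poly_fun (linform (polarl q u)) v = B v u.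
  by rewrite poly_fun_linform //; exact: polarl_is_linear.
exists (linform (polarl q c)), 1%N; split; first exact: linform_homog.
  by rewrite hvalE lE.
by move=> y; rewrite !hvalE !lE.
Qed.

Lemma regular_rat c w x : B (vec x) c != 0 -> regular_at (rat c w) x.
Proof. by move=> xc; apply/regular_rep; do 2!eexists; exact: rep_rat. Qed.

Lemma zariski_near_polar c x : B (vec x) c != 0 -> zariski_near x (fun y => B (vec y) c != 0).
Proof.
move=> xc; have [d [_ _ r]] := rep_rat 0 xc; apply: zariski_nearW r => y [+ _].
by rewrite hvalE poly_fun_linform //; exact: polarl_is_linear.
Qed.

Lemma polar_neq0 x : exists c, B (vec x) c != 0.
Proof.
apply: contrapT => no; case/eqP: (vec_neq0 x); apply: nondeg_q => y; apply: contrapT => By.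
by apply: no; exists y; apply/eqP.
Qed.
Definition cx x : V := sval (cid (polar_neq0 x)).
Lemma cxP x : B (vec x) (cx x) != 0. Proof. exact: (svalP (cid (polar_neq0 x))). Qed.

(* The cotangent vector at x determined by w, for w orthogonal to [vec x]; the choice of
   the denominator is then irrelevant, see [lamE]. *)
Definition lam x w (D : tangent_space x) : K^o :=
  B (vec x) (cx x) * D (rat (cx x) w).

Lemma rat_lin c a w w' : rat c (a *: w + w') = (fun y => a * rat c w y + rat c w' y).
Proof.
by apply/funext => y; rewrite /rat (polarDr quad_q) (polarZr quad_q) mulrDl -mulrA.
Qed.

(** A change of denominator multiplies [rat c w] by a function whose derivative does not contribute
    to the Leibniz rule, because [rat c w] is zero at x. *)
Lemma lamE c x w (D : tangent_space x) : B (vec x) c != 0 -> B (vec x) w = 0 ->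
  lam w D = B (vec x) c * D (rat c w).
Proof.
move=> xc xw; rewrite /lam; have xc' := cxP x; move: (cx x) xc' => c' xc'.
have -> : D (rat c' w) = D (fun y => rat c w y * rat c' c y).
  apply: tangent_near; first exact: regular_rat.
    by apply: regular_atM; exact: regular_rat.
  apply: zariski_nearW (zariski_near_polar xc) => y yc; rewrite /rat.
  by rewrite mulrA divfK.
rewrite tangent_mul; try exact: regular_rat.
have -> : rat c w x = 0 by rewrite /rat xw mul0r.
by rewrite mul0r add0r {1}/rat mulrA [_ * (_ / _)]mulrC divfK.
Qed.

Fact lam_is_linear x w : linear (@lam x w).
Proof. by move=> a D D'; rewrite /lam mulrDr mulrCA. Qed.
HB.instance Definition _ x w :=
  GRing.isLinear.Build K (tangent_space x) K^o _ (@lam x w) (@lam_is_linear x w).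

Lemma lam_lin x (D : tangent_space x) a w w' : lam (a *: w + w') D = a * lam w D + lam w' D.
Proof.
by rewrite /lam rat_lin tangent_lin ?mulrDr 1?mulrCA //; apply: regular_rat; exact: cxP.
Qed.
Lemma lam0 x (D : tangent_space x) : lam 0 D = 0.
Proof.
rewrite /lam (_ : rat _ 0 = (fun=> 0)) ?tangent_cst ?mulr0 //.
by apply/funext => y; rewrite /rat (polar0r quad_q) mul0r.
Qed.
Lemma lamZ x (D : tangent_space x) a w : lam (a *: w) D = a * lam w D.
Proof. by rewrite -[a *: w]addr0 lam_lin lam0 addr0. Qed.
Lemma lam_sum x (D : tangent_space x) (I : Type) (s : seq I) (a : I -> K) (w : I -> V) :
  lam (\sum_(i <- s) a i *: w i) D = \sum_(i <- s) a i * lam (w i) D.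
Proof.
by elim: s => [|i s IH]; rewrite ?big_nil ?lam0 // !big_cons lam_lin IH.
Qed.

(** The representing vector is written down in a frame, and the point supplies the isotropic vector
    from which the frame is built. *)
Lemma lin_repr (l : V -> K) : linear (l : V -> K^o) -> point ->
  exists c, forall v, l v = B v c.
Proof.
move=> ll x; have [k [e [[Ge eE] _]]] := frame_exists quad_q nondeg_q (vec_neq0 x) (quad_vec x).
pose h := HB.pack_for {linear V -> K^o} (l : V -> K^o) (GRing.isLinear.Build K V K^o _ _ ll).
exists (2%:R * l (e i0) *: e i1 + (2%:R * l (e i1) *: e i0 + \sum_i l (e (iu i)) *: e (iu i))).
move=> v; rewrite !(polarDr quad_q) !(polarZr quad_q) (polar_sumr quad_q).
rewrite {1}(eE v) -[LHS]/(h _) linear_sum !big_ord_recl -/i0 -/i1 !(linearZ_LR h) /=.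
rewrite co0 co1; congr (_ + (_ + _)).
- by rewrite -[_ *: _]/(_ * _); ring.
- by rewrite -[_ *: _]/(_ * _); ring.
apply: eq_bigr => i _; transitivity (co q e (iu i) v * l (e (iu i))).
  exact: (linearZ_LR h).
by rewrite cou (polarZr quad_q) mulrC.
Qed.

Lemma cv_repr (x : point) : exists d : 'I_(\dim {:V}) -> V, forall i v, cv v i = B v (d i).
Proof.
have H i : {d | forall v, cv v i = B v d}.
  apply/cid/lin_repr => // a u v; exact: linearP.
by exists (fun i => sval (H i)) => i; exact: (svalP (H i)).
Qed.

(** D is applied to the equation of the quadric, written in dual bases d and X as a sum of products
    [rat c (d i) * rat c X_i]. By the Leibniz rule both halves give the derivative of
    [rat c (vec x)] up to the same factor. This is why symbols ignore multiples of x added to w. *)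
Lemma lam_vec x (D : tangent_space x) : lam (vec x) D = 0.
Proof.
have [d dE] := cv_repr x; set X := vbasis {:V}; have xc := cxP x; set c := cx x in xc *.
have qE y : \sum_i rat c (d i) y * rat c X`_i y = 0.
  transitivity (B (vec y) (vec y) / B (vec y) c ^+ 2); last first.
    by rewrite (polar_vv quad_q) quad_vec mul0r.
  have -> : B (vec y) (vec y) = \sum_i B (vec y) (d i) * B (vec y) X`_i.
    rewrite {2}(cv_vec (vec y)) (polar_sumr quad_q); apply: eq_bigr => i _.
    by rewrite (polarZr quad_q) dE.
  have fm (p t l : K) : p / l * (t / l) = p * t / l ^+ 2 by rewrite expr2 invfM mulrACA.
  by rewrite big_distrl; apply: eq_bigr => i _; exact: fm.
have r w : regular_at (rat c w) x by exact: regular_rat.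
have [_ Dsum] := @tangent_sum x D _ (index_enum 'I_(\dim {:V})) (fun=> 1)
  (fun i y => rat c (d i) y * rat c X`_i y) (fun i => regular_atM (r _) (r _)).
have Drat (a : 'I_(\dim {:V}) -> K) (w : 'I_(\dim {:V}) -> V) :
    \sum_i a i * D (rat c (w i)) = D (rat c (\sum_i a i *: w i)).
  apply: (mulfI xc); have := lam_sum D (index_enum 'I_(\dim {:V})) a w.
  rewrite /lam -/c => ->; rewrite big_distrr; apply: eq_bigr => i _ /=; exact: mulrCA.
have sE (a b : 'I_(\dim {:V}) -> K) (ab : forall i, a i = b i / B (vec x) c)
    (w : 'I_(\dim {:V}) -> V) (wE : \sum_i b i *: w i = vec x) :
    \sum_i a i * D (rat c (w i)) = (B (vec x) c)^-1 * D (rat c (vec x)).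
  rewrite -[X in D (rat c X)]wE -Drat big_distrr; apply: eq_bigr => i _ /=.
  have fm (p l t : K) : p / l * t = l^-1 * (p * t) by rewrite -mulrA mulrCA.
  rewrite ab; exact: fm.
have : 0 = 2%:R * ((B (vec x) c)^-1 * D (rat c (vec x))).
  rewrite -{1}(tangent_cst D 0).
  transitivity (D (fun y => \sum_i 1 * (rat c (d i) y * rat c X`_i y))).
    congr (tangent_val D); apply/funext => y /=; rewrite -[LHS](qE y).
    by apply: eq_bigr => i _; rewrite mul1r.
  rewrite Dsum (eq_bigr (fun i => rat c (d i) x * D (rat c X`_i) +
    rat c X`_i x * D (rat c (d i)))) => [|i _]; last by rewrite mul1r tangent_mul.
  rewrite big_split /= mulr_natl mulr2n; congr (_ + _).
    by apply: (sE _ (cv (vec x))) => [i|]; [rewrite dE | rewrite -cv_vec].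
  (* Here [vec x] is expanded in the basis d dual to X; the expansion is tested against all w by
     nondegeneracy. *)
  apply: (sE _ (fun i => B (vec x) X`_i)) => // .
  suff e : forall w, B (\sum_(i < \dim {:V}) B (vec x) X`_i *: d i) w = B (vec x) w.
    apply/eqP; rewrite -subr_eq0; apply/eqP/nondeg_q => w.
    by rewrite (polarBl quad_q) e subrr.
  move=> w; rewrite (polar_suml quad_q) [in RHS](cv_vec w) (polar_sumr quad_q).
  apply: eq_bigr => i _; rewrite (polarZl quad_q) (polarZr quad_q) dE (polarC q w).
  exact: mulrC.
move/esym/eqP; rewrite !mulf_eq0 pnatr_eq0 invr_eq0 (negPf xc) /= => /eqP e.
by rewrite /lam -/c e mulr0.
Qed.
End TangentSpaces.

(** * Bases of tangent spaces, and vector fields from skew endomorphisms *)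

Section VectorFields.
Variables (K : numClosedFieldType) (V : vectType K) (q : V -> K).
Hypotheses (quad_q : quadratic_form q) (nondeg_q : nondegenerate_quad q).
Local Notation B := (polar q).
Local Notation Q := (quadric q).
Local Notation point := (set_type Q).
Local Notation form := {mpoly K[\dim {:V}]}.
Local Notation fn := (point -> K).
Local Notation lam := (lam nondeg_q).
Local Notation tau := (tau quad_q nondeg_q).
Implicit Types (x y : point) (u v w c : V) (f g : form) (F G : fn).

Lemma lam_tau x w w' (xw : B (vec x) w = 0) : B (vec x) w' = 0 ->
  lam w' (tau xw) = B w w'.
Proof.
move=> xw'; have xc := cxP nondeg_q x; rewrite /lam; move: (cx _ x) xc => c xc.
rewrite [X in _ * X](tangent_funE quad_q nondeg_q xw (rep_rat quad_q _ xc)) /quot_der.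
rewrite !dirder_linform ?poly_fun_linform; try exact: polarl_is_linear.
rewrite /polarl xw' mul0r subr0.
have fm (p t : K) : t != 0 -> t * (p * t / t ^+ 2) = p by move=> t0; field.
exact: fm.
Qed.

(** Near x a regular function is a quotient of polynomials in the functions [rat c w], so D is
    determined by its values on them. Since [rat c c] is locally constant, subtracting a multiple of
    c makes w orthogonal to [vec x]. *)
Lemma tangent_eq0 x (D : tangent_space x) :
  (forall w, B (vec x) w = 0 -> lam w D = 0) -> D = 0.
Proof.
move=> D0; have xc := cxP nondeg_q x; set c := cx nondeg_q x in xc.
have r w : regular_at (rat c w) x by exact: regular_rat.
have Dr w : D (rat c w) = 0.
  have cE : lam c D = 0.
    rewrite /lam -/c (tangent_near D (G := fun=> 1)) ?tangent_cst ?mulr0 //.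
      exact: regular_at_cst.
    by apply: zariski_nearW (zariski_near_polar quad_q xc) => y yc; rewrite /rat divff.
  have : lam w D = 0.
    pose b := B (vec x) w / B (vec x) c.
    have -> : lam w D = b * lam c D + lam (w - b *: c) D by rewrite -lam_lin // addrC subrK.
    rewrite cE mulr0 add0r; apply: D0; rewrite (polarBr quad_q) (polarZr quad_q).
    have fm (p t : K) : t != 0 -> p - p / t * t = 0 by move=> t0; rewrite divfK // subrr.
    exact: fm.
  by rewrite /lam -/c => /eqP; rewrite mulf_eq0 (negPf xc) => /eqP.
apply: val_inj; apply/funext => F; rewrite [RHS]/=.
have [/regular_rep[f [g [d [fd gd rFG]]]]|nF] := pselect (regular_at F x); last first.
  by rewrite [LHS]tangent_nreg.
have [e eE] := cv_repr quad_q nondeg_q x.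
pose hom f : fn := fun y => f.@[fun i => rat c (e i) y].
have [hf Df] := tangent_comp D f (fun i => r (e i)).
have [hg Dg] := tangent_comp D g (fun i => r (e i)).
have {}Df : D (hom f) = 0 by rewrite Df big1 // => i _; rewrite Dr mulr0.
have {}Dg : D (hom g) = 0 by rewrite Dg big1 // => i _; rewrite Dr mulr0.
have homE h k y : h \is k.-homog -> hom h y = (B (vec y) c)^-1 ^+ k * poly_fun h (vec y).
  move=> hk; rewrite poly_funE -meval_homog //; apply: meval_eq => i.
  by rewrite /rat eE mulrC.
have rF : regular_at F x by apply/regular_rep; exists f, g, d.
have : D (fun y => F y * hom g y) = D (hom f).
  apply: tangent_near => //; first exact: regular_atM.
  apply: zariski_nearW (zariski_near_and rFG (zariski_near_polar quad_q xc)).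
  move=> y [[gy ->] yc]; rewrite (homE _ _ _ fd) (homE _ _ _ gd) !hvalE in gy *.
  by rewrite mulrCA divfK.
rewrite tangent_mul // Df Dg mulr0 add0r => /eqP; rewrite mulf_eq0 => /orP[|/eqP //].
have [gx _] := zariski_near_pt rFG.
by rewrite (homE _ _ _ gd) mulf_eq0 (negPf gx) orbF expf_eq0 invr_eq0 (negPf xc) andbF.
Qed.

(** The derivation of the polynomial ring induced by the linear vector field v -> N v. It preserves
    degrees, which makes the corresponding field on Q regular. *)
Definition nder (N : V -> V) f : form :=
  \sum_i f^`M(i) * linform (fun v => cv (N v) i).

Section Linear.
Variable N : {linear V -> V}.

Let Nl i : linear ((fun v => cv (N v) i) : V -> K^o).
Proof. by move=> a u v; rewrite linearP cvD cvZ. Qed.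

Lemma nder_homog d f : f \is d.-homog -> nder N f \is d.-homog.
Proof.
move=> /dhomogP fd; apply: rpred_sum => i _.
rewrite [f]mpolyE (linear_sum (mderiv i)) big_distrl big_seq; apply: rpred_sum => mm /fd mmd.
rewrite /= mderivZ mderivX -!scalerAl; apply: rpredZ.
case: (posnP (mm i)) => [->|mi]; first by rewrite scale0r rpred0.
have hX : ('X_[(mm - U_(i))%MM] : form) \is (mdeg (mm - U_(i))%MM).-homog by rewrite dhomogX /=.
have := dhomogM hX (linform_homog (fun v => cv (N v) i)).
have -> : (mdeg (mm - U_(i)) + 1 = d)%N.
  rewrite -mmd /= -{2}(submK (m := U_(i)%MM) (m' := mm)); last first.
    by apply/mnm_lepP => j; rewrite mnm1E; case: eqP => [<-|].
  by rewrite mdegD mdeg1.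
by move=> H; exact: rpredZ.
Qed.

Lemma poly_fun_nder f v : poly_fun (nder N f) v = dirder f v (N v).
Proof.
rewrite poly_funE raddf_sum; apply: eq_bigr => i _ /=.
by rewrite mevalM -[X in _ * X]poly_funE poly_fun_linform.
Qed.

Hypothesis Nskew : forall v, B v (N v) = 0.

Definition field_of : vector_field Q := fun x => tau (Nskew (vec x)).

Lemma regular_field_of x : regular_field_at field_of x.
Proof.
move=> F /regular_rep[f [g [d [fd gd r]]]]; apply/regular_rep.
exists (nder N f * g - f * nder N g), (g * g), (d + d)%N; split.
- by apply: rpredB; apply: dhomogM => //; exact: nder_homog.
- exact: dhomogM.
apply: zariski_nearW (zariski_near_near r) => y ry.
have [gy _] := zariski_near_pt ry.
rewrite hvalE poly_funM mulf_neq0 //; split=> //.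
rewrite [LHS](tangent_funE quad_q nondeg_q (Nskew (vec y)) (f := f) (g := g)); last by exists d.
by rewrite /quot_der !hvalE poly_funB !poly_funM !poly_fun_nder expr2.
Qed.

Lemma lam_field_of x w : B (vec x) w = 0 -> lam w (field_of x) = B (N (vec x)) w.
Proof. exact: lam_tau. Qed.
End Linear.

(** In a frame with [e i0 = vec x], a vector orthogonal to x has no component along [e i1], and its
    component along [vec x] is invisible to [lam]. Hence the orthonormal vectors [e (iu j)] give
    dual bases, and [tangent_eq0] applies. *)
Lemma tangent_basis x : exists k (mu : 'I_k -> V) (xmu : forall j, B (vec x) (mu j) = 0),
  (forall i j, B (mu i) (mu j) = (i == j)%:R) /\
  forall D : tangent_space x, D = \sum_j lam (mu j) D *: tau (xmu j).
Proof.
have [k [e [[Ge eE] e0]]] := frame_exists quad_q nondeg_q (vec_neq0 x) (quad_vec x).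
have xmu j : B (vec x) (e (iu j)) = 0 by rewrite -e0 -cou Ge iE.
have mumu i j : B (e (iu i)) (e (iu j)) = (i == j)%:R by rewrite -cou Ge iuu eq_sym.
exists k, (fun j => e (iu j)), xmu; split => // D; apply/eqP; rewrite -subr_eq0; apply/eqP.
apply: tangent_eq0 => w xw; pose lw : {linear tangent_space x -> K^o} := lam w.
rewrite (linearB lw) (linear_sum lw) /=.
have wE : w = co q e i0 w *: vec x + \sum_j co q e (iu j) w *: e (iu j).
  rewrite {1}(eE w) /span_pt !big_ord_recl -/i0 -/i1 e0 co1 e0 (polarC q w) xw mulr0 scale0r add0r.
  by congr (_ + _); apply: eq_bigr.
rewrite {1}wE (lam_lin quad_q) (lam_vec quad_q) mulr0 add0r (lam_sum quad_q) -sumrB big1 // => j _.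
rewrite (linearZ_LR lw) [lw _](lam_tau (xmu j) xw) (polarC q (e _)) -cou.
by rewrite [X in _ - X]mulrC subrr.
Qed.
End VectorFields.

(** * Symmetric algebras *)

Section QuotientLift.
Variables (A : comPzRingType) (S : pzRingType) (I : set A) (psi : {rmorphism A -> S}).
Hypothesis psiI : forall e, I e -> psi e = 0.

Lemma quot_map_repr (x : quot_ring I) : quot_map I (repr x) = x.
Proof. by rewrite quot_mapE; exact: reprK. Qed.

Definition quot_lift_fun (x : quot_ring I) : S := psi (repr x).

Lemma quot_lift_funE a : quot_lift_fun (quot_map I a) = psi a.
Proof.
apply/eqP; rewrite -subr_eq0 -rmorphB; apply/eqP.
have : ideal_gen I (repr (quot_map I a) - a) by apply/quot_mapP; rewrite quot_map_repr.
elim=> [|b e z Ie _ IH]; first exact: rmorph0.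
by rewrite rmorphD rmorphM (psiI Ie) mulr0 add0r.
Qed.

Fact quot_lift_zmod_morphism : zmod_morphism quot_lift_fun.
Proof.
move=> x y; rewrite -(quot_map_repr x) -(quot_map_repr y) -rmorphB !quot_lift_funE.
exact: rmorphB.
Qed.
Fact quot_lift_monoid_morphism : monoid_morphism quot_lift_fun.
Proof.
split=> [|x y]; first by rewrite -(rmorph1 (quot_map I)) quot_lift_funE rmorph1.
by rewrite -(quot_map_repr x) -(quot_map_repr y) -rmorphM !quot_lift_funE rmorphM.
Qed.
Definition quot_lift : {rmorphism quot_ring I -> S} :=
  HB.pack_for {rmorphism quot_ring I -> S} quot_lift_fun
    (GRing.isZmodMorphism.Build (quot_ring I) S quot_lift_fun quot_lift_zmod_morphism)
    (GRing.isMonoidMorphism.Build (quot_ring I) S quot_lift_fun quot_lift_monoid_morphism).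

Lemma quot_liftE a : quot_lift (quot_map I a) = psi a.
Proof. exact: quot_lift_funE. Qed.
End QuotientLift.

Section SymEval.
Variables (K : fieldType) (W : lmodType K) (phi : {linear W -> K^o}).

Definition mon_eval (m : cmonom W) : K := \prod_(i <- finsupp m) phi i ^+ m i.

Lemma mon_evalw (m : cmonom W) (d : finSet W) : fsubset (finsupp m) d ->
  mon_eval m = \prod_(i <- d) phi i ^+ m i.
Proof.
move=> le; rewrite /mon_eval (big_fset_incl _ le) // => i i_in_d.
by rewrite -cmE_neq0 negbK => /eqP->; rewrite expr0.
Qed.

Fact mon_eval_mmorphism : mmorphism mon_eval.
Proof.
split=> [m1 m2|]; last by rewrite /mon_eval mdom1 big_seq_fset0.
rewrite /mon_eval mdomD.
rewrite -!/(mon_eval _) (mon_evalw (fsubsetUl _ (finsupp m2)))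
  (mon_evalw (fsubsetUr (finsupp m1) _)) -big_split /=.
by apply: eq_bigr => i _; rewrite cmM exprD.
Qed.
HB.instance Definition _ := monalg.isMultiplicative.Build (cmonom W) K mon_eval mon_eval_mmorphism.

Definition alg_eval : {rmorphism free_com_alg W -> K} := monalg.mmap (@idfun K) mon_eval.

Lemma alg_eval_var w : alg_eval (sym_var w) = phi w.
Proof.
rewrite [LHS]monalg.mmapU mul1r /= /mon_eval mdomU big_seq_fset1 cmUU; exact: expr1.
Qed.
Lemma alg_evalC (c : K) : alg_eval (malgC c) = c.
Proof. exact: monalg.mmapC. Qed.

Lemma alg_evalD (a b : free_com_alg W) : alg_eval (a + b) = alg_eval a + alg_eval b.
Proof. exact: (rmorphD alg_eval). Qed.
Lemma alg_evalB (a b : free_com_alg W) : alg_eval (a - b) = alg_eval a - alg_eval b.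
Proof. exact: (rmorphB alg_eval). Qed.
Lemma alg_evalM (a b : free_com_alg W) : alg_eval (a * b) = alg_eval a * alg_eval b.
Proof. exact: (rmorphM alg_eval). Qed.

Lemma alg_eval_rel (e : free_com_alg W) : sym_rel e -> alg_eval e = 0.
Proof.
case=> [[u [v ->]]|[a [u ->]]].
  rewrite alg_evalB alg_evalD; apply/eqP; rewrite subr_eq0; apply/eqP.
  apply: (etrans (alg_eval_var _)); apply: (etrans (linearD phi u v)).
  congr (_ + _); exact: esym (alg_eval_var _).
have eaZ : alg_eval (a *: sym_var u) = a * phi u.
  transitivity (alg_eval (malgC a * sym_var u)).
    by congr (alg_eval _); exact: esym (monalg.mul_malgC _ _).
  by rewrite alg_evalM; congr (_ * _); [exact: alg_evalC | exact: alg_eval_var].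
rewrite alg_evalB; apply/eqP; rewrite subr_eq0; apply/eqP.
exact: etrans (alg_eval_var _) (etrans (linearZ_LR phi a u) (esym eaZ)).

Qed.

Definition sym_eval : {rmorphism sym_alg W -> K} := quot_lift alg_eval_rel.

Lemma sym_eval_scal c : sym_eval (sym_scal W c) = c.
Proof. by rewrite [LHS](quot_liftE alg_eval_rel) alg_evalC. Qed.
Lemma sym_eval_in w : sym_eval (sym_in w) = phi w.
Proof. by rewrite [LHS](quot_liftE alg_eval_rel) alg_eval_var. Qed.
End SymEval.

Section SymPolynomials.
Variables (K : numFieldType) (W : lmodType K).

Fact sym_alg_neq0 : (1 : sym_alg W) != 0.
Proof.
apply/eqP => e; have := congr1 (sym_eval (\0 : {linear W -> K^o})) e.
by rewrite rmorph1 rmorph0 => /eqP; rewrite oner_eq0.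
Qed.
HB.instance Definition _ := GRing.PzSemiRing_isNonZero.Build (sym_alg W) sym_alg_neq0.

Lemma sym_inD (u v : W) : sym_in (u + v) = sym_in u + sym_in v.
Proof.
rewrite /sym_in -rmorphD; apply/quot_mapP; rewrite -[_ - _]mul1r -[1 * _]addr0.
by apply: Ideal_genD; [left; exists u, v | exact: Ideal_gen0].
Qed.
Lemma sym_inZ a (u : W) : sym_in (a *: u) = sym_scal W a * sym_in u.
Proof.
have e : (malgC a : free_com_alg W) * sym_var u = a *: sym_var u by exact: monalg.mul_malgC.
rewrite /sym_in /sym_scal -rmorphM e; apply/quot_mapP.
rewrite -[_ - _]mul1r -[1 * _]addr0.
by apply: Ideal_genD; [right; exists a, u | exact: Ideal_gen0].
Qed.
Lemma sym_in_sum (I : Type) (r : seq I) (a : I -> K) (u : I -> W) :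
  sym_in (\sum_(i <- r) a i *: u i) = \sum_(i <- r) sym_scal W (a i) * sym_in (u i).
Proof.
have sym_in0 : sym_in (0 : W) = 0 by rewrite -(scale0r 0) sym_inZ rmorph0 mul0r.
by elim: r => [|i r IH]; rewrite ?big_nil // !big_cons sym_inD sym_inZ IH.
Qed.

Section Generators.
Variables (k : nat) (t : 'I_k -> W).

Definition sym_poly : {mpoly K[k]} -> sym_alg W := mmap (@sym_scal K W) (fun i => sym_in (t i)).
HB.instance Definition _ := GRing.RMorphism.copy sym_poly sym_poly.

Lemma sym_polyC c : sym_poly c%:MP = sym_scal W c. Proof. exact: mmapC. Qed.
Lemma sym_polyX i : sym_poly 'X_i = sym_in (t i).
Proof. by rewrite [LHS]mmapX mmap1U. Qed.

Lemma sym_polyM f g : sym_poly (f * g) = sym_poly f * sym_poly g.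
Proof. exact: (rmorphM sym_poly). Qed.
Lemma sym_polyD f g : sym_poly (f + g) = sym_poly f + sym_poly g.
Proof. exact: (rmorphD sym_poly). Qed.
Lemma sym_poly0 : sym_poly 0 = 0. Proof. exact: (rmorph0 sym_poly). Qed.
Lemma sym_polyZ c f : sym_poly (c *: f) = sym_scal W c * sym_poly f.
Proof. by rewrite -mul_mpolyC sym_polyM sym_polyC. Qed.
Lemma sym_poly_sum (I : Type) (r : seq I) (f : I -> {mpoly K[k]}) :
  sym_poly (\sum_(i <- r) f i) = \sum_(i <- r) sym_poly (f i).
Proof. exact: (rmorph_sum sym_poly). Qed.
Lemma sym_poly_prod (I : Type) (r : seq I) (f : I -> {mpoly K[k]}) :
  sym_poly (\prod_(i <- r) f i) = \prod_(i <- r) sym_poly (f i).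
Proof. exact: (rmorph_prod sym_poly). Qed.

Lemma sym_eval_poly (phi : {linear W -> K^o}) h :
  sym_eval phi (sym_poly h) = h.@[fun i => phi (t i)].
Proof.
elim/mpoly_ind: h => [a|i|f g IHf IHg|f g IHf IHg].
- by rewrite sym_polyC sym_eval_scal mevalC.
- by rewrite sym_polyX sym_eval_in mevalXU.
- rewrite (rmorphD sym_poly) mevalD -IHf -IHg; exact: (rmorphD (sym_eval phi)).
- rewrite (rmorphM sym_poly) mevalM -IHf -IHg; exact: (rmorphM (sym_eval phi)).
Qed.

(** Stands in for the theorem that Sym W is a polynomial ring: a polynomial h with sum z in the t i
    takes the value 0 at every c, so it is 0 already as a polynomial. *)
Lemma sym_poly_eq0 z : (exists h, z = sym_poly h) ->
  (forall c : 'I_k -> K, exists phi : {linear W -> K^o},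
     (forall i, phi (t i) = c i) /\ sym_eval phi z = 0) -> z = 0.
Proof.
move=> [h ->] z0; rewrite (_ : h = 0) ?rmorph0 //; apply: mpoly_eq0 => c.
have [phi [phic]] := z0 c; rewrite sym_eval_poly => <-.
by apply: meval_eq => i; rewrite phic.
Qed.
End Generators.
End SymPolynomials.

(** * Symbols of symmetric tensors *)

Section Symbols.
Variables (K : numClosedFieldType) (V : vectType K) (q : V -> K).
Hypotheses (quad_q : quadratic_form q) (nondeg_q : nondegenerate_quad q).
Local Notation B := (polar q).
Local Notation Q := (quadric q).
Local Notation point := (set_type Q).
Local Notation lam := (lam nondeg_q).
Local Notation tau := (tau quad_q nondeg_q).
Implicit Types (x y : point) (u v w c : V) (s : tensor_field Q).

Definition symb s x w : K := sym_eval (lam w : {linear tangent_space x -> K^o}) (s x).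

Lemma symbD s s' x w : symb (s + s') x w = symb s x w + symb s' x w.
Proof. exact: (rmorphD (sym_eval _)). Qed.
Lemma symbB s s' x w : symb (s - s') x w = symb s x w - symb s' x w.
Proof. exact: (rmorphB (sym_eval _)). Qed.
Lemma symbM s s' x w : symb (s * s') x w = symb s x w * symb s' x w.
Proof. exact: (rmorphM (sym_eval _)). Qed.
Lemma symb0 x w : symb 0 x w = 0.
Proof. exact: (rmorph0 (sym_eval _)). Qed.
Lemma symb_scal (a : K) x w : symb (scal_field a) x w = a.
Proof. exact: sym_eval_scal. Qed.
Lemma symb_in (D : vector_field Q) x w : symb (fun y => sym_in (D y)) x w = lam w (D x).
Proof. exact: sym_eval_in. Qed.

Lemma symbE (m p : nat) s x w (a : 'I_m -> K) (D : 'I_m -> 'I_p -> tangent_space x) :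
  s x = \sum_k sym_scal _ (a k) * \prod_i sym_in (D k i) ->
  symb s x w = \sum_k a k * \prod_i lam w (D k i).
Proof.
rewrite /symb => ->; set ev := sym_eval _.
rewrite (rmorph_sum ev); apply: eq_bigr => k _.
rewrite (rmorphM ev) (rmorph_prod ev); congr (_ * _); first exact: sym_eval_scal.
by apply: eq_bigr => i _; exact: sym_eval_in.
Qed.

(** Each s x is a polynomial in the basis of [tangent_basis], and the forms [lam w], for w in the
    span of the mu j, take arbitrary values on that basis. *)
Lemma symb_eq0 s : is_sym_tensor_sum s ->
  (forall x w, B (vec x) w = 0 -> symb s x w = 0) -> s = 0.
Proof.
move=> Ss s0; apply: functional_extensionality_dep => x.
have [k [mu [xmu [mumu DE]]]] := tangent_basis quad_q nondeg_q x.
apply: (@sym_poly_eq0 _ _ k (fun j => tau (xmu j))).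
  have sin D : sym_in D = sym_poly (fun j => tau (xmu j)) (\sum_j lam (mu j) D *: 'X_j).
    rewrite {1}(DE D) sym_in_sum sym_poly_sum; apply: eq_bigr => j _.
    by rewrite sym_polyZ sym_polyX.
  elim: Ss => [|p s1 s2 ps1 _ [h2 h2E]]; first by exists 0; rewrite sym_poly0.
  have [m [a [D /zariski_near_pt[_ _ s1E]]]] := ps1 x.
  exists (\sum_k (a k x)%:MP * (\prod_i \sum_j lam (mu j) (D k i x) *: 'X_j) + h2).
  rewrite sym_polyD -h2E [LHS]/(s1 x + s2 x) s1E sym_poly_sum; congr (_ + _).
  apply: eq_bigr => l _; rewrite sym_polyM sym_polyC sym_poly_prod; congr (_ * _).
  by apply: eq_bigr => i _; exact: sin.
move=> c; pose w := \sum_j c j *: mu j; exists (lam w : {linear tangent_space x -> K^o}).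
have xw : B (vec x) w = 0.
  by rewrite (polar_sumr quad_q) big1 // => j _; rewrite (polarZr quad_q) xmu mulr0.
split; last exact: s0.
move=> i; rewrite [LHS](lam_tau quad_q nondeg_q) // (polar_sumr quad_q) (bigD1 i) //= big1 => [|j ji].
  by rewrite (polarZr quad_q) mumu eqxx mulr1 addr0.
by rewrite (polarZr quad_q) mumu eq_sym (negPf ji) mulr0.
Qed.

Lemma symb_shift p s x w (t c : K) : is_sym_tensor p s ->
  symb s x (t *: w + c *: vec x) = t ^+ p * symb s x w.
Proof.
move=> ps; have [m [a [D /zariski_near_pt[_ _ sE]]]] := ps x.
rewrite !(symbE _ sE) big_distrr; apply: eq_bigr => k _ /=; rewrite mulrCA; congr (_ * _).
have -> : t ^+ p = \prod_(i < p) t by rewrite prodr_const card_ord.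
rewrite -big_split; apply: eq_bigr => i _ /=.
by rewrite (lam_lin quad_q) (lamZ quad_q) (lam_vec quad_q) mulr0 addr0.
Qed.

Lemma vec_inj x y (c : K) : vec x = c *: vec y -> x = y.
Proof.
have L z : val (val z) = <[vec z]>%VS :> {vspace V}.
  apply/esym/eqP; rewrite eqEdim -memvE memv_pick dim_vline vec_neq0.
  by case: (val z) => L /= /eqP->.
move=> e; apply: val_inj; apply: val_inj; rewrite [LHS]L [RHS]L e.
by apply/eqP; rewrite eqEdim -memvE memvZ ?memv_line //= !dim_vline -e !vec_neq0.
Qed.
End Symbols.

Lemma bihom_subst_homog (K : numFieldType) (n N : nat) (th : 'I_N -> {mpoly K[n + n]}) k l d h :
  (forall i, bihom k l (th i)) -> h \is d.-homog -> bihom (k *+ d) (l *+ d) (subst th h).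
Proof.
move=> tkl hd; rewrite [h]mpolyE rmorph_sum /= big_seq; apply: bihom_sum => mm mmh.
rewrite substZ; apply: bihomZ; rewrite subst_monom -(dhomogP _ _ _ hd _ mmh) /= mdegE.
apply: (big_ind2 (fun c (a : nat) => bihom (k *+ a) (l *+ a) c)) => [|c a c' a' ca ca'|i _].
- by rewrite -mpolyC1; exact: bihomC.
- by rewrite !mulrnDr; exact: bihomM.
- exact: bihomX.
Qed.

(** * Local polynomial formulas for symbols *)

Section Locality.
Variables (K : numClosedFieldType) (V : vectType K) (q : V -> K).
Hypotheses (quad_q : quadratic_form q) (nondeg_q : nondegenerate_quad q).
Local Notation B := (polar q).
Local Notation Q := (quadric q).
Local Notation point := (set_type Q).
Local Notation form := {mpoly K[\dim {:V}]}.
Local Notation fn := (point -> K).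
Local Notation lam := (lam nondeg_q).
Variables (m : nat) (e : 'I_m.+2 -> V).
Hypothesis fe : frame q e.
Local Notation n := m.+2.
Local Notation P := {mpoly K[n + n]}.
Local Notation co := (co q e).
Implicit Types (x y : point) (u v w c : V) (psi : point -> V -> K).

Definition pull : form -> P := subst (fun i => \sum_j cv (e j) i *: xv K j).

Lemma pull_eval g a b : (pull g).@[vf a b] = poly_fun g (span_pt e a).
Proof.
rewrite meval_subst poly_funE; apply: meval_eq => i.
rewrite raddf_sum cv_sum; apply: eq_bigr => j _ /=.
by rewrite mevalZ mevalXU vf_l cvZ mulrC.
Qed.
Lemma pull_bihom d g : g \is d.-homog -> bihom d 0 (pull g).
Proof.
move=> gd; apply: bihom_eq (bihom_subst_homog (k := 1) (l := 0) _ gd) => [||i]; rewrite ?natz ?mul0rn //.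
by apply: bihom_sum => j _; apply: bihomZ; exact: bihom_xv.
Qed.

Local Notation eval f x w := f.@[vf (fun i => co i (vec x)) (fun i => co i w)].

Lemma pull_vec g x w : eval (pull g) x w = poly_fun g (vec x).
Proof. by rewrite pull_eval -fe.2. Qed.

(** The denominator is cleared so that the formula can be required at all points of Q and not only
    near x. It does not involve w, and the numerator exceeds it by bidegree (p, p), as [extension]
    expects. *)
Definition Loc x p psi := exists (d : nat) (g : form) (f : P),
  [/\ g \is d.-homog, poly_fun g (vec x) != 0, bihom (d + p)%N p f
    & forall y w, B (vec y) w = 0 -> poly_fun g (vec y) * psi y w = eval f y w].

(** Multiplying by the form h that cuts out the neighbourhood makes the formula trivial outside
    it. *)
Lemma Loc_near x p psi psi' : zariski_near x (fun y => forall w, B (vec y) w = 0 -> psi' y w = psi y w) ->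
  Loc x p psi -> Loc x p psi'.
Proof.
move=> [h [d' [hd' hx hE]]] [d [g [f [gd gx fd gf]]]].
exists (d' + d)%N, (h * g), (pull h * f); split.
- exact: dhomogM.
- by rewrite poly_funM mulf_neq0.
- by apply: bihom_eq (bihomM (pull_bihom hd') fd) => //; lia.
move=> y w yw; rewrite mevalM pull_vec -gf // poly_funM.
have [->|hy] := eqVneq (poly_fun h (vec y)) 0; first by rewrite !mul0r.
by rewrite (hE y hy w yw) mulrA.
Qed.

Lemma LocM x p p' psi psi' : Loc x p psi -> Loc x p' psi' ->
  Loc x (p + p')%N (fun y w => psi y w * psi' y w).
Proof.
move=> [d [g [f [gd gx fd gf]]]] [d' [g' [f' [gd' gx' fd' gf']]]].
exists (d + d')%N, (g * g'), (f * f'); split.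
- exact: dhomogM.
- by rewrite poly_funM mulf_neq0.
- by apply: bihom_eq (bihomM fd fd') => //; lia.
by move=> y w yw; rewrite mevalM -gf // -gf' // poly_funM mulrACA.
Qed.

Lemma LocD x p psi psi' : Loc x p psi -> Loc x p psi' ->
  Loc x p (fun y w => psi y w + psi' y w).
Proof.
move=> [d [g [f [gd gx fd gf]]]] [d' [g' [f' [gd' gx' fd' gf']]]].
exists (d + d')%N, (g * g'), (pull g' * f + pull g * f'); split.
- exact: dhomogM.
- by rewrite poly_funM mulf_neq0.
- apply: bihomD; first by apply: bihom_eq (bihomM (pull_bihom gd') fd) => //; lia.
  by apply: bihom_eq (bihomM (pull_bihom gd) fd') => //; lia.
move=> y w yw; rewrite mevalD !mevalM !pull_vec -gf // -gf' // poly_funM; ring.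
Qed.

Lemma Loc_poly x (p : nat) (f : P) : bihom p p f -> Loc x p (fun y w => eval f y w).
Proof.
move=> fp; exists 0%N, 1, f; split => //; first exact: dhomog1.
  by rewrite poly_funE meval1 oner_neq0.
by move=> y w _; rewrite poly_funE meval1 mul1r.
Qed.

Lemma Loc_sum x p (I : Type) (r : seq I) (psi : I -> point -> V -> K) :
  (forall i, Loc x p (psi i)) -> Loc x p (fun y w => \sum_(i <- r) psi i y w).
Proof.
move=> L; elim: r => [|i r IH].
  apply: (@Loc_near _ _ (fun y w => eval (0 : P) y w)); last by apply: Loc_poly; exact: bihom0.
  by apply: zariski_nearT => y w _; rewrite big_nil meval0.
by apply: Loc_near (LocD (L i) IH); apply: zariski_nearT => y w _; rewrite big_cons.
Qed.

Lemma Loc_prod x p (psi : 'I_p -> point -> V -> K) :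
  (forall i, Loc x 1 (psi i)) -> Loc x p (fun y w => \prod_i psi i y w).
Proof.
elim: p psi => [|p IH] psi L.
  apply: (@Loc_near _ _ (fun y w => eval (1%:MP : P) y w)); last by apply: Loc_poly; exact: bihomC.
  by apply: zariski_nearT => y w _; rewrite big_ord0 mevalC.
apply: Loc_near (LocM (L ord0) (IH _ (fun i => L (lift ord0 i)))).
by apply: zariski_nearT => y w _; rewrite big_ord_recl.
Qed.

Lemma Loc_regular x (F : fn) : regular_at F x -> Loc x 0 (fun y _ => F y).
Proof.
move=> /regular_rep[f [g [d [fd gd r]]]]; have [gx _] := zariski_near_pt r.
apply: (@Loc_near _ _ (fun y w => poly_fun f (vec y) / poly_fun g (vec y))).
  by apply: zariski_nearW r => y [_ Fy] w _.
have [h [d' [hd' hx hE]]] := r.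
exists (d' + d)%N, (h * g), (pull (h * f)); split.
- exact: dhomogM.
- by rewrite poly_funM mulf_neq0.
- by apply: bihom_eq (pull_bihom (dhomogM hd' fd)) => //; lia.
move=> y w _; rewrite pull_vec !poly_funM.
have [->|hy] := eqVneq (poly_fun h (vec y)) 0; first by rewrite !mul0r.
have [gy _] := hE _ hy; rewrite hvalE in gy.
by rewrite mulrACA divff // mulr1.
Qed.

Lemma Loc_field x (D : vector_field Q) : regular_field_at D x ->
  Loc x 1 (fun y w => lam w (D y) : K).
Proof.
move=> rD; have xc := cxP nondeg_q x; set c := cx nondeg_q x in xc.
pose f i : P := pull (linform (polarl q c)) * yv K i.
(* One denominator c serves all points near x, by [lamE]. Expanding w in the frame leaves the
   derivatives of the fixed functions [rat c (e i)], which are regular because D is. *)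
apply: (@Loc_near x 1 (fun y w => \sum_i eval (f i) y w * D y (rat (q := q) c (e i)))); last first.
  apply: (@Loc_sum x 1) => i; apply: (@LocM x 1 0); last by apply/Loc_regular/rD; exact: regular_rat.
  apply: Loc_poly; apply: bihom_eq (bihomM (pull_bihom (linform_homog _)) (bihom_yv i)) => //.
apply: zariski_nearW (zariski_near_polar quad_q xc) => y yc w yw.
rewrite (lamE quad_q nondeg_q _ yc yw).
have r u : regular_at (rat (q := q) c u) y by exact: regular_rat.
have [_ Dsum] := @tangent_sum _ _ _ _ (D y) _ (index_enum 'I_n) (fun i => co i w)
  (fun i => rat (q := q) c (e i)) (fun i => r (e i)).
have -> : rat (q := q) c w = (fun y => \sum_i co i w * rat (q := q) c (e i) y).
  apply/funext => z; rewrite /rat {1}(fe.2 w) (polar_sumr quad_q) big_distrl.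
  by apply: eq_bigr => i _; rewrite (polarZr quad_q) /= -mulrA.
rewrite Dsum big_distrr; apply: eq_bigr => i _ /=.
rewrite mevalM pull_vec mevalXU vf_r poly_fun_linform /polarl; last exact: polarl_is_linear.
by rewrite mulrA.
Qed.

Lemma Loc_symb x p (s : tensor_field Q) : is_sym_tensor p s -> Loc x p (symb nondeg_q s).
Proof.
move=> ps; have [k [a [D near]]] := ps x; have [ra rD _] := zariski_near_pt near.
apply: (@Loc_near _ _ (fun y w => \sum_k a k y * \prod_i lam w (D k i y))).
  by apply: zariski_nearW near => y [_ _ sE] w _; exact: symbE sE.
apply: Loc_sum => j; apply: (@LocM x 0 p); first exact: Loc_regular.
by apply: Loc_prod => i; apply: Loc_field.
Qed.
End Locality.

(** * Symbols are forms in the Pluecker coordinates *)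

Section Pluecker.
Variables (K : numFieldType) (V : vectType K).
Local Notation X i := ((vbasis {:V})`_i).

Lemma pluecker_form (l l' : V -> K) : linear (l : V -> K^o) -> linear (l' : V -> K^o) ->
  exists L : {mpoly K[\dim {:ext2 V}]}, L \is 1.-homog /\
    forall v w, poly_fun L (wedge v w) = l v * l' w - l' v * l w.
Proof.
move=> ll ll'; pose G i j := l (X i) * l' (X j) - l (X j) * l' (X i).
pose t (eta : ext2 V) : K := \sum_p eta p * G (val p).1 (val p).2.
have lt : linear (t : ext2 V -> K^o).
  move=> a u v; rewrite -[RHS]/(a * t u + t v) big_distrr -big_split; apply: eq_bigr => p _ /=.
  have -> : (a *: u + v) p = a * u p + v p by rewrite !ffunE.
  by rewrite mulrDl mulrA.
exists (linform t); split; first exact: linform_homog.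
have lE (k : V -> K) (lk : linear (k : V -> K^o)) v : k v = \sum_i cv v i * k (X i).
  by rewrite -(poly_fun_linform lk) poly_funE raddf_sum; apply: eq_bigr => i _;
    rewrite /= mevalZ mevalXU mulrC.
move=> v w; rewrite poly_fun_linform //.
transitivity (\sum_i \sum_j cv v i * cv w j * G i j).
  rewrite -sum_pairs => [|i|i j]; first by apply: eq_bigr => p _; rewrite ffunE.
    by rewrite /G subrr.
  by rewrite /G opprB.
rewrite sum_minor -(lE l ll) -(lE l' ll') -(lE l ll) -(lE l' ll').
by rewrite (mulrC (l w)).
Qed.
End Pluecker.

Section Sections.
Variables (K : numClosedFieldType) (V : vectType K) (q : V -> K).
Hypotheses (quad_q : quadratic_form q) (nondeg_q : nondegenerate_quad q).
Local Notation B := (polar q).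
Local Notation Q := (quadric q).
Local Notation point := (set_type Q).
Variables (m : nat) (e : 'I_m.+2 -> V).
Hypothesis fe : frame q e.
Local Notation n := m.+2.
Local Notation P := {mpoly K[n + n]}.
Local Notation co := (co q e).
Local Notation pt := (span_pt e).
Implicit Types (x y : point) (u v w c : V).

Lemma frame_dim : (\dim {:V} <= m.+2)%N.
Proof.
have : (fullv <= <<map e (enum 'I_m.+2)>>)%VS.
  apply/subvP => v _; rewrite (fe.2 v); apply: memv_suml => i _; apply: memvZ.
  by apply: memv_span; apply: map_f; rewrite mem_enum.
move/dimvS/leq_trans; apply; apply: leq_trans (dim_span _) _.
by rewrite size_map size_enum_ord.
Qed.

Lemma pt_linear (s : K) (a b : 'I_n -> K) : pt (fun i => s * a i + b i) = s *: pt a + pt b.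
Proof. by rewrite /pt scaler_sumr -big_split; apply: eq_bigr => i _; rewrite scalerDl scalerA. Qed.
Lemma ptZ (s : K) (a : 'I_n -> K) : pt (fun i => s * a i) = s *: pt a.
Proof. by rewrite /pt scaler_sumr; apply: eq_bigr => i _; rewrite scalerA. Qed.
Lemma coK a i : co i (pt a) = a i. Proof. exact: (co_pt quad_q fe.1). Qed.

Lemma incident_point a b : incident a b ->
  exists x t, [/\ t != 0, pt a = t *: vec x & B (vec x) (pt b) = 0].
Proof.
move=> [[i ai] qa ab]; have a0 : pt a != 0.
  apply: contra_neq ai => a0; rewrite -(coK a) a0.
  by rewrite -(scale0r 0) (coZ quad_q) mul0r.
have [x [t [t0 xt]]] : exists x t, t != 0 /\ pt a = t *: vec x.
  by apply: (vec_surj quad_q) => //; rewrite (quad_pt quad_q fe.1).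
exists x, t; split=> //; have := polar_pt quad_q fe.1 a b.
by rewrite ab xt (polarZl quad_q) => /eqP; rewrite mulf_eq0 pnatr_eq0 (mulf_eq0 t) (negPf t0) => /eqP.
Qed.

Lemma point_incident x w : B (vec x) w = 0 -> incident (co^~ (vec x)) (co^~ w).
Proof.
move=> xw; have vE := fe.2 (vec x); split.
- apply: contrapT => no; case/eqP: (vec_neq0 x); rewrite vE /span_pt big1 // => i _.
  by case: (eqVneq (co i (vec x)) 0) => [->|ci]; [rewrite scale0r | case: no; exists i].
- by rewrite -(quad_pt quad_q fe.1) -vE quad_vec.
- by rewrite -(polar_pt quad_q fe.1) -vE -fe.2 xw mulr0.
Qed.
Hypothesis m_gt0 : (0 < m)%N.

(** By [minor_ind] only multiplication by a minor has to be treated, and a minor of frame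
    coordinates is a linear form in the Pluecker coordinates. *)
Lemma invariant_form (p : nat) (h : P) : bihom p p h -> opE h = 0 ->
  exists G : {mpoly K[\dim {:ext2 V}]}, G \is p.-homog /\
    forall a b, h.@[vf a b] = poly_fun G (wedge (pt a) (pt b)).
Proof.
move: p h; apply: (minor_ind (S := fun (p : nat) (h : P) => exists G : {mpoly K[\dim {:ext2 V}]}, G \is p.-homog /\
    forall a b, h.@[vf a b] = poly_fun G (wedge (pt a) (pt b)))).
- move=> c; exists c%:MP; split=> [|a b]; last by rewrite poly_funE !mevalC.
  by rewrite -[c%:MP]mulr1 mul_mpolyC rpredZ ?dhomog1.
- by move=> p; exists 0; split=> [|a b]; [exact: rpred0 | rewrite poly_funE !meval0].
- move=> p g h [G [Gp GE]] [H [Hp HE]]; exists (G + H).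
  by split=> [|a b]; [exact: rpredD | rewrite mevalD poly_funD GE HE].
move=> p c i j g [G [Gp GE]].
have col i' : linear (co i' : V -> K^o).
  by move=> a u v; rewrite (coD quad_q) (coZ quad_q).
have [L [L1 LE]] := pluecker_form (col i) (col j).
exists (c *: (L * G)); split; first by apply: rpredZ; exact: (dhomogM L1 Gp).
move=> a b; rewrite mevalZ mevalM poly_funZ poly_funM -GE LE !coK; congr (_ * (_ * _)).
by rewrite mevalB !mevalM !mevalXU !vf_l !vf_r.
Qed.

Lemma symb_form p (s : tensor_field Q) : is_sym_tensor p s ->
  exists G : {mpoly K[\dim {:ext2 V}]}, G \is p.-homog /\
    forall x w, B (vec x) w = 0 -> symb nondeg_q s x w = poly_fun G (wedge (vec x) w).
Proof.
move=> ps; pose F := symb nondeg_q s.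
have Fc x w (t c : K) : F x (t *: w + c *: vec x) = t ^+ p * F x w.
  exact: (symb_shift quad_q nondeg_q).
(* The vectors [vec x] are arbitrary choices, so F is spread over the cone: at a = t [vec x] the
   value is t ^ p F(x, b), of degree p in a. At all other a the relation is void and any value will
   do. *)
pose R a b z := forall x t, t != 0 -> pt a = t *: vec x -> z = t ^+ p * F x (pt b).
have exR a b : exists z, R a b z.
  have [[x [t [t0 xt]]]|no] := pselect (exists x t, t != 0 /\ pt a = t *: vec x); last first.
    by exists 0 => x t t0 xt; case: no; exists x, t.
  exists (t ^+ p * F x (pt b)) => x' t' t'0 xt'.
  have xx' : x = x'.
    apply: (@vec_inj _ _ _ x x' (t' / t)); apply: (scalerI t0).
    by rewrite scalerA mulrC divfK // -xt -xt'.
  subst x'; have /eqP : t *: vec x = t' *: vec x by rewrite -xt.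
  by rewrite -subr_eq0 -scalerBl scaler_eq0 (negPf (vec_neq0 x)) orbF subr_eq0 => /eqP->.
pose phi a b := sval (cid (exR a b)).
have phiE a b : R a b (phi a b) := svalP (cid (exR a b)).
have [|||h [hp Eh hE]] := @extension K m m_gt0 p phi.
- move=> s' t' a b s0 t0 /incident_point[x [t [tn xt _]]].
  rewrite (phiE a b x t tn xt) (phiE _ _ x (s' * t)); first last.
  + by rewrite ptZ xt scalerA.
  + by rewrite mulf_neq0.
  have := Fc x (pt b) t' 0; rewrite scale0r addr0 ptZ => ->.
  by rewrite exprMn; ring.
- move=> c a b /incident_point[x [t [tn xt _]]].
  rewrite (phiE a b x t tn xt) (phiE _ _ x t tn xt); congr (_ * _).
  have -> : pt (fun i => b i + c * a i) = 1 *: pt b + (c * t) *: vec x.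
    rewrite scale1r -scalerA -xt addrC -pt_linear; congr span_pt.
    by apply/funext => i; rewrite addrC.
  by rewrite Fc expr1n mul1r.
- move=> a0 b0 /incident_point[x [t [tn xt _]]].
  have [d [g [f [gd gx fd gf]]]] := Loc_symb quad_q nondeg_q fe x ps.
  exists d, (pull e g), f; split => //.
  + exact: pull_bihom.
  + by rewrite pull_eval xt (poly_fun_homog _ _ gd) mulf_neq0 // expf_neq0.
  move=> a b /incident_point[y [r [r0 yr yb]]].
  rewrite pull_eval yr (poly_fun_homog _ _ gd) (phiE a b y r r0 yr).
  have := gf _ _ yb; rewrite -/F => gfE.
  transitivity (r ^+ (d + p) * (poly_fun g (vec y) * F y (pt b))); first by rewrite exprD; ring.
  rewrite gfE; have := eval_scale r 1 (fun i => co i (vec y)) (fun i => co i (pt b)) fd.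
  rewrite expr1n mulr1 => <-; apply: meval_eq => i.
  case: (splitl i) => -[j ->]; rewrite ?vf_l ?vf_r ?mul1r ?coK //.
  by rewrite -(coZ quad_q) -yr coK.
have [G [Gp GE]] := invariant_form hp Eh.
exists G; split=> // x w xw; have xwI := point_incident xw.
have := hE _ _ xwI; rewrite GE -!fe.2 => <-.
by rewrite (phiE _ _ x 1) ?oner_neq0 // ?scale1r -?fe.2 // expr1n mul1r.
Qed.
End Sections.

(** * Tensors with a given symbol *)

Section Wedge.
Variables (K : fieldType) (V : vectType K).
Implicit Types (u v w : V).

Lemma wedge_linl a u v w : wedge (a *: u + v) w = a *: wedge u w + wedge v w.
Proof.
apply/ffunP => p; have -> : (a *: wedge u w + wedge v w) p = a * wedge u w p + wedge v w p.
  by rewrite !ffunE.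
by rewrite !ffunE !linearP /=; ring.
Qed.
Lemma wedge_anti v w : wedge v w = - wedge w v.
Proof. by apply/ffunP => p; rewrite !ffunE; ring. Qed.
Lemma wedgevv v : wedge v v = 0.
Proof. by apply/ffunP => p; rewrite !ffunE; ring. Qed.
Lemma wedge_linr a u v w : wedge w (a *: u + v) = a *: wedge w u + wedge w v.
Proof. by rewrite wedge_anti wedge_linl opprD -scalerN -!wedge_anti. Qed.
Lemma wedge0l w : wedge 0 w = 0.
Proof. by apply/ffunP => p; rewrite !ffunE !linear0; ring. Qed.
Lemma wedgeZl a v w : wedge (a *: v) w = a *: wedge v w.
Proof. by rewrite -[a *: v]addr0 wedge_linl wedge0l addr0. Qed.
Lemma wedgeZr a v w : wedge v (a *: w) = a *: wedge v w.
Proof. by rewrite wedge_anti wedgeZl -scalerN -wedge_anti. Qed.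
Lemma wedge_suml (I : Type) (r : seq I) (a : I -> K) (f : I -> V) w :
  wedge (\sum_(i <- r) a i *: f i) w = \sum_(i <- r) a i *: wedge (f i) w.
Proof.
by elim: r => [|i r IH]; rewrite ?big_nil ?wedge0l // !big_cons wedge_linl IH.
Qed.
Lemma wedge_sumr (I : Type) (r : seq I) (a : I -> K) (f : I -> V) w :
  wedge w (\sum_(i <- r) a i *: f i) = \sum_(i <- r) a i *: wedge w (f i).
Proof.
by rewrite wedge_anti wedge_suml -sumrN; apply: eq_bigr => i _; rewrite -scalerN -wedge_anti.
Qed.

Lemma wedge_free v w : wedge v w != 0 -> free [:: v; w].
Proof.
apply: contraR; rewrite free_cons seq1_free negb_and negbK negbK span_seq1.
move=> /orP[/vlineP[k ->]|/eqP->]; first by rewrite wedgeZl wedgevv scaler0.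
by rewrite wedge_anti wedge0l oppr0.
Qed.

Lemma wedge_neq0 : (1 < \dim {:V})%N -> exists v w, wedge v w != 0 :> ext2 V.
Proof.
move=> d1; pose i : 'I_(\dim {:V}) := Ordinal (ltnW d1); pose j := Ordinal d1.
exists (vbasis {:V})`_i, (vbasis {:V})`_j.
have cE (k l : 'I_(\dim {:V})) : coord (vbasis {:V}) k (vbasis {:V})`_l = (l == k)%:R.
  by rewrite coord_free ?(basis_free (vbasisP _)).
apply/eqP => /ffunP/(_ (exist _ (i, j) (erefl true : ((i, j).1 < (i, j).2)%N))).
rewrite ffunE [X in X = _](_ : _ = 1) => [|]; last first.
  rewrite -[LHS]/(coord (vbasis {:V}) i (vbasis {:V})`_i * coord (vbasis {:V}) j (vbasis {:V})`_j -
    coord (vbasis {:V}) j (vbasis {:V})`_i * coord (vbasis {:V}) i (vbasis {:V})`_j).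
  by rewrite !cE !eqxx (_ : (i == j) = false) // mulr1 mul0r subr0.
by rewrite ffunE => /eqP; rewrite oner_eq0.
Qed.
End Wedge.

Section Isotropic.
Variables (K : numClosedFieldType) (V : vectType K) (q : V -> K).
Hypotheses (quad_q : quadratic_form q).

Lemma isotropic_exists : (1 < \dim {:V})%N -> exists v, v != 0 /\ q v = 0.
Proof.
move=> /wedge_neq0[v [w vw]]; have v0 : v != 0.
  by apply: contraNneq vw => ->; rewrite wedge0l.
have [qv|qv] := eqVneq (q v) 0; first by exists v.
pose u := w - (polar q w v / q v) *: v.
have uv : polar q u v = 0.
  rewrite (polarBl quad_q) (polarZl quad_q) (polar_vv quad_q).
  have fm (p t : K) : t != 0 -> p - p / t * t = 0 by move=> t0; rewrite divfK // subrr.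
  exact: fm.
have u0 : u != 0.
  apply: contraNneq vw => u0; have -> : w = (polar q w v / q v) *: v.
    by apply/eqP; rewrite -subr_eq0 -/u u0.
  by rewrite wedgeZr wedgevv scaler0.
have [qu|qu] := eqVneq (q u) 0; first by exists u.
(* As u is orthogonal to v, the coefficient s has to satisfy q v + s ^ 2 q u = 0. *)
exists (v + sqrtC (- q v / q u) *: u); split.
  apply: contraNneq qv => e; rewrite -(polar_vv quad_q).
  have := congr1 (fun z => polar q z v) e.
  by rewrite /= (polarDl quad_q) (polarZl quad_q) uv mulr0 addr0 (polar0l quad_q) => ->.
rewrite quadD (quadZ quad_q) sqrtCK (polarZr quad_q) (polarC q v) uv !mulr0 addr0.
by rewrite divfK // subrr.
Qed.
End Isotropic.

Section TensorsOfForms.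
Variables (K : numClosedFieldType) (V : vectType K) (q : V -> K).
Hypotheses (quad_q : quadratic_form q) (nondeg_q : nondegenerate_quad q).
Local Notation B := (polar q).
Local Notation Q := (quadric q).
Local Notation point := (set_type Q).
Local Notation eform := {mpoly K[\dim {:ext2 V}]}.
Implicit Types (x y : point) (u v w c : V) (s : tensor_field Q) (G : eform).

Definition represents s G := forall x w, B (vec x) w = 0 ->
  symb nondeg_q s x w = poly_fun G (wedge (vec x) w).

Lemma is_sym_tensorD p s s' : is_sym_tensor p s -> is_sym_tensor p s' -> is_sym_tensor p (s + s').
Proof.
move=> Hs Ht; apply: is_sym_tensor_fin => x.
have [m [a [D aD]]] := Hs x; have [n [b [E bE]]] := Ht x.
exists ('I_m + 'I_n)%type, (fun k => match k with inl i => a i | inr i => b i end),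
  (fun k => match k with inl i => D i | inr i => E i end).
apply: zariski_nearW (zariski_near_and aD bE) => y [[ra rD sE] [rb rE tE]].
by split=> [[]//|[]//|]; rewrite big_sumType -tE -sE.
Qed.

Lemma is_sym_tensor0 p : is_sym_tensor p (0 : tensor_field Q).
Proof.
move=> x; exists 0%N, (fun=> fun=> 0), (fun _ _ _ => 0).
by apply: zariski_nearT => y; split=> [[]//|[]//|]; rewrite big_ord0.
Qed.

Definition liftable p G := exists s, is_sym_tensor p s /\ represents s G.

Lemma liftable0 p : liftable p 0.
Proof.
exists 0; split; first exact: is_sym_tensor0.
by move=> x w _; rewrite symb0 poly_funE meval0.
Qed.
Lemma liftableD p G H : liftable p G -> liftable p H -> liftable p (G + H).
Proof.
move=> [s [ps sG]] [t [pt tH]]; exists (s + t); split; first exact: is_sym_tensorD.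
by move=> x w xw; rewrite symbD poly_funD sG // tH.
Qed.
Lemma liftableM p r G H : liftable p G -> liftable r H -> liftable (p + r) (G * H).
Proof.
move=> [s [ps sG]] [t [pt tH]]; exists (s * t); split; first exact: is_sym_tensorM.
by move=> x w xw; rewrite symbM poly_funM sG // tH.
Qed.
Lemma liftableC (a : K) : liftable 0 a%:MP.
Proof.
exists (scal_field a); split; first exact: is_sym_tensor_scal.
by move=> x w _; rewrite symb_scal poly_funE mevalC.
Qed.

Lemma liftableX (x0 : point) i : liftable 1 'X_i.
Proof.
pose l v w : K := cv (wedge v w) i.
have H j : {c | forall w, l (vbasis {:V})`_j w = B w c}.
  apply/cid/(lin_repr quad_q nondeg_q _ x0) => a u v.
  by rewrite /l wedge_linr cvD cvZ.
(* N is determined by the condition that B (N v) w be the i-th coordinate of v wedge w; it is skew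
   because the wedge is alternating. *)
pose N0 v : V := \sum_j cv v j *: sval (H j).
have N0lin : linear N0.
  move=> a u v; rewrite /N0 scaler_sumr -big_split; apply: eq_bigr => j _.
  by rewrite cvD cvZ scalerDl scalerA.
pose N := HB.pack_for {linear V -> V} N0 (GRing.isLinear.Build K V V _ N0 N0lin).
have NE v w : B (N v) w = l v w.
  rewrite [N v]/(N0 v) (polar_suml quad_q) /l {2}(cv_vec v) wedge_suml cv_sum.
  apply: eq_bigr => j _; rewrite (polarZl quad_q) (polarC q _ w) -(svalP (H j)).
  by rewrite cvZ.
have Nskew v : B v (N v) = 0.
  by rewrite (polarC q) NE /l wedgevv /cv linear0.
pose D := field_of quad_q nondeg_q Nskew.
exists (fun x => sym_in (D x)); split.
  apply: is_sym_tensor_fin => x; exists unit, (fun=> fun=> 1), (fun _ _ => D).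
  apply: zariski_nearT => y; split=> [_|_ _|]; first exact: regular_at_cst.
    exact: regular_field_of.
  by rewrite (big_pred1 tt) => [|[]//]; rewrite rmorph1 mul1r big_ord1.
by move=> x w xw; rewrite symb_in lam_field_of // NE poly_funE mevalXU.
Qed.

Lemma liftable_homog (x0 : point) p G : G \is p.-homog -> liftable p G.
Proof.
move=> Gp; rewrite [G]mpolyE big_seq; apply: (big_ind (liftable p)).
- exact: liftable0.
- exact: liftableD.
move=> mm mmG; rewrite -mul_mpolyC; apply: (@liftableM 0 p); first exact: liftableC.
rewrite -(dhomogP _ _ _ Gp _ mmG) /= mdegE mpolyXE_id.
apply: (big_ind2 (fun (a : nat) G => liftable a G)) => [||i _].
- by rewrite -mpolyC1; exact: liftableC.
- by move=> *; exact: liftableM.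
elim: (mm i) => [|k IH]; first by rewrite expr0 -mpolyC1; exact: liftableC.
by rewrite exprS; apply: (@liftableM 1 k) IH; exact: liftableX.
Qed.
End TensorsOfForms.

(** * Forms with zero symbol *)

Lemma pihomog_eval_eq0 (K : numFieldType) N (G : {mpoly K[N]}) v d :
  (forall t, t != 0 -> G.@[fun i => t * v i] = 0) -> (pihomog mdeg d G).@[v] = 0.
Proof.
move=> G0; rewrite pihomogE raddf_sum /=; under eq_bigr do rewrite mevalZ.
apply: (coef_poly_scale (d := mdeg (n := N))) => s s0; rewrite mul0r -[RHS](G0 s s0).
rewrite [RHS](congr1 (meval _) (mpolyE G)) raddf_sum; apply: eq_bigr => mm _ /=.
rewrite mevalZ (@meval_homog _ _ (mdeg mm)); last by rewrite dhomogX.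
by rewrite -mulrA [X in _ * X]mulrC.
Qed.

Section Kernel.
Variables (K : numClosedFieldType) (V : vectType K) (q : V -> K).
Hypotheses (quad_q : quadratic_form q) (nondeg_q : nondegenerate_quad q).
Local Notation B := (polar q).
Local Notation Q := (quadric q).
Local Notation point := (set_type Q).
Local Notation eform := {mpoly K[\dim {:ext2 V}]}.
Local Notation Z := (grassmannian2 V).
Local Notation Delta := (ext2_quadric q).
Implicit Types (x y : point) (u v w c : V) (G H : eform).

Definition proj_class G : quot_ring [set coord_class Z Delta] :=
  quot_map [set coord_class Z Delta] (quot_map (vanishing_forms Z) G).

Lemma proj_classD G H : proj_class (G + H) = proj_class G + proj_class H.
Proof. by rewrite /proj_class !rmorphD. Qed.
Lemma proj_classB G H : proj_class (G - H) = proj_class G - proj_class H.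
Proof. by rewrite /proj_class !rmorphB. Qed.
Lemma proj_classM G H : proj_class (G * H) = proj_class G * proj_class H.
Proof. by rewrite /proj_class !rmorphM. Qed.
Lemma proj_class_sum (I : Type) (r : seq I) (F : I -> eform) :
  proj_class (\sum_(i <- r) F i) = \sum_(i <- r) proj_class (F i).
Proof. by rewrite /proj_class !rmorph_sum. Qed.
Lemma proj_class_surj z : exists G, z = proj_class G.
Proof.
exists (repr (repr z)); rewrite /proj_class quot_map_repr; exact: esym (quot_map_repr z).
Qed.

Lemma vanishing_form_wedge G : (1 < \dim {:V})%N -> vanishing_forms Z G ->
  forall v w, poly_fun G (wedge v w) = 0.
Proof.
move=> d1 [d [Gd G0]].
have H v w : wedge v w != 0 -> poly_fun G (wedge v w) = 0.
  move=> vw; have dL : \dim <[wedge v w]> == 1%N by rewrite dim_vline vw.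
  pose L : proj (ext2 V) := exist _ <[wedge v w]>%VS dL.
  have /G0 : Z L by exists v, w; split=> //; exact: wedge_free.
  rewrite /hval; set u := vpick _.
  have u0 : u != 0 by rewrite vpick0 -dimv_eq0 (eqP dL).
  have /vlineP[k uE] : u \in <[wedge v w]>%VS by exact: memv_pick.
  rewrite uE (poly_fun_homog _ _ Gd) => /eqP; rewrite mulf_eq0 expf_eq0.
  rewrite (negPf (_ : k != 0)) ?andbF => [/eqP //|].
  by apply: contraNneq u0 => k0; rewrite uE k0 scale0r.
move=> v w; have [->|] := eqVneq (wedge v w) 0; last exact: H.
(* The zero bivector is 0 times a nonzero one, an argument that also covers forms of degree 0. *)
have [v' [w' vw']] := wedge_neq0 d1.
by rewrite -(scale0r (wedge v' w')) (poly_fun_homog _ _ Gd) H // mulr0.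
Qed.

(** Evaluation at x wedge w kills the ideal of the Grassmannian and also the quadric, because q(x) =
    B(x, w) = 0; so it factors through both quotients. *)
Lemma proj_class_eval G x w : (1 < \dim {:V})%N -> B (vec x) w = 0 ->
  proj_class G = 0 -> poly_fun G (wedge (vec x) w) = 0.
Proof.
move=> d1 xw; pose ev : {rmorphism eform -> K} := meval (cv (wedge (vec x) w)).
have ev0 (H : eform) : vanishing_forms Z H -> ev H = 0.
  by move=> ZH; exact: (vanishing_form_wedge d1 ZH).
pose ev1 := quot_lift ev0.
have evD : forall z, [set coord_class Z Delta] z -> ev1 z = 0.
  move=> _ ->; rewrite [LHS](quot_liftE ev0).
  rewrite -[LHS]/(poly_fun Delta (wedge (vec x) w)) ext2_quadric_wedge //.
    by rewrite quad_vec xw mul0r expr0n subr0.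
  by rewrite pnatr_eq0.
pose ev2 := quot_lift evD.
move=> /(congr1 ev2); rewrite rmorph0 [X in X = _](quot_liftE evD) => <-.
by rewrite [RHS](quot_liftE ev0).
Qed.

Lemma ext2_quadric_homog : Delta \is 2.-homog.
Proof.
have X1 i : ('X_i : eform) \is 1.-homog by rewrite dhomogX /= mdeg1.
apply: rpred_sum => i _; apply: rpred_sum => j _; apply: rpredZ.
exact: dhomogM (X1 i) (X1 j).
Qed.

Section Frame.
Variables (m : nat) (e : 'I_m.+2 -> V).
Hypotheses (fe : frame q e) (m_gt0 : (0 < m)%N).
Local Notation n := m.+2.
Local Notation P := {mpoly K[n + n]}.
Local Notation pt := (span_pt e).

Definition wedge_poly i : P := \sum_j \sum_k cv (wedge (e j) (e k)) i *: (xv K j * yv K k).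

Lemma wedge_poly_eval i a b : (wedge_poly i).@[vf a b] = cv (wedge (pt a) (pt b)) i.
Proof.
rewrite wedge_suml cv_sum raddf_sum; apply: eq_bigr => j _ /=.
rewrite cvZ wedge_sumr cv_sum raddf_sum big_distrr; apply: eq_bigr => k _ /=.
by rewrite cvZ mevalZ mevalM !mevalXU vf_l vf_r; ring.
Qed.

(** On a polynomial linear in x and in y the operator E substitutes x for y, and x wedge x = 0. *)
Lemma wedge_poly_invariant G : opE (subst wedge_poly G) = 0.
Proof.
have opEW i : opE (wedge_poly i) = 0.
  have -> : opE (wedge_poly i) = subst (vf (xv K (n := n)) (xv K (n := n))) (wedge_poly i).
    rewrite linear_sum [RHS]rmorph_sum; apply: eq_bigr => j _ /=.
    rewrite linear_sum [RHS]rmorph_sum; apply: eq_bigr => k _ /=.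
    by rewrite substZ linearZ /= opE_M opEx opEy mul0r add0r rmorphM /= !substX vf_l vf_r.
  apply: mpoly_eq0 => v; rewrite (@subst_vf _ _ _ _ (fun j => v (lshift n j)) (fun j => v (lshift n j))).
  - by rewrite wedge_poly_eval wedgevv /cv linear0.
  - by move=> j; rewrite vf_l mevalXU.
  by move=> j; rewrite vf_r mevalXU.
elim/mpoly_ind: G => [c|i|f g IHf IHg|f g IHf IHg].
- by rewrite substC /opE derivationC.
- by rewrite substX.
- by rewrite rmorphD linearD /= IHf IHg addr0.
- by rewrite rmorphM opE_M IHf IHg mulr0 mul0r addr0.
Qed.

Lemma homog_kernel p G : G \is p.-homog ->
  (forall x w, B (vec x) w = 0 -> poly_fun G (wedge (vec x) w) = 0) -> proj_class G = 0.
Proof.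
move=> Gp G0; pose h := subst wedge_poly G.
have hE a b : h.@[vf a b] = poly_fun G (wedge (pt a) (pt b)).
  by rewrite meval_subst poly_funE; apply: meval_eq => i; rewrite wedge_poly_eval.
have hp : bihom p p h.
  apply: bihom_eq (bihom_subst_homog (k := 1) (l := 1) _ Gp) => [||i]; rewrite ?natz //.
  apply: bihom_sum => j _; apply: bihom_sum => k _; apply: bihomZ.
  by apply: bihom_eq (bihomM (bihom_xv j) (bihom_yv k)).
have Jh : inJ h.
  apply: (inJ_vanish m_gt0 hp) => a b a0 qa ab; rewrite hE.
  have abI : incident a b by split=> //; exists i0.
  have [x [t [_ -> xw]]] := incident_point quad_q fe abI.
  by rewrite wedgeZl (poly_fun_homog _ _ Gp) G0 // mulr0.
have [r [hr rp Er]] := invariant_inJ m_gt0 hp (wedge_poly_invariant G) Jh.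
(* For p < 2 the cofactor r has negative bidegree, hence is 0; otherwise it is a form of degree p -
   2 in the Pluecker coordinates. *)
have [R [Rp RE]] : exists R : eform, 4%:R *: (Delta * R) \is p.-homog /\
    forall a b, r.@[vf a b] = poly_fun R (wedge (pt a) (pt b)).
  case: (ltnP p 2) => p2.
    exists 0; split=> [|a b]; first by rewrite mulr0 scaler0 rpred0.
    by rewrite (bihom_neg rp) ?meval0 ?poly_funE ?meval0 //; lia.
  have rp' : bihom (p - 2)%N (p - 2)%N r by apply: bihom_eq rp; lia.
  have [R [Rp RE]] := invariant_form quad_q fe rp' Er.
  exists R; split=> //; apply: rpredZ; rewrite -(subnKC p2).
  exact: dhomogM ext2_quadric_homog Rp.
(* As [LL] is twice the polar form, 4 Q1 Q2 - LL ^ 2 is four times the pull-back of [Delta]. *)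
have VG : vanishing_forms Z (G - 4%:R *: (Delta * R)).
  exists p; split; first exact: rpredB.
  move=> L [v [w [_ LE]]]; rewrite /hval; set u := vpick _.
  have /vlineP[k ->] : u \in <[wedge v w]>%VS by rewrite -LE; exact: memv_pick.
  rewrite (poly_fun_homog _ _ (rpredB Gp Rp)) poly_funB poly_funZ poly_funM.
  rewrite ext2_quadric_wedge //; last by rewrite pnatr_eq0.
  have := quad_pt quad_q fe.1 (fun i => co q e i v); rewrite -fe.2 => ->.
  have := quad_pt quad_q fe.1 (fun i => co q e i w); rewrite -fe.2 => ->.
  have := polar_pt quad_q fe.1 (fun i => co q e i v) (fun i => co q e i w).
  have := hE (fun i => co q e i v) (fun i => co q e i w).
  have := RE (fun i => co q e i v) (fun i => co q e i w).
  rewrite -!fe.2 => <- <-; rewrite hr mevalM.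
  set a := fun i => _; set b := fun i => _; rewrite mevalB rmorphXn !mevalM /=.
  have -> : Q1.@[vf a b] = qform a.
    by rewrite [LHS]qform_morph; apply: eq_qform => i /=; rewrite mevalXU vf_l.
  have -> : Q2.@[vf a b] = qform b.
    by rewrite [LHS]qform_morph; apply: eq_qform => i /=; rewrite mevalXU vf_r.
  have -> : LL.@[vf a b] = bform a b.
    by rewrite [LHS]bform_morph; apply: eq_bform => i /=; rewrite mevalXU ?vf_l ?vf_r.
  rewrite rmorph_nat => <-; move: (polar q v w) => z; rewrite [X in _ * X](_ : _ = 0) ?mulr0 //.
  ring.
have -> : G = (G - 4%:R *: (Delta * R)) + (4%:R *: R) * Delta.
  by rewrite -scalerAl (mulrC R) subrK.
rewrite proj_classD proj_classM /proj_class.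
have -> : quot_map (vanishing_forms Z) (G - 4%:R *: (Delta * R)) = 0.
  apply/quot_map_eq0; rewrite -[X in ideal_gen _ X]mul1r -[1 * _]addr0.
  exact: Ideal_genD (Ideal_gen0 _).
have -> : quot_map [set coord_class Z Delta] (quot_map (vanishing_forms Z) Delta) = 0.
  apply/quot_map_eq0; rewrite -[X in ideal_gen _ X]mul1r -[1 * _]addr0.
  exact: Ideal_genD (Ideal_gen0 _).
by rewrite rmorph0 mulr0 addr0.
Qed.
End Frame.
End Kernel.

(** * The isomorphism of graded algebras *)

Section Isomorphism.
Variables (K : numClosedFieldType) (V : vectType K) (q : V -> K).
Hypotheses (quad_q : quadratic_form q) (nondeg_q : nondegenerate_quad q).
Hypothesis dimV : (3 <= \dim {:V})%N.
Local Notation B := (polar q).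
Local Notation Q := (quadric q).
Local Notation point := (set_type Q).
Local Notation eform := {mpoly K[\dim {:ext2 V}]}.
Local Notation Z := (grassmannian2 V).
Local Notation represents := (represents nondeg_q).
Local Notation cls := (proj_class q).
Local Notation ring := (sym_tensor_ring Q).
Local Notation coord := (gralg_quot (coord_ring Z) [set coord_class Z (ext2_quadric q)]).
Implicit Types (x y : point) (u v w c : V) (G H : eform) (s : ring).

(** A frame of m + 2 vectors spans V, so dim V >= 3 forces m > 0. *)
Lemma frame_of_point : exists (m : nat) (e : 'I_m.+2 -> V), frame q e /\ (0 < m)%N.
Proof.
have [v [v0 qv]] := isotropic_exists quad_q (ltnW dimV).
have [m [e [fe _]]] := frame_exists quad_q nondeg_q v0 qv.
by exists m, e; split=> //; have := leq_trans dimV (frame_dim fe).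
Qed.

Lemma point_exists : exists x : point, True.
Proof.
have [v [v0 qv]] := isotropic_exists quad_q (ltnW dimV).
by have [x _] := vec_surj quad_q v0 qv; exists x.
Qed.

(** Extends [homog_kernel] to inhomogeneous forms: scaling w scales x wedge w, so each homogeneous
    component vanishes there separately. *)
Lemma cls_eq0 G : cls G = 0 <->
  forall x w, B (vec x) w = 0 -> poly_fun G (wedge (vec x) w) = 0.
Proof.
have [m [e [fe m0]]] := frame_of_point.
split=> [G0 x w xw|G0]; first exact: (proj_class_eval quad_q (ltnW dimV)).
rewrite (@pihomog_partitionE _ _ mdeg _ G (leqnn _)) proj_class_sum big1 // => d _.
apply: (homog_kernel quad_q fe m0 (pihomogP _ _ _)) => x w xw.
apply: pihomog_eval_eq0 => t t0; rewrite -[RHS](G0 x (t *: w)); last first.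
  by rewrite (polarZr quad_q) xw mulr0.
by rewrite wedgeZr poly_funE; apply: meval_eq => i; rewrite cvZ.
Qed.

Lemma represents_sum s : exists G, represents (val s) G.
Proof.
case: s => s /= /asboolP; elim=> [|p s1 s2 ps1 _ [G2 G2E]].
  by exists 0 => x w _; rewrite symb0 poly_funE meval0.
have [m [e [fe m0]]] := frame_of_point.
have [G1 [_ G1E]] := symb_form quad_q nondeg_q fe m0 ps1.
by exists (G1 + G2) => x w xw; rewrite symbD poly_funD G1E // G2E.
Qed.

Lemma represented G : exists s, represents (val s) G.
Proof.
have [x0 _] := point_exists.
rewrite (@pihomog_partitionE _ _ mdeg _ G (leqnn _)).
apply: (big_ind (fun G => exists s, represents (val s) G)).
- by exists 0 => x w _; rewrite symb0 poly_funE meval0.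
- move=> G1 G2 [s1 s1E] [s2 s2E]; exists (s1 + s2) => x w xw.
  by rewrite symbD poly_funD -s1E // -s2E.
move=> d _; have [s [sp sE]] := liftable_homog quad_q nondeg_q x0 (pihomogP mdeg d G).
by exists (SymTensor (asboolT (is_sym_tensor_sum1 sp))).
Qed.

(** Some form with the symbol of s is chosen; by [cls_eq0] its class does not depend on the choice,
    and the properties of the map are derived from [to_coordE]. *)
Definition to_coord s : coord := cls (sval (cid (represents_sum s))).

Lemma to_coordE s G : represents (val s) G -> to_coord s = cls G.
Proof.
move=> sG; have sH := svalP (cid (represents_sum s)).
apply/eqP; rewrite /to_coord -subr_eq0 -proj_classB; apply/eqP/cls_eq0 => x w xw.
by rewrite poly_funB -sG // -sH // subrr.
Qed.

Fact to_coord_zmod_morphism : zmod_morphism to_coord.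
Proof.
move=> s t; have [G sG] := represents_sum s; have [H tH] := represents_sum t.
rewrite (to_coordE sG) (to_coordE tH) -proj_classB; apply: to_coordE => x w xw.
rewrite poly_funB -sG // -tH //; exact: (symbB nondeg_q (val s) (val t)).
Qed.
Fact to_coord_monoid_morphism : monoid_morphism to_coord.
Proof.
split=> [|s t].
  rewrite (@to_coordE _ 1) => [|x w _]; first by rewrite /proj_class !rmorph1.
  by rewrite poly_funE meval1 -(symb_scal nondeg_q 1 x w) scal_field1.
have [G sG] := represents_sum s; have [H tH] := represents_sum t.
rewrite (to_coordE sG) (to_coordE tH) -proj_classM; apply: to_coordE => x w xw.
by rewrite symbM poly_funM sG // tH.
Qed.
HB.instance Definition _ :=
  GRing.isZmodMorphism.Build ring coord to_coord to_coord_zmod_morphism.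
HB.instance Definition _ :=
  GRing.isMonoidMorphism.Build ring coord to_coord to_coord_monoid_morphism.

Lemma to_coord_scal (c : K) : to_coord (sym_tensor_scal Q c) = cls c%:MP.
Proof. by apply: to_coordE => x w _; rewrite symb_scal poly_funE mevalC. Qed.

(** A tensor whose form has class 0 has zero symbol, and is then 0 by [symb_eq0]. *)
Lemma to_coord_inj : injective to_coord.
Proof.
move=> s t e; apply/eqP; rewrite -subr_eq0; apply/eqP/val_inj.
apply: (symb_eq0 quad_q (nondeg_q := nondeg_q)); first exact: asboolW (valP (s - t)).
have [G GE] := represents_sum (s - t) => x w xw; rewrite GE //.
by move: x w xw; apply/cls_eq0; rewrite -(to_coordE GE) rmorphB /= e subrr.
Qed.

Theorem tensors_isomorphic : gralg_isomorphic (sym_tensor_gralg Q) coord.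
Proof.
exists (to_coord : {rmorphism _ -> _}); split.
- have surj z : exists s, to_coord s = z.
    have [G ->] := proj_class_surj z; have [s sG] := represented G.
    by exists s; exact: to_coordE.
  pose g z := sval (cid (surj z)); have gK z : to_coord (g z) = z := svalP (cid (surj z)).
  by exists g => // s; exact: to_coord_inj.
- exact: to_coord_scal.
move=> p; apply/seteqP; split=> [_ [s /= sp <-]|_ [_ [G /= Gp <-] <-]].
  have [m [e [fe m0]]] := frame_of_point.
  have [G [Gp GE]] := symb_form quad_q nondeg_q fe m0 sp.
  by rewrite (to_coordE GE); exists (quot_map (vanishing_forms Z) G) => //; exists G.
have [x0 _] := point_exists.
have [s [sp sE]] := liftable_homog quad_q nondeg_q x0 Gp.
by exists (SymTensor (asboolT (is_sym_tensor_sum1 sp))) => //; exact: to_coordE.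
Qed.
End Isomorphism.

Theorem proposition3 (R : realType) (V : vectType R[i]) (q : V -> R[i])
    (dimV : (3 <= \dim {:V})%N) (quad_q : quadratic_form q)
    (nondeg_q : nondegenerate_quad q) :
  gralg_isomorphic (sym_tensor_gralg (quadric q))
    (gralg_quot (coord_ring (grassmannian2 V))
       [set coord_class (grassmannian2 V) (ext2_quadric q)]).
Proof. exact: (@tensors_isomorphic _ V). Qed.
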